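(* Let $R_{\mathrm{tot}}=\sum_{\ell=0}^{L-1}R_\ell$ and $$D_{\mathrm{opt}}(R_{\mathrm{tot}})=\min_{0\prec K\preceq\Sigma_X}\left\{\mathrm{tr}(\tilde WK):\ \frac12\log\frac{\det\Sigma_X}{\det K}\le R_{\mathrm{tot}}\right\}.$$ Then any mechanism (sequence of representations $H^{(0)},\dots,H^{(L)}$) satisfying $$I\big(X;H^{(\ell+1)}\mid H^{(\ell)}\big)\le R_\ell,\qquad\ell=0,\dots,L-1,$$ must obey $$\mathrm{tr}(\tilde WK_X^{(L)})\ge D_{\mathrm{opt}}(R_{\mathrm{tot}}),$$ and this lower bound is achievable by a Gaussian test channel. Moreover, if $\tilde W\succ0$ and the optimizer satisfies the interior condition $K^\star\prec\Sigma_X$, then the unique optimum is $$K^\star(R_{\mathrm{tot}})=\nu^\star(R_{\mathrm{tot}})\,\tilde W^{-1},\qquad\nu^\star(R_{\mathrm{tot}})=\exp\!\left(\frac1k\big[\log\det\Sigma_X+\log\det\tilde W-2R_{\mathrm{tot}}\big]\right),$$ and the optimal semantic distortion decays exponentially: $$D_{\mathrm{opt}}(R_{\mathrm{tot}})=k\,(\det\Sigma_X\,\det\tilde W)^{1/k}\exp\!\left(-2\frac{R_{\mathrm{tot}}}{k}\right).$$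
   Context: $X\sim\mathcal N(0,\Sigma_X)$ in $\mathbb R^k$ with $\Sigma_X\succ0$; $B\in\mathbb R^{k\times k}$; $W_e\succ0$ is a symmetric $k\times k$ matrix; $\tilde W=W_e(B-I)+(B-I)^\top W_e+W_e$ (symmetric). The representations are generated sequentially by $H^{(\ell+1)}\sim p_\ell(\cdot\mid H^{(\ell)},Z)$, $\ell=0,\dots,L-1$, from data $Z$ correlated with $X$, with possibly randomized update rules $p_\ell$, so that $X-(H^{(\ell)},Z)-H^{(\ell+1)}$ is a Markov chain. $K_X^{(\ell)}=\Sigma_{X\mid H^{(\ell)}}$, where $\Sigma_{X\mid U}=\mathbb E[(X-\mathbb E[X\mid U])(X-\mathbb E[X\mid U])^\top]$, and it is assumed that $K_X^{(0)}=\Sigma_X$. Achievability by a Gaussian test channel means: by a Gaussian auxiliary $U=X+N$, with $N$ Gaussian independent of $X$, inducing $\Sigma_{X\mid U}=K$ with $I(X;U)=\frac12\log\frac{\det\Sigma_X}{\det K}\le R_{\mathrm{tot}}$ for the optimal $K$. Logarithms are natural; $\preceq$ is the Loewner order.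
   Formalization: The initial representation H^(0) is assumed independent of X (K_X^(0)=Σ_X alone makes the bound false, e.g. H^(0)=|X|, H^(1)=X); the test channel is U=X+N when K≺Σ_X, and U=AX+N when Σ_X−K is singular, where U=X+N cannot induce K. *)

(* Defs.v *)
(* MathComp / MathComp-Analysis. *)
From HB Require Import structures.
From mathcomp Require Import all_boot all_order all_algebra.
From mathcomp Require Import all_classical all_reals all_analysis.

Set Implicit Arguments.
Unset Strict Implicit.
Unset Printing Implicit Defensive.

Import Order.TTheory GRing.Theory Num.Theory.
Import numFieldNormedType.Exports.

Local Open Scope classical_set_scope.
Local Open Scope ring_scope.

Section loewner.
Context {R : realType} {k : nat}.
Implicit Types M N : 'M[R]_k.

Definition psdmx M : Prop :=
  M^T = M /\ forall v : 'cV[R]_k, 0 <= (v^T *m M *m v) 0 0.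

Definition pdmx M : Prop :=
  M^T = M /\ forall v : 'cV[R]_k, v != 0 -> 0 < (v^T *m M *m v) 0 0.

Definition loewner_le M N : Prop := psdmx (N - M).
Definition loewner_lt M N : Prop := pdmx (N - M).

End loewner.

Section conditioning.
Context {R : realType} {d} {T : measurableType d} (P : probability T R).

(* g is a regression function of f on U: E[f | U] = g(U) almost surely. *)
Definition is_regression d' (TU : measurableType d') (U : T -> TU)
    (f : T -> R) (g : TU -> R) : Prop :=
  [/\ measurable_fun setT g,
      P.-integrable setT (EFin \o (g \o U)) &
      forall C, measurable C ->
        (\int[P]_(t in U @^-1` C) (g (U t))%:E =
         \int[P]_(t in U @^-1` C) (f t)%:E)%E].

(* A version of E[f | U], meaningful for integrable f; markov_chain,
   cond_mutual_info and cond_cov do not depend on the choice of the version. *)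
Definition cond_exp d' (TU : measurableType d') (U : T -> TU) (f : T -> R) :
    T -> R :=
  xget (fun=> 0) [set g | is_regression U f g] \o U.

Definition cond_prob d' (TU : measurableType d') (U : T -> TU) (E : set T) :
    T -> R :=
  cond_exp U \1_E.

Definition indep_rv d1 (T1 : measurableType d1) d2 (T2 : measurableType d2)
    (X : T -> T1) (Y : T -> T2) : Prop :=
  forall A B, measurable A -> measurable B ->
    (P (X @^-1` A `&` Y @^-1` B) = P (X @^-1` A) * P (Y @^-1` B))%E.

(* X - V - Y : X and Y are conditionally independent given V. *)
Definition markov_chain d1 (T1 : measurableType d1) d2 (T2 : measurableType d2)
    d3 (T3 : measurableType d3) (X : T -> T1) (V : T -> T2) (Y : T -> T3)
    : Prop :=
  forall A B, measurable A -> measurable B ->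
    {ae P, forall t, cond_prob V (X @^-1` A `&` Y @^-1` B) t =
                     cond_prob V (X @^-1` A) t * cond_prob V (Y @^-1` B) t}.

End conditioning.

Section information.
Context {R : realType}.

Definition finite_partition d (T : measurableType d) n (A : 'I_n -> set T)
    : Prop :=
  [/\ forall i, measurable (A i), trivIset setT A & \bigcup_i A i = setT].

(* sum_ij p_ij ln (p_ij / (p_i q_j)) in nats; since 0 * x = 0 this follows the
   convention 0 ln 0 = 0. *)
Definition discrete_info n m (pq : 'I_n -> 'I_m -> R) (p : 'I_n -> R)
    (q : 'I_m -> R) : R :=
  \sum_(i < n) \sum_(j < m) pq i j * ln (pq i j / (p i * q j)).

Context {d} {T : measurableType d} (P : probability T R).

(* I(X;Y) for arbitrary measurable spaces: the supremum over finite measurable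
   quantizations of X and Y of the discrete mutual information. *)
Definition mutual_info d1 (T1 : measurableType d1) d2 (T2 : measurableType d2)
    (X : T -> T1) (Y : T -> T2) : \bar R :=
  ereal_sup [set I : \bar R |
    exists n m (A : 'I_n -> set T1) (B : 'I_m -> set T2),
    [/\ finite_partition A, finite_partition B &
      I = (discrete_info
        (fun i j => fine (P (X @^-1` A i `&` Y @^-1` B j)))
        (fun i => fine (P (X @^-1` A i)))
        (fun j => fine (P (Y @^-1` B j))))%:E]].

(* I(X;Y|V) for arbitrary measurable spaces (Dobrushin, Wyner): the same
   supremum, with conditional probabilities given V, averaged over V.  It needs
   no regular conditional distributions. *)
Definition cond_mutual_info d1 (T1 : measurableType d1)
    d2 (T2 : measurableType d2) d3 (T3 : measurableType d3)
    (X : T -> T1) (Y : T -> T2) (V : T -> T3) : \bar R :=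
  ereal_sup [set I : \bar R |
    exists n m (A : 'I_n -> set T1) (B : 'I_m -> set T2),
    [/\ finite_partition A, finite_partition B &
      (I = \int[P]_t (discrete_info
        (fun i j => cond_prob P V (X @^-1` A i `&` Y @^-1` B j) t)
        (fun i => cond_prob P V (X @^-1` A i) t)
        (fun j => cond_prob P V (Y @^-1` B j) t))%:E)%E]].

End information.

(* Random vectors of R^k take values in k.-tuple R, which carries the product
   (= Borel) sigma-algebra; colv turns their values into column vectors. *)
Definition colv {R : realType} {k : nat} (x : k.-tuple R) : 'cV[R]_k :=
  \col_i tnth x i.

Section random_vectors.
Context {R : realType} {k : nat} {d} {T : measurableType d}.
Variable P : probability T R.

Definition iid_std_normal r (G : 'I_r -> {RV P >-> R}) : Prop :=
  forall C : 'I_r -> set R, (forall i, measurable (C i)) ->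
    (P (\bigcap_i (G i @^-1` C i)) = \prod_(i < r) normal_prob 0 1 (C i))%E.

(* X ~ N(0, S): X = A G almost surely with G standard Gaussian in some R^r and
   A A^T = S.  S may be singular. *)
Definition centered_gaussian (X : T -> k.-tuple R) (S : 'M[R]_k) : Prop :=
  exists (r : nat) (A : 'M[R]_(k, r)) (G : 'I_r -> {RV P >-> R}),
    [/\ iid_std_normal G, A *m A^T = S &
        {ae P, forall t, colv (X t) = A *m \col_i G i t}].

Definition cond_residual d' (TU : measurableType d') (U : T -> TU)
    (X : T -> k.-tuple R) (t : T) : 'cV[R]_k :=
  \col_i (tnth (X t) i - cond_exp P U (fun s => tnth (X s) i) t).

(* Sigma_{X|U} = E[(X - E[X|U]) (X - E[X|U])^T] *)
Definition cond_cov d' (TU : measurableType d') (U : T -> TU)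
    (X : T -> k.-tuple R) : 'M[R]_k :=
  \matrix_(i, j)
    fine ('E_P[fun t => (cond_residual U X t *m (cond_residual U X t)^T) i j]).

End random_vectors.

Section rate_distortion.
Context {R : realType} {k : nat}.
Implicit Types S W We B K : 'M[R]_k.

Definition Wtilde We B : 'M[R]_k :=
  We *m (B - 1%:M) + (B - 1%:M)^T *m We + We.

Definition feasible S (r : R) K : Prop :=
  [/\ pdmx K, loewner_le K S & 2^-1 * ln (\det S / \det K) <= r].

(* The value of min tr(W K) over feasible K; that the minimum is attained is
   stated separately through is_optimal. *)
Definition Dopt S W (r : R) : R :=
  inf [set \tr (W *m K) | K in [set K | feasible S r K]].

Definition is_optimal S W (r : R) K : Prop :=
  feasible S r K /\ forall K', feasible S r K' -> \tr (W *m K) <= \tr (W *m K').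

(* A Gaussian test channel for X ~ N(0, S), at rate at most r, whose error
   covariance is K.  The channel is U = X + N when K < S.  When S - K is
   singular no finite noise covariance gives Sigma_{X|U} = K (the noise would be
   infinite along ker (S - K)), and the channel is U = A X + N. *)
Definition gaussian_test_channel S (r : R) K : Prop :=
  exists d (T : measurableType d) (P : probability T R)
    (X N U : {RV P >-> k.-tuple R}) (A SN : 'M[R]_k),
    [/\ centered_gaussian P X S, centered_gaussian P N SN & indep_rv P X N] /\
    [/\ forall t, colv (U t) = A *m colv (X t) + colv (N t),
        loewner_lt K S -> A = 1%:M,
        cond_cov P U X = K,
        mutual_info P X U = (2^-1 * ln (\det S / \det K))%:E &
        (mutual_info P X U <= r%:E)%E].

End rate_distortion.

(* A mechanism H^(0), ..., H^(L) for X ~ N(0, S) from the data Z, with rate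
   budgets r_0, ..., r_(L-1).  The families are indexed by nat, but only the
   indices at most L are constrained.  The initial representation is
   uninformative: it is independent of X, which is more than
   Sigma_{X|H^(0)} = S.  The latter alone allows H^(0) = |X| for k = 1, which
   carries unbounded information about X. *)
Definition mechanism {R : realType} {k : nat} (S : 'M[R]_k) (L : nat)
    (r : nat -> R) d (T : measurableType d) (P : probability T R)
    (X : {RV P >-> k.-tuple R}) dZ (TZ : measurableType dZ)
    (Z : {RV P >-> TZ}) (dH : nat -> measure_display)
    (TH : forall l, measurableType (dH l))
    (H : forall l, {RV P >-> TH l}) : Prop :=
  [/\ centered_gaussian P X S,
      cond_cov P (H 0%N) X = S,
      indep_rv P X (H 0%N),
      (forall l, (l < L)%N ->
         markov_chain P X (fun t => (H l t, Z t)) (H l.+1)) &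
      (forall l, (l < L)%N ->
         (cond_mutual_info P X (H l.+1) (H l) <= (r l)%:E)%E)].

(* Main.v *)
(* Converse.  For a finite partition A of the space of X, let h(V) be the
   expectation of sum_i pi_i ln pi_i, where pi_i is the posterior probability of
   A_i given V.  Quantizing H^(l+1) along the values of these posteriors shows
   that the conditional information bounds the increment
   h(H^(l+1)) - h(H^(l)), and h(H^(0)) is the entropy term of the prior, so that
   h(H^(L)) - sum_i P(A_i) ln P(A_i) <= Rtot.  By the tangent inequality of
   y ln y, h(V) dominates any expected log-likelihood; taken with the Gaussian
   density N(E[X|V], Q^-1), Q = (K + e I)^-1, averaged over the cells of a fine
   grid, this yields 1/2 ln (det SX / det (K + e I)) <= Rtot for K = Sigma_{X|V}.
   Hence K is feasible.

   Achievability.  Write SX - K = F1 F1^T, K = F2 F2^T and X = F1 g1 + F2 g2 with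
   g1, g2 standard.  Up to a linear change of variable, U = F1 g1: the residual
   F2 g2 is independent of U, and U - A X is independent of X when it is
   uncorrelated with X, by rotation invariance.  The information is bounded above
   through the density ratio of (X, U), and below by the converse bound itself.

   Interior optimum.  By ln det M <= tr M - k, K0 = nu W^-1 is the unique
   minimizer of the trace under the rate constraint alone.  From an optimizer
   K < SX other than K0, a small step towards K0 would stay feasible, since the
   superlevel sets of det are convex, and would lower the trace. *)

Require Import Defs.
From HB Require Import structures.
From mathcomp Require Import all_boot all_order all_algebra all_fingroup.
From mathcomp Require Import all_classical all_reals all_analysis.
From mathcomp Require Import measurable_realfun ring lra.

Set Implicit Arguments.
Unset Strict Implicit.
Unset Printing Implicit Defensive.

Import Order.TTheory GRing.Theory Num.Theory.
Import numFieldNormedType.Exports.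

Local Open Scope classical_set_scope.
Local Open Scope ring_scope.

(** * Positive semidefinite matrices *)

(** Mutual information is a supremum over finite quantizations of arbitrary measurable spaces, so
    neither densities of the representations nor regular conditional laws are at hand. Rates are
    therefore carried by [cond_xlnx], and everything Gaussian is isolated in
    [gaussian_information_bound], whose only information-theoretic input compares [cond_xlnx] with
    the prior term. A single mutual information satisfies the same comparison, which is why the
    converse also bounds the test channel from below.

    The delicate point is that the test density must be averaged over cells. Only its term bilinear
    in X and E[X|V] suffers; the loss is controlled by the quantization error of X and Young's
    inequality, since E[X|V] is merely square integrable. The other terms integrate to ln det(Q SX)
    / 2 + (k - tr(Q K)) / 2, whence the condition tr(Q K) <= k on Q.

    Gaussian integrals use the standard measure [gauss n] as reference, with affine changes of
    variables obtained from the LUP factorization; Cholesky factors take the place of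
    eigenvalues. *)

Section matrix.
Context {R : realType}.

(** Sylvester's identity: the block matrix with unit diagonal blocks is eliminated from either
    corner. With m different from n it brings a determinant from the dimension of the driving noise
    down to k. *)
Lemma det_1_mulmx m n (A : 'M[R]_(m, n)) (B : 'M[R]_(n, m)) :
  \det (1%:M + A *m B) = \det (1%:M + B *m A).
Proof.
have E1 : block_mx 1%:M A (- B) 1%:M =
    block_mx 1%:M 0 (- B) 1%:M *m block_mx 1%:M A 0 (1%:M + B *m A).
  by rewrite mulmx_block !mul1mx !mulmx1 !mul0mx ?mulmx0 !addr0 mulNmx
     (addrC 1%:M) addKr.
have E2 : block_mx 1%:M A (- B) 1%:M =
    block_mx (1%:M + A *m B) A 0 1%:M *m block_mx 1%:M 0 (- B) 1%:M.
  by rewrite mulmx_block !mul1mx !mulmx1 !mul0mx ?mulmx0 !add0r mulmxN addrK.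
have := congr1 determinant E1; rewrite E2 !det_mulmx.
by rewrite !det_lblock !det_ublock !det1 !mul1r !mulr1.
Qed.

(** These rules unfold the outer operation only, whereas [mxE] would also expand matrix products
    into sums. *)
Lemma addmxE m n (A B : 'M[R]_(m, n)) i j : (A + B) i j = A i j + B i j.
Proof. by rewrite mxE. Qed.

Lemma oppmxE m n (A : 'M[R]_(m, n)) i j : (- A) i j = - A i j.
Proof. by rewrite mxE. Qed.

Lemma scalemxE m n a (A : 'M[R]_(m, n)) i j : (a *: A) i j = a * A i j.
Proof. by rewrite mxE. Qed.

Lemma sqnorm_ge0 n (v : 'cV[R]_n) : 0 <= (v^T *m v) 0 0.
Proof. by rewrite mxE sumr_ge0// => i _; rewrite mxE -expr2 sqr_ge0. Qed.

Lemma sqnorm_eq0 n (v : 'cV[R]_n) : (v^T *m v) 0 0 = 0 -> v = 0.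
Proof.
rewrite mxE => /psumr_eq0P v0; apply/colP => i; rewrite mxE.
have /eqP : (v^T 0 i) * v i 0 = 0.
  by apply: v0 => // j _; rewrite mxE -expr2 sqr_ge0.
by rewrite mxE mulf_eq0 orbb => /eqP.
Qed.

Lemma sqnorm_gt0 n (v : 'cV[R]_n) : v != 0 -> 0 < (v^T *m v) 0 0.
Proof.
move=> v0; rewrite lt_neqAle sqnorm_ge0 andbT eq_sym.
by apply: contraNneq v0 => /sqnorm_eq0 ->.
Qed.

Lemma bilin_sym n (M : 'M[R]_n) (u v : 'cV[R]_n) : M^T = M ->
  (u^T *m M *m v) 0 0 = (v^T *m M *m u) 0 0.
Proof.
move=> sM.
have -> : u^T *m M *m v = (v^T *m M *m u)^T.
  by rewrite !trmx_mul trmxK sM mulmxA.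
by rewrite mxE.
Qed.

Lemma pdmx_psdmx n (M : 'M[R]_n) : pdmx M -> psdmx M.
Proof.
case=> sM pM; split=> // v; have [->|/pM/ltW//] := eqVneq v 0.
by rewrite mulmx0 mxE.
Qed.

Lemma psdmx_congr m n (M : 'M[R]_n) (F : 'M[R]_(n, m)) :
  psdmx M -> psdmx (F^T *m M *m F).
Proof.
case=> sM pM; split; first by rewrite !trmx_mul trmxK sM mulmxA.
by move=> v; rewrite !mulmxA -trmx_mul -mulmxA; exact: pM.
Qed.

Lemma psdmx_mulmxT m n (F : 'M[R]_(m, n)) : psdmx (F *m F^T).
Proof.
split; first by rewrite trmx_mul trmxK.
move=> v; have -> : v^T *m (F *m F^T) *m v = (F^T *m v)^T *m (F^T *m v).
  by rewrite trmx_mul trmxK !mulmxA.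
exact: sqnorm_ge0.
Qed.

(** Along the direction [w = M *m v] the form takes the values [2 t N + t^2 c], with [N] the squared
    norm of [w]; they are nonnegative for all t only if [N] vanishes. *)
Lemma psdmx_ker n (M : 'M[R]_n) (v : 'cV[R]_n) :
  psdmx M -> (v^T *m M *m v) 0 0 = 0 -> M *m v = 0.
Proof.
case=> sM pM v0; apply/sqnorm_eq0; apply/eqP.
rewrite eq_le sqnorm_ge0 andbT leNgt; apply/negP.
set w := M *m v; set N : R := (w^T *m w) 0 0; set c : R := (w^T *m M *m w) 0 0 => N0.
have c0 : 0 <= c by exact: pM.
have wMv : (w^T *m M *m v) 0 0 = N by rewrite -mulmxA.
have key t : 0 <= 2 * t * N + t ^+ 2 * c.
  have := pM (v + t *: w); rewrite [(_ + _)^T]linearD/= [(_ *: _)^T]linearZ/= !mulmxDl !mulmxDr.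
  rewrite -!scalemxAr -!scalemxAl !(addmxE, scalemxE) v0.
  rewrite (bilin_sym v w sM) wMv -/c => /le_trans; apply.
  by rewrite le_eqVlt; apply/orP; left; apply/eqP; ring.
have c1 : 0 < c + 1 by exact: ltr_wpDl.
(* The minimizer would be -N / c; [c + 1] avoids a division by zero and the value is still
   negative. *)
have := key (- N / (c + 1)); rewrite leNgt => /negP; apply.
have -> : 2 * (- N / (c + 1)) * N + (- N / (c + 1)) ^+ 2 * c =
    - (N ^+ 2 * (c + 2)) / (c + 1) ^+ 2 by field; exact: lt0r_neq0.
by rewrite mulNr oppr_lt0 divr_gt0 ?exprn_gt0// mulr_gt0 ?exprn_gt0 ?ltr_wpDl.
Qed.

(** Induction on the size through the Schur complement. Singular matrices are included, as needed
    later to factor [S - K]. *)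
Lemma psdmx_cholesky n (M : 'M[R]_n) : psdmx M ->
  exists L : 'M[R]_n,
    [/\ is_trig_mx L, forall i, 0 <= L i i & M = L *m L^T].
Proof.
elim: n M => [M _|n IH M].
  by exists 0; split; [exact: mx0_is_trig|case|apply/matrixP; case].
rewrite -[n.+1]/(1 + n)%N in M *; move=> psdM.
have [sM pM] := psdM.
pose a := ulsubmx M; pose bT := ursubmx M.
pose b := dlsubmx M; pose D := drsubmx M.
have [sD bTE] : D^T = D /\ bT = b^T.
  by rewrite /D /bT /b trmx_drsub trmx_dlsub sM.
have qM : M = block_mx a bT b D by rewrite submxK.
have a0 : 0 <= a 0 0.
  have := pM (col_mx (1%:M : 'M[R]_1) (0 : 'cV_n)); rewrite qM tr_col_mx trmx1 trmx0.
  by rewrite mul_row_block !mul1mx !mul0mx !addr0 mul_row_col mulmx1 mulmx0 addr0.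
pose F (c : 'rV[R]_n) := block_mx 1%:M c 0 1%:M : 'M[R]_(1 + n).
have schur c : (F c)^T *m M *m F c = block_mx a (a *m c + bT)
      (c^T *m a + b) (c^T *m a *m c + b *m c + c^T *m bT + D).
  rewrite qM tr_block_mx !trmx1 trmx0 mulmx_block !mul1mx !mul0mx !addr0.
  rewrite mulmx_block !mulmx1 ?mulmx0 !addr0 mulmxDl.
  by rewrite -!addrA.
have aE : a = (a 0 0)%:M by exact: mx11_scalar.
(* A zero pivot puts the first basis vector into the kernel, so the column below it vanishes and the
   recursion is on [D] itself. *)
have [a_eq0|a_neq0] := eqVneq (a 0 0) 0.
  have b0 : b = 0.
    have /(psdmx_ker psdM) : ((col_mx 1%:M 0 : 'cV_(1 + n))^T *m M *m
        (col_mx 1%:M 0 : 'cV_(1 + n))) 0 0 = 0.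
      rewrite qM tr_col_mx trmx1 trmx0.
      rewrite mul_row_block !mul1mx !mul0mx !addr0 mul_row_col mulmx1 mulmx0.
      by rewrite addr0.
    rewrite qM mul_block_col !mulmx1 ?mulmx0 !addr0 => /(congr1 dsubmx).
    by rewrite col_mxKd => ->; apply/matrixP => i j; rewrite !mxE.
  have psdD : psdmx D.
    split=> // v; have := pM (col_mx (0 : 'cV_1) v); rewrite qM tr_col_mx trmx0.
    rewrite mul_row_block !mul0mx !add0r mul_row_col.
    by rewrite mulmx0 add0r.
  have [L [tL dL DE]] := IH _ psdD.
  exists (block_mx 0 0 0 L); split.
  - by rewrite is_trig_block_mx// eqxx tL mx11_is_trig.
  - move=> i; case: (split_ordP (i : 'I_(1 + n))) => j ->.
      by rewrite block_mxEul mxE.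
    by rewrite block_mxEdr.
  - rewrite qM bTE b0 trmx0 aE a_eq0 DE tr_block_mx !trmx0 mulmx_block.
    by rewrite !mul0mx ?mulmx0 !addr0 !add0r raddf0.
have agt0 : 0 < a 0 0 by rewrite lt_neqAle eq_sym a_neq0.
set l := Num.sqrt (a 0 0).
have l0 : l != 0 by rewrite gt_eqF// sqrtr_gt0.
have l2 : l * l = a 0 0 by rewrite -expr2 sqr_sqrtr.
(* Congruence by [F c] with c = - bT / a clears the border and leaves the Schur complement as lower
   block. *)
have psdS : psdmx (D - (a 0 0)^-1 *: (b *m b^T)).
  have := psdmx_congr (F (- (a 0 0)^-1 *: bT)) psdM; rewrite schur.
  have -> : (- (a 0 0)^-1 *: bT)^T *m a = - b.
    rewrite bTE linearZ/= trmxK aE -scalemxAl mul_mx_scalar scalerA mxE /= mulr1n.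
    by rewrite mulNr mulVf// scaleN1r.
  have -> : - b *m (- (a 0 0)^-1 *: bT) + b *m (- (a 0 0)^-1 *: bT) +
      (- (a 0 0)^-1 *: bT)^T *m bT + D = D - (a 0 0)^-1 *: (b *m b^T).
    by rewrite mulNmx addNr add0r bTE linearZ/= trmxK -scalemxAl scaleNr addrC.
  move=> -[sS pS]; split.
    by move/(congr1 drsubmx): sS; rewrite tr_block_mx !block_mxKdr.
  move=> v; have := pS (col_mx (0 : 'cV_1) v); rewrite tr_col_mx trmx0.
  by rewrite mul_row_block !mul0mx ?mulmx0 !add0r mul_row_col mulmx0 add0r.
have [L [tL dL DE]] := IH _ psdS.
exists (block_mx l%:M 0 (l^-1 *: b) L); split.
- by rewrite is_trig_block_mx// eqxx tL mx11_is_trig.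
- move=> i; case: (split_ordP (i : 'I_(1 + n))) => j ->.
    by rewrite block_mxEul mxE ord1 eqxx mulr1n sqrtr_ge0.
  by rewrite block_mxEdr.
- rewrite [LHS]qM tr_block_mx !trmx0 mulmx_block !mul0mx ?mulmx0 !addr0 -DE.
  rewrite tr_scalar_mx [(_ *: b)^T]linearZ/= -bTE; congr block_mx.
  + by rewrite mul_scalar_mx scale_scalar_mx l2 -aE.
  + by rewrite mul_scalar_mx scalerA mulfV// scale1r.
  + by rewrite mul_mx_scalar scalerA mulfV// scale1r.
  + by rewrite -scalemxAr -scalemxAl scalerA -invfM l2 addrC subrK.
Qed.

Lemma mxtrace_mulmxT n (L : 'M[R]_n) : \tr (L *m L^T) = \sum_i \sum_j L i j ^+ 2.
Proof.
by apply: eq_bigr => i _; rewrite mxE; apply: eq_bigr => j _; rewrite mxE expr2.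
Qed.

Lemma pdmx_det_gt0 n (M : 'M[R]_n) : pdmx M -> 0 < \det M.
Proof.
move=> pdM; have [L [tL L0 ML]] := psdmx_cholesky (pdmx_psdmx pdM).
rewrite ML det_mulmx det_tr -expr2 exprn_even_gt0//=.
apply/negP => /det0P[v v0 vL]; have vT0 : v^T != 0 by rewrite trmx_eq0.
have := pdM.2 _ vT0; rewrite trmxK ML mulmxA vL !mul0mx mxE.
by rewrite ltxx.
Qed.

Lemma pdmx_unit n (M : 'M[R]_n) : pdmx M -> M \in unitmx.
Proof. by move=> /pdmx_det_gt0/lt0r_neq0; rewrite unitmxE unitfE. Qed.

Lemma psdmx_det_gt0 n (M : 'M[R]_n) : psdmx M -> 0 < \det M -> pdmx M.
Proof.
move=> psdM dM; have [sM pM] := psdM; split=> // v v0.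
rewrite lt_neqAle pM andbT eq_sym; apply: contraNneq v0 => /(psdmx_ker psdM) Mv0.
have uM : M \in unitmx by rewrite unitmxE unitfE gt_eqF.
by rewrite -(mulKmx uM v) Mv0 mulmx0.
Qed.

Lemma pdmx_cholesky n (M : 'M[R]_n) : pdmx M ->
  exists L : 'M[R]_n,
    [/\ is_trig_mx L, forall i, 0 < L i i & M = L *m L^T].
Proof.
move=> pdM; have [L [tL L0 ML]] := psdmx_cholesky (pdmx_psdmx pdM).
exists L; split=> // i; rewrite lt_neqAle L0 andbT eq_sym.
have := pdmx_det_gt0 pdM; rewrite ML det_mulmx det_tr -expr2.
rewrite exprn_even_gt0//= det_trig// => /prodf_neq0; exact.
Qed.

Lemma pdmx_congr n (M F : 'M[R]_n) :
  pdmx M -> F \in unitmx -> pdmx (F^T *m M *m F).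
Proof.
move=> pdM uF; apply: psdmx_det_gt0; first exact/psdmx_congr/pdmx_psdmx.
rewrite !det_mulmx det_tr mulrAC -expr2 mulr_gt0 ?pdmx_det_gt0//.
by rewrite exprn_even_gt0//= -unitfE -unitmxE.
Qed.

Lemma pdmx_inv n (M : 'M[R]_n) : pdmx M -> pdmx (invmx M).
Proof.
move=> pdM; have uM := pdmx_unit pdM; have [sM _] := pdM.
have := pdmx_congr pdM (_ : invmx M \in unitmx).
rewrite unitmx_inv trmx_inv sM mulVmx// mul1mx; exact.
Qed.

Lemma psdmxD n (M N : 'M[R]_n) : psdmx M -> psdmx N -> psdmx (M + N).
Proof.
move=> [sM pM] [sN pN]; split=> [|v]; first by rewrite linearD/= sM sN.
by rewrite mulmxDr mulmxDl addmxE addr_ge0.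
Qed.

Lemma pdmxD n (M N : 'M[R]_n) : psdmx M -> pdmx N -> pdmx (M + N).
Proof.
move=> [sM pM] [sN pN]; split=> [|v v0]; first by rewrite linearD/= sM sN.
by rewrite mulmxDr mulmxDl addmxE ltr_wpDl// pN.
Qed.

Lemma psdmxZ n a (M : 'M[R]_n) : 0 <= a -> psdmx M -> psdmx (a *: M).
Proof.
move=> a0 [sM pM]; split=> [|v]; first by rewrite linearZ/= sM.
by rewrite -scalemxAr -scalemxAl scalemxE mulr_ge0.
Qed.

Lemma pdmxZ n a (M : 'M[R]_n) : 0 < a -> pdmx M -> pdmx (a *: M).
Proof.
move=> a0 [sM pM]; split=> [|v v0]; first by rewrite linearZ/= sM.
by rewrite -scalemxAr -scalemxAl scalemxE mulr_gt0// pM.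
Qed.

Lemma pdmx1 n : pdmx (1%:M : 'M[R]_n).
Proof. by split=> [|v v0]; rewrite ?trmx1// mulmx1 sqnorm_gt0. Qed.

Lemma ln_lt_subr1 (x : R) : 0 < x -> x != 1 -> ln x < x - 1.
Proof.
move=> x0 x1; rewrite -[ltRHS]expRK ltr_ln ?posrE ?expR_gt0//.
by have := @expR_gt1Dx R (x - 1); rewrite subr_eq0 addrC subrK => /(_ x1).
Qed.

Lemma ln_le_subr1 (x : R) : 0 < x -> ln x <= x - 1.
Proof.
by move=> x0; have [->|/(ln_lt_subr1 x0)/ltW//] := eqVneq x 1; rewrite ln1 subrr.
Qed.

Lemma ln_prodr (I : finType) (f : I -> R) :
  (forall i, 0 < f i) -> ln (\prod_i f i) = \sum_i ln (f i).
Proof.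
move=> f0; suff [] : 0 < \prod_i f i /\ ln (\prod_i f i) = \sum_i ln (f i) by [].
elim/big_rec2: _ => [|i x y _ [y0 <-]]; first by rewrite ln1.
by split; rewrite ?mulr_gt0// lnM ?posrE.
Qed.

(* With M = L L^T, \tr M - ln (\det M) is the sum of the squared off-diagonal
   entries of L and of the numbers x - ln x for x = (L i i)^2. *)
Lemma ln_det_le_mxtrace n (M : 'M[R]_n) : pdmx M ->
  ln (\det M) <= \tr M - n%:R /\
  (\tr M - n%:R <= ln (\det M) -> M = 1%:M).
Proof.
move=> pdM; have [L [tL L0 ML]] := pdmx_cholesky pdM.
have Lpos i : 0 < L i i ^+ 2 by rewrite exprn_gt0.
have ldE : ln (\det M) = \sum_i ln (L i i ^+ 2).
  by rewrite ML det_mulmx det_tr -expr2 det_trig// -prodrXl ln_prodr.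
have trE : \tr M - n%:R =
    \sum_i (L i i ^+ 2 - 1) + \sum_i \sum_(j | j != i) L i j ^+ 2.
  have -> : n%:R = \sum_(i < n) (1 : R) by rewrite sumr_const card_ord.
  rewrite ML mxtrace_mulmxT -sumrB -big_split/=; apply: eq_bigr => i _.
  by rewrite (bigD1 i)//= addrAC.
have off0 i j : 0 <= L i j ^+ 2 by exact: sqr_ge0.
have dle i : ln (L i i ^+ 2) <= L i i ^+ 2 - 1 by exact: ln_le_subr1.
have off : 0 <= \sum_i \sum_(j | j != i) L i j ^+ 2.
  by apply: sumr_ge0 => i _; exact: sumr_ge0.
have dsum : \sum_i ln (L i i ^+ 2) <= \sum_i (L i i ^+ 2 - 1) by exact: ler_sum.
rewrite ldE trE; split; first exact: ler_wpDr.
move=> le; have off_le0 : \sum_i \sum_(j | j != i) L i j ^+ 2 <= 0.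
  by move: (\sum_i ln _) (\sum_i (_ - _)) (\sum_i \sum_(_ | _) _) le dsum => x y z; lra.
have deq : \sum_i (L i i ^+ 2 - 1 - ln (L i i ^+ 2)) <= 0.
  rewrite sumrB; move: le off.
  by move: (\sum_i ln _) (\sum_i (_ - _)) (\sum_i \sum_(_ | _) _) => x y z; lra.
have L_diag i : L i i = 1.
  have : L i i ^+ 2 - 1 - ln (L i i ^+ 2) = 0.
    have dge j : true -> 0 <= L j j ^+ 2 - 1 - ln (L j j ^+ 2).
      by rewrite subr_ge0.
    apply: (psumr_eq0P dge) => //.
    by apply/eqP; rewrite eq_le deq sumr_ge0.
  have [/eqP|/(ln_lt_subr1 (Lpos i))] := eqVneq (L i i ^+ 2) 1; last lra.
  by rewrite -[X in _ == X](expr1n _ 2) eqrXn2// ?ler01// ?ltW// => /eqP.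
have L_off i j : j != i -> L i j = 0.
  move=> ji; apply/eqP; rewrite -sqrf_eq0; apply/eqP.
  have row0 i' : true -> 0 <= \sum_(j | j != i') L i' j ^+ 2.
    by move=> _; exact: sumr_ge0.
  apply: (psumr_eq0P (fun j _ => off0 i j) _ ji).
  apply: (psumr_eq0P row0) => //.
  by apply/eqP; rewrite eq_le off_le0.
have L1 : L = 1%:M.
  apply/matrixP => i j; rewrite mxE; have [->|ij] := eqVneq i j.
    by rewrite L_diag.
  by rewrite L_off// eq_sym.
by rewrite ML L1 trmx1 mulmx1.
Qed.

(** [Q *m K] need not be symmetric. With K = L L^T, the matrix L^T Q L is, and it has the same trace
    and determinant, so the previous lemma applies to it. *)
Lemma ln_det_mulmx_le_mxtrace n (Q K : 'M[R]_n) : pdmx Q -> pdmx K ->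
  ln (\det Q * \det K) <= \tr (Q *m K) - n%:R /\
  (\tr (Q *m K) - n%:R <= ln (\det Q * \det K) -> Q *m K = 1%:M).
Proof.
move=> pdQ pdK; have [L [tL L0 KL]] := pdmx_cholesky pdK.
have uL : L \in unitmx.
  by rewrite unitmxE unitfE det_trig// gt_eqF// prodr_gt0.
have := ln_det_le_mxtrace (pdmx_congr pdQ uL).
have -> : \det (L^T *m Q *m L) = \det Q * \det K.
  by rewrite KL !det_mulmx; ring.
have -> : \tr (L^T *m Q *m L) = \tr (Q *m K).
  by rewrite -mulmxA mxtrace_mulC KL mulmxA.
move=> [le1 eq1]; split=> // /eq1 E; rewrite KL mulmxA.
have uLT : L^T \in unitmx by rewrite unitmx_tr.
by rewrite -[Q *m L](mulKmx uLT) (mulmxA L^T) E mulmx1 mulVmx.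
Qed.

End matrix.

(** * The rate-distortion program *)

Section matrix_continuity.
Context {R : realType} {T : topologicalType}.

Lemma continuous_sum (I : finType) (P : pred I) (f : I -> T -> R) :
  (forall i, continuous (f i)) -> continuous (fun x => \sum_(i | P i) f i x).
Proof.
by move=> cf x; apply: cvg_big => [|i _]; [exact: add_continuous|exact: cf].
Qed.

Lemma continuous_prod (I : finType) (P : pred I) (f : I -> T -> R) :
  (forall i, continuous (f i)) -> continuous (fun x => \prod_(i | P i) f i x).
Proof.
by move=> cf x; apply: cvg_big => [|i _]; [exact: mul_continuous|exact: cf].
Qed.

Lemma continuous_subr (f g : T -> R) :
  continuous f -> continuous g -> continuous (fun x => f x - g x).
Proof. by move=> cf cg x; apply: cvgB; [exact: cf|exact: cg]. Qed.

Lemma continuous_mulmx m n p (F : T -> 'M[R]_(m, n)) (G : T -> 'M[R]_(n, p)) :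
  (forall i j, continuous (fun x => F x i j)) ->
  (forall i j, continuous (fun x => G x i j)) ->
  forall i j, continuous (fun x => (F x *m G x) i j).
Proof.
move=> cF cG i j; under eq_fun do rewrite mxE.
by apply: continuous_sum => l x; apply: cvgM; [exact: cF|exact: cG].
Qed.

Lemma continuous_det n (F : T -> 'M[R]_n) :
  (forall i j, continuous (fun x => F x i j)) -> continuous (fun x => \det (F x)).
Proof.
move=> cF; apply: continuous_sum => s x; apply: cvgM; first exact: cvg_cst.
exact: continuous_prod.
Qed.

End matrix_continuity.

Section rate_distortion_minimum.
Context {R : realType} {k : nat}.
Variables (S : 'M[R]_k) (r : R).
Hypothesis S_pd : pdmx S.
Implicit Types K W : 'M[R]_k.

(** Positive definiteness is not a closed condition, but on positive semidefinite matrices the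
    determinant bound forces it. In this form the feasible set is visibly closed and free of
    logarithms. *)
Lemma feasibleP K : feasible S r K <->
  [/\ psdmx K, psdmx (S - K) & \det S * expR (- (2 * r)) <= \det K].
Proof.
have dS := pdmx_det_gt0 S_pd.
have rateE : 0 < \det K -> (2^-1 * ln (\det S / \det K) <= r) =
    (\det S * expR (- (2 * r)) <= \det K).
  move=> dK; rewrite ler_pdivrMl// -{1}[2 * r]expRK ler_ln ?posrE ?expR_gt0 ?divr_gt0//.
  by rewrite ler_pdivrMr// expRN ler_pdivrMr ?expR_gt0// mulrC.
split=> [[pK leK rK]|[pK leK dK]].
  by split=> //; [exact: pdmx_psdmx|rewrite -rateE// pdmx_det_gt0].
have dK0 : 0 < \det K by rewrite (lt_le_trans _ dK)// mulr_gt0 ?expR_gt0.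
by split=> //; [exact: psdmx_det_gt0|rewrite rateE].
Qed.

(** Obtained by testing on e_i + e_j and e_i - e_j. It reduces the boundedness of the feasible set
    to the diagonal, where [S] dominates. *)
Lemma psdmx_entry_le K i j : psdmx K -> `|K i j| <= K i i + K j j.
Proof.
move=> [sK pK].
have ent (a b : 'I_k) : ((delta_mx a 0 : 'cV[R]_k)^T *m K *m (delta_mx b 0 : 'cV[R]_k)) 0 0 = K a b.
  by rewrite trmx_delta -rowE -colE !mxE.
have diag a : 0 <= K a a by rewrite -ent.
have sym : K j i = K i j by rewrite -{1}sK mxE.
have plus (e : R) : 0 <= K i i + 2 * e * K i j + e ^+ 2 * K j j.
  have := pK (delta_mx i 0 + e *: delta_mx j 0).
  rewrite [(_ + _)^T]linearD/= [(_ *: _)^T]linearZ/= !mulmxDl !mulmxDr.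
  rewrite -!scalemxAr -!scalemxAl !(addmxE, scalemxE) !ent sym => h.
  by apply: (le_trans h); rewrite le_eqVlt; apply/orP; left; apply/eqP; ring.
have di := diag i; have dj := diag j; have p1 := plus 1; have p2 := plus (- 1).
rewrite ler_norml; move: (K i j) (K i i) (K j j) di dj p1 p2 => x y z; clear.
by move=> *; apply/andP; split; lra.
Qed.

Lemma is_optimal_exists W : 0 <= r -> exists K, is_optimal S W r K.
Proof.
move=> r0; have dS := pdmx_det_gt0 S_pd; have psdS := pdmx_psdmx S_pd.
(* Matrices are read as row vectors, for which the compactness of boxes and the extreme value
   theorem are applied. *)
pose A := [set v : 'rV[R]_(k * k) |
  feasible S r (vec_mx v)].
pose vm (v : 'rV[R]_(k * k)) : 'M[R]_k := vec_mx v.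
have cE i j : continuous (fun v => vm v i j).
  have -> : (fun v => vm v i j) = fun v => v 0 (mxvec_index i j).
    by apply/funext => v; rewrite /vm mxE.
  exact: coord_continuous.
have cC m n (M : 'M[R]_(m, n)) i j : continuous (fun v : 'rV[R]_(k * k) => M i j).
  exact: cst_continuous.
have closed_psd (F : 'rV[R]_(k * k) -> 'M[R]_k) :
    (forall i j, continuous (fun v => F v i j)) -> closed [set v | psdmx (F v)].
  move=> cF.
  have -> : [set v | psdmx (F v)] = (\bigcap_(ij : 'I_k * 'I_k) ((fun v =>
      F v ij.1 ij.2 - F v ij.2 ij.1) @^-1` [set x | x = 0])) `&`
      \bigcap_(w : 'cV[R]_k) ((fun v => (w^T *m F v *m w) 0 0) @^-1` [set x | 0 <= x]).
    apply/seteqP; split=> [v [sv pv]|v [sv pv]].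
      split=> [ij _|w _]; last exact: pv.
      by rewrite /= -{1}sv mxE subrr.
    split=> [|w]; last exact: pv.
    apply/matrixP => i j; rewrite mxE; apply/eqP; rewrite -subr_eq0.
    exact/eqP/(sv (j, i)).
  apply: closedI; apply: closed_bigI => w _; apply: closed_comp.
  - by move=> v _; apply: continuous_subr; exact: cF.
  - exact: closed_eq.
  - move=> v _; apply: continuous_mulmx; last exact: cC.
    by apply: continuous_mulmx; [exact: cC|exact: cF].
  - exact: closed_ge.
have closedA : closed A.
  have -> : A = [set v | psdmx (vm v)] `&` [set v | psdmx (S - vm v)] `&`
      ((fun v => \det (vm v)) @^-1` [set x | \det S * expR (- (2 * r)) <= x]).
    apply/seteqP; split=> [v /feasibleP[]//|v [[? ?] ?]].
    exact/feasibleP.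
  apply: closedI; first apply: closedI.
  - exact: closed_psd.
  - apply: closed_psd => i j v; under eq_fun do rewrite addmxE oppmxE.
    by apply: continuous_subr; [exact: cC|exact: cE].
  - apply: closed_comp; last exact: closed_ge.
    by move=> v _; exact: continuous_det.
(* The diagonal entries of a feasible matrix are at most those of [S], hence at most the trace [M];
   all entries then lie between [- (2 * M)] and [2 * M]. *)
pose M := \sum_i S i i.
have Sii i : 0 <= S i i by have := psdmx_entry_le i i psdS; rewrite ler_norml; lra.
have SM i : S i i <= M by rewrite /M (bigD1 i)//= lerDl sumr_ge0.
have compactA : compact A.
  apply: (subclosed_compact closedA (rV_compact (fun=> segment_compact (a := - (2 * M)) (b := 2 * M)))).
  move=> v /feasibleP[pv pSv _] /= a.
  case/mxvec_indexP: a => i j.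
  have -> : v ord0 (mxvec_index i j) = vm v i j by rewrite /vm mxE.
  have diag a' : vm v a' a' <= M.
    apply: le_trans (SM a'); have := psdmx_entry_le a' a' pSv.
    rewrite addmxE oppmxE -/(vm v) => h.
    by have := le_trans (normr_ge0 _) h; move: (S a' a') (vm v a' a') => x y; lra.
  have := psdmx_entry_le i j pv; rewrite ler_norml in_itv/= -/(vm v).
  have := diag i; have := diag j.
  clear SM; move: (vm v i j) (vm v i i) (vm v j j) (M) => x y z t; clear.
  by move=> ? ? /andP[? ?]; apply/andP; split; lra.
(* [S] itself has rate 0, which is admissible because [0 <= r]. *)
have A0 : A !=set0.
  exists (mxvec S); rewrite /A /= mxvecK; apply/feasibleP; split=> //.
    by rewrite subrr; split=> [|v]; rewrite ?trmx0// mulmx0 mul0mx mxE.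
  by rewrite ger_pMr// -expR0 ler_expR oppr_le0 mulr_ge0.
have ctr : {within A, continuous (fun v => \tr (W *m vm v))}.
  apply: continuous_subspaceT; apply: continuous_sum => i.
  by apply: continuous_mulmx; [exact: cC|exact: cE].
have [c cA cmin] := EVT_min_rV A0 compactA ctr.
exists (vm c); split; first by move: cA; rewrite inE.
move=> K fK; have := cmin (mxvec K); rewrite /vm mxvecK; apply.
by rewrite inE /A /= mxvecK.
Qed.

Lemma is_optimal_Dopt W K : is_optimal S W r K -> \tr (W *m K) = Dopt S W r.
Proof.
move=> [fK Kmin]; apply/le_anti/andP; split.
  apply: lb_le_inf; first by exists (\tr (W *m K)), K.
  by move=> _ [K' fK' <-]; exact: Kmin.
apply: ge_inf; last by exists K.
by exists (\tr (W *m K)) => _ [K' fK' <-]; exact: Kmin.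
Qed.

Lemma Dopt_le W K : 0 <= r -> feasible S r K -> Dopt S W r <= \tr (W *m K).
Proof.
move=> r0 fK; have [K0 oK0] := is_optimal_exists W r0.
by rewrite -(is_optimal_Dopt oK0); exact: oK0.2.
Qed.

End rate_distortion_minimum.

(** * Closed form of an optimizer strictly below [S] *)

Section interior.
Context {R : realType} {k : nat}.
Implicit Types S W K M N : 'M[R]_k.

(** A crude substitute for the spectral norm, from |v_i v_j| <= |v|^2. *)
Lemma qform_bound N (v : 'cV[R]_k) :
  `|(v^T *m N *m v) 0 0| <= (\sum_i \sum_j `|N i j|) * (v^T *m v) 0 0.
Proof.
have vv : (v^T *m v) 0 0 = \sum_i v i 0 ^+ 2.
  by rewrite mxE; apply: eq_bigr => i _; rewrite mxE expr2.
have -> : (v^T *m N *m v) 0 0 = \sum_i \sum_j N i j * (v i 0 * v j 0).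
  rewrite mxE exchange_big/=; apply: eq_bigr => j _; rewrite mxE big_distrl/=.
  by apply: eq_bigr => i _; rewrite mxE; ring.
rewrite (le_trans (ler_norm_sum _ _ _))// big_distrl/= ler_sum// => i _.
rewrite (le_trans (ler_norm_sum _ _ _))// big_distrl/= ler_sum// => j _.
rewrite normrM ler_wpM2l// vv.
have le_sum a : v a 0 ^+ 2 <= \sum_i v i 0 ^+ 2.
  by rewrite (bigD1 a)//= lerDl sumr_ge0// => ? _; exact: sqr_ge0.
have := le_sum i; have := le_sum j; move: (\sum_i _) (v i 0) (v j 0) => s x y.
move=> xs ys; rewrite ler_norml; have := sqr_ge0 (x + y); have := sqr_ge0 (x - y).
by move=> ? ?; apply/andP; split; nra.
Qed.

(** The Cholesky factor of [M] turns [M] into the identity and [N] into [N']. By [qform_bound], a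
    step of length 1 / (C + 1) cannot cancel the identity. *)
Lemma pdmx_perturb M N : pdmx M -> N^T = N ->
  exists2 t, 0 < t <= 1 & psdmx (M + t *: N).
Proof.
move=> pdM sN; have [L [tL L0 ML]] := pdmx_cholesky pdM.
have uL : L \in unitmx by rewrite unitmxE unitfE det_trig// gt_eqF// prodr_gt0.
have uLT : L^T \in unitmx by rewrite unitmx_tr.
pose N' := invmx L *m N *m (invmx L)^T.
pose C := \sum_i \sum_j `|N' i j|.
have C0 : 0 <= C by rewrite sumr_ge0// => i _; rewrite sumr_ge0.
have C1 : 0 < C + 1 by rewrite ltr_wpDl.
exists (C + 1)^-1; first by rewrite invr_gt0 C1 invf_le1// lerDr.
split=> [|v]; first by rewrite linearD/= linearZ/= sN pdM.1.
have NE : v^T *m N *m v = (L^T *m v)^T *m N' *m (L^T *m v).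
  rewrite trmx_mul trmxK /N' !mulmxA mulmxK//.
  by rewrite trmx_inv -!mulmxA mulKmx// !mulmxA.
have ME : v^T *m M *m v = (L^T *m v)^T *m (L^T *m v).
  by rewrite trmx_mul trmxK ML !mulmxA.
rewrite mulmxDr mulmxDl -scalemxAr -scalemxAl addmxE scalemxE NE ME.
have := qform_bound N' (L^T *m v); rewrite -/C ler_norml => /andP[h _].
have := sqnorm_ge0 (L^T *m v).
move: h; move: ((_ *m N' *m _) 0 0) (((L^T *m v)^T *m _) 0 0) => x y h y0.
rewrite -(pmulr_rge0 _ C1) mulrDr mulrA divff ?gt_eqF// mul1r.
by move: C C1 C0 h {NE ME} => c *; nra.
Qed.

Lemma convex_lt (a b t : R) : b < a -> 0 < t -> (1 - t) * a + t * b < a.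
Proof. by move=> ? ?; nra. Qed.

Variables (S W : 'M[R]_k) (r : R).
Hypotheses (k_gt0 : (0 < k)%N) (S_pd : pdmx S) (W_pd : pdmx W).

Let nu : R := expR (k%:R^-1 * (ln (\det S) + ln (\det W) - 2 * r)).
Let K0 := nu *: invmx W.
Let nu_gt0 : 0 < nu. Proof. exact: expR_gt0. Qed.
Let K0_pd : pdmx K0. Proof. exact/pdmxZ/pdmx_inv. Qed.
Let kR_neq0 : k%:R != 0 :> R. Proof. by rewrite pnatr_eq0 -lt0n. Qed.

(** [nu] is defined so that [K0] meets the rate constraint with equality: its k-th power is
    [\det S * \det W * expR (- (2 * r))]. *)
Let det_K0 : \det K0 = \det S * expR (- (2 * r)).
Proof.
rewrite detZ /nu -expRM_natl mulrA mulfV// mul1r !expRD !lnK ?posrE ?pdmx_det_gt0//.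
by rewrite det_inv; field; rewrite gt_eqF// pdmx_det_gt0.
Qed.

(** The inequality ln det <= tr - k is applied to [Q *m K] with Q = W / nu. The determinant of this
    product is [\det K / \det K0], which is at least 1 by the rate constraint, so the logarithm is
    nonnegative. *)
Let trace_ge K : feasible S r K ->
  k%:R * nu <= \tr (W *m K) /\ (\tr (W *m K) <= k%:R * nu -> K = K0).
Proof.
move=> fK; have [psdK _ dK] := (feasibleP r S_pd K).1 fK.
have pdK : pdmx K by case: fK.
have pdQ : pdmx (nu^-1 *: W) by apply: pdmxZ => //; rewrite invr_gt0.
have [le1 eq1] := ln_det_mulmx_le_mxtrace pdQ pdK.
have detQ : \det (nu^-1 *: W) * \det K = \det K / \det K0.
  rewrite /K0 !detZ det_inv; have := lt0r_neq0 (pdmx_det_gt0 W_pd).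
  have nuk : nu ^+ k != 0 by rewrite expf_neq0// gt_eqF.
  rewrite exprVn; move: (nu ^+ k) (\det W) (\det K) nuk => x y z x0 y0.
  by field; rewrite x0 y0.
have ge0 : 0 <= ln (\det (nu^-1 *: W) * \det K).
  by rewrite ln_ge0// detQ ler_pdivlMr ?pdmx_det_gt0// mul1r det_K0.
have trQ : \tr (nu^-1 *: W *m K) = nu^-1 * \tr (W *m K).
  by rewrite -scalemxAl mxtraceZ.
rewrite trQ in le1 eq1.
split; first by rewrite mulrC -ler_pdivlMl//; lra.
rewrite mulrC -ler_pdivrMl// => le2.
have /eq1 : nu^-1 * \tr (W *m K) - k%:R <= ln (\det (nu^-1 *: W) * \det K) by lra.
rewrite -scalemxAl => /(congr1 (fun A => invmx W *m (nu *: A))).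
by rewrite scalerA divff ?gt_eqF// scale1r mulKmx ?pdmx_unit// -scalemxAr mulmx1.
Qed.

Let trace_K0 : \tr (W *m K0) = k%:R * nu.
Proof.
by rewrite /K0 -scalemxAr mulmxV ?pdmx_unit// mxtraceZ mxtrace1 mulrC.
Qed.

(** [K0] may violate the Loewner constraint, so it cannot simply be compared with [K]. A short step
    from [K] towards [K0] keeps that constraint because [K] is interior, keeps the rate constraint
    by concavity, and strictly lowers the trace unless [K] is [K0]. *)
Let optimal_eq K : is_optimal S W r K -> loewner_lt K S -> K = K0.
Proof.
move=> [fK Kmin] ltKS; have [psdK _ dK] := (feasibleP r S_pd K).1 fK.
have pdK : pdmx K by case: fK.
have [_ eqK0] := trace_ge fK; apply: eqK0; rewrite leNgt; apply/negP => lt_tr.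
have sKK0 : (K - K0)^T = K - K0 by rewrite linearB/= pdK.1 K0_pd.1.
have [t /andP[t0 t1] psdt] := pdmx_perturb ltKS sKK0.
pose Kt := (1 - t) *: K + t *: K0.
have pdKt : pdmx Kt.
  by apply: pdmxD; [apply: psdmxZ (pdmx_psdmx pdK); rewrite subr_ge0|exact: pdmxZ].
have trKt Q : \tr (Q *m Kt) = (1 - t) * \tr (Q *m K) + t * \tr (Q *m K0).
  by rewrite /Kt mulmxDr -!scalemxAr mxtraceD !mxtraceZ.
have feasKt : feasible S r Kt.
  apply/(feasibleP _ S_pd); split; first exact: pdmx_psdmx.
    suff -> : S - Kt = S - K + t *: (K - K0) by [].
    by rewrite /Kt; apply/matrixP => i j; rewrite !mxE; ring.
  (* Concavity of ln det in tangent form at [Kt]: with Q the inverse of [Kt], the traces of [Q *m K]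
     and [Q *m K0], weighted by 1 - t and t, add up to k. The weighted logarithms of det(Q K) and
     det(Q K0) thus sum to at most 0, and so the smaller one, that of [K0], is at most 0. *)
  rewrite -det_K0; have pdQ := pdmx_inv pdKt.
  have [le1 _] := ln_det_mulmx_le_mxtrace pdQ pdK.
  have [le2 _] := ln_det_mulmx_le_mxtrace pdQ K0_pd.
  have := trKt (invmx Kt); rewrite mulVmx ?pdmx_unit// mxtrace1 => trE.
  have dQ := pdmx_det_gt0 pdQ; have dK0 := pdmx_det_gt0 K0_pd.
  have le3 : ln (\det (invmx Kt) * \det K0) <= ln (\det (invmx Kt) * \det K).
    rewrite ler_ln ?posrE ?mulr_gt0// ?(pdmx_det_gt0 pdK)//.
    by rewrite ler_pM2l// det_K0.
  have : ln (\det (invmx Kt) * \det K0) <= 0.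
    move: le1 le2 le3 trE t0 t1; clear.
    move: (ln _) (ln _) (\tr _) (\tr _) => *; nra.
  rewrite -[X in _ <= X]ln1 ler_ln ?posrE ?mulr_gt0// det_inv.
  by rewrite ler_pdivrMl ?pdmx_det_gt0// mulr1.
have := Kmin _ feasKt; rewrite trKt trace_K0; apply/negP; rewrite -ltNge.
exact: convex_lt.
Qed.

Lemma interior_optimum K : is_optimal S W r K -> loewner_lt K S ->
  [/\ K = nu *: invmx W,
      (forall K', is_optimal S W r K' -> K' = K) &
      Dopt S W r = k%:R * (\det S * \det W) `^ (k%:R^-1)
                * expR (- 2 * (r / k%:R))].
Proof.
move=> oK ltKS; have KE := optimal_eq oK ltKS; split=> //.
  (* [K'] is not assumed interior: its trace is at most [k%:R * nu], and the equality case of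
     [trace_ge] identifies it. *)
  move=> K' [fK' K'min]; rewrite KE; apply: (trace_ge fK').2.
  by rewrite -trace_K0 -KE; apply: K'min; case: oK.
rewrite -(is_optimal_Dopt oK) KE trace_K0 -mulrA; congr (_ * _).
have dS := pdmx_det_gt0 S_pd; have dW := pdmx_det_gt0 W_pd.
rewrite /powR gt_eqF ?mulr_gt0// lnM ?posrE//.
by rewrite -expRD /nu; congr expR; field.
Qed.

End interior.

(** * Gaussian measures *)

Section normal_affine.
Context {R : realType}.
Local Notation mu := (@lebesgue_measure R).
Local Notation tR := (measurableTypeR R).

Lemma measurable_affine (c s : R) : measurable_fun [set: tR] (fun x : tR => c * x + s : tR).
Proof. by apply: measurable_funD => //; exact: measurable_funM. Qed.

Lemma preimage_affine_itv (c s a b : R) : c != 0 ->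
  (fun x : R => c * x + s) @^-1` [set` `]a, b]%R] =
  if 0 < c then [set` `](a - s) / c, (b - s) / c]%R]
  else [set` `[(b - s) / c, (a - s) / c[%R].
Proof.
move=> c0; case: ifPn => c_gt0; apply/seteqP; split=> x /=; rewrite !in_itv/=.
- by rewrite ltr_pdivrMr// ler_pdivlMr// => /andP[? ?]; apply/andP; split; lra.
- by rewrite ltr_pdivrMr// ler_pdivlMr// => /andP[? ?]; apply/andP; split; lra.
- have c_lt0 : c < 0 by rewrite lt_neqAle c0 leNgt.
  by rewrite ltr_ndivlMr// ler_ndivrMr// => /andP[? ?]; apply/andP; split; lra.
- have c_lt0 : c < 0 by rewrite lt_neqAle c0 leNgt.
  by rewrite ltr_ndivlMr// ler_ndivrMr// => /andP[? ?]; apply/andP; split; lra.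
Qed.

(** The image of Lebesgue measure under the affine map, scaled by |c|, agrees with Lebesgue measure
    on half-open intervals, hence everywhere. *)
Lemma ge0_integral_affine (c s : R) (F : tR -> \bar R) : c != 0 ->
  measurable_fun setT F -> (forall x, (0 <= F x)%E) ->
  (\int[mu]_x (F (c * x + s)%R * `|c|%:E) = \int[mu]_x F x)%E.
Proof.
move=> c0 mF F0.
have maff := measurable_affine c s.
pose aff (x : tR) : tR := c * x + s.
pose nu := mscale (NngNum (normr_ge0 c))
  (measure_function_pushforward__canonical__measure_function_Measure mu maff).
have nuE A : measurable A -> mu A = nu A.
  apply: lebesgue_measure_unique => X [[a b]/= _ <-].
  rewrite /nu /mscale/= /pushforward.
  have /= -> := preimage_affine_itv s a b c0.
  rewrite lebesgue_measure_itv/= lte_fin.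
  have [c_gt0|c_le0] := ltrP 0 c; rewrite lebesgue_measure_itv/= lte_fin.
    rewrite gtr0_norm// ltr_pM2r ?invr_gt0// ltrD2r; case: ifPn => _.
      by rewrite -!EFinB -EFinM; congr EFin; field.
    by rewrite mule0.
  have c_lt0 : c < 0 by rewrite lt_neqAle c0.
  rewrite ltr0_norm// ltr_nM2r ?invr_lt0// ltrD2r; case: ifPn => _.
    by rewrite -!EFinB -EFinM; congr EFin; field.
  by rewrite mule0.
rewrite [RHS](eq_measure_integral nu); last by move=> A mA _; exact: nuE.
rewrite ge0_integral_mscale//= ge0_integral_pushforward//=.
rewrite ge0_integralZr//; first by rewrite muleC preimage_setT.
exact: measurableT_comp.
Qed.

Let idTR : measurableTypeR R -> R := idfun.

#[local] HB.instance Definition _ :=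
  @isMeasurableFun.Build _ _ _ _ idTR (@measurable_id _ _ setT).

(* normal_prob lives on measurableTypeR R, whose display differs from that of
   R; the identity transports it. *)
Definition std_normal : probability R R := distribution (normal_prob 0 1) idTR.

Arguments std_normal : simpl never.

(** The Radon-Nikodym derivative of [normal_prob 0 1] and [normal_pdf 0 1] have the same integral
    over every measurable set, so they agree almost everywhere. *)
Lemma ge0_integral_std_normal (F : R -> \bar R) :
  measurable_fun setT F -> (forall x, (0 <= F x)%E) ->
  (\int[std_normal]_x F x = \int[mu]_x (F x * (normal_pdf 0 1 x)%:E))%E.
Proof.
move=> mF F0; rewrite /std_normal ge0_integral_distribution//.
have dom := @normal_prob_dominates R 0 1.
rewrite -(Radon_Nikodym_SigmaFinite.change_of_variables dom)//.
apply: ae_eq_integral => //=.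
- apply: emeasurable_funM => //.
  by apply: measurable_int; exact: Radon_Nikodym_SigmaFinite.f_integrable.
- apply: emeasurable_funM => //; apply/measurable_EFinP.
  exact: measurable_normal_pdf.
- apply: ae_eqe_mul2l; apply: integral_ae_eq => //.
  + exact: Radon_Nikodym_SigmaFinite.f_integrable.
  + by apply/measurable_EFinP; exact: measurable_normal_pdf.
  + by move=> E _ mE; rewrite -Radon_Nikodym_SigmaFinite.f_integral.
Qed.

(** For a = |x|^2 and b = |y|^2 this is the ratio of the standard Gaussian densities at y and at x.
    As a weight it converts a Lebesgue change of variables into one for the Gaussian measure. *)
Definition wexp (a b : R) : R := expR (2^-1 * (a - b)).

Lemma wexp_normal_pdf (x y c : R) : wexp (x ^+ 2) (y ^+ 2) * c * normal_pdf 0 1 x =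
   normal_pdf 0 1 y * c.
Proof.
rewrite mulrAC; congr (_ * _).
rewrite normal_pdfE ?oner_neq0//.
rewrite mulrCA; congr (_ * _).
rewrite /normal_fun !subr0.
rewrite expr1n /wexp -expRD; congr expR.
by rewrite -(mulr_natr 1) mul1r; field.
Qed.

Lemma ge0_integral_std_normal_affine (c s : R) (F : R -> \bar R) : c != 0 ->
  measurable_fun setT F -> (forall x, (0 <= F x)%E) ->
  (\int[std_normal]_x (F (c * x + s)%R
      * (wexp (x ^+ 2) ((c * x + s) ^+ 2) * `|c|)%:E)
   = \int[std_normal]_x F x)%E.
Proof.
move=> c0 mF F0.
have maff : measurable_fun [set: R] (fun x : R => c * x + s).
  by apply: measurable_funD => //; exact: measurable_funM.
rewrite !ge0_integral_std_normal//; last 2 first.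
- apply: emeasurable_funM; first exact: measurableT_comp.
  apply/measurable_EFinP; apply: measurable_funM => //.
  apply: measurableT_comp => //; apply: measurable_funM => //.
  by apply: measurable_funB; exact: measurable_funX.
- by move=> x; rewrite mule_ge0// lee_fin mulr_ge0// expR_ge0.
rewrite -(@ge0_integral_affine c s (fun x => F x * (normal_pdf 0 1 x)%:E)%E)//.
- apply: eq_integral => x _; rewrite -!muleA; congr (_ * _)%E.
  by rewrite -!EFinM wexp_normal_pdf.
- apply: emeasurable_funM => //; apply/measurable_EFinP.
  exact: measurable_normal_pdf.
- by move=> x; rewrite mule_ge0// lee_fin normal_pdf_ge0.
Qed.

End normal_affine.

Section gauss_measure.
Context {R : realType}.

Definition box n (C : 'I_n -> set R) : set (n.-tuple R) :=
  \bigcap_(i in [set: 'I_n]) ((@tnth n R)^~ i @^-1` C i).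

Lemma measurable_box n (C : 'I_n -> set R) :
  (forall i, measurable (C i)) -> measurable (box C).
Proof.
move=> mC; apply: fin_bigcap_measurable => [|i _]; first exact: finite_finset.
by rewrite -[X in measurable X]setTI; exact: measurable_tnth.
Qed.

(** Boxes are stable under intersection and generate the product sigma-algebra; a cylinder over one
    coordinate is a box whose other sides are [setT]. *)
Lemma measure_tuple_unique n (mu nu : probability (n.-tuple R) R) :
  (forall C, (forall i, measurable (C i)) -> mu (box C) = nu (box C)) ->
  forall A, measurable A -> mu A = nu A.
Proof.
move=> eq_box; pose G := [set A | exists2 C : 'I_n -> set R,
  forall i, measurable (C i) & A = box C].
have GT : G setT.
  by exists (fun=> setT) => //; apply/esym/seteqP; split.
apply: (@measure_unique _ _ _ G (fun=> setT)) => //.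
- apply/seteqP; split=> A.
    move=> mA; apply: (mA <<s G >>); split; first exact: smallest_sigma_algebra.
    rewrite -bigcup_seq => B [i _ [C mC <-]]; apply: sub_sigma_algebra.
    exists (fun j => if j == i then C else setT).
      by move=> j; case: ifP.
    rewrite setTI; apply/seteqP; split=> [x Cx j _|x]; rewrite /preimage /=.
      by case: ifPn => // /eqP ->.
    by move=> /(_ i I)/=; rewrite eqxx.
  move: A; apply: smallest_sub; first exact: sigma_algebra_measurable.
  by move=> _ [C mC ->]; exact: measurable_box.
- move=> _ _ [C mC ->] [D mD ->]; exists (fun i => C i `&` D i).
    by move=> i; exact: measurableI.
  by rewrite /box -bigcapI.
- by apply/seteqP; split=> // x _; exists 0%N.
- by move=> _ [C mC ->]; exact: eq_box.
- by move=> ?; rewrite /= probability_setT ltry.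
Qed.

Definition cons_tuple n (xt : R * n.-tuple R) : n.+1.-tuple R :=
  [tuple of xt.1 :: xt.2].

Lemma measurable_cons_tuple n : measurable_fun setT (@cons_tuple n).
Proof. by apply: measurable_cons. Qed.

HB.instance Definition _ n :=
  isMeasurableFun.Build _ _ _ _ (@cons_tuple n) (@measurable_cons_tuple n).

(** Built one coordinate at a time, so that Tonelli's theorem peels off the first coordinate in
    inductions on the dimension. *)
Fixpoint gauss n : probability (n.-tuple R) R :=
  match n with
  | 0 => \d_ [tuple]
  | m.+1 => distribution (std_normal \x gauss m)%E (@cons_tuple m)
  end.

Lemma gauss_box n (C : 'I_n -> set R) : (forall i, measurable (C i)) ->
  gauss n (box C) = (\prod_i std_normal (C i))%E.
Proof.
elim: n C => [C _|n IH C mC].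
  by rewrite big_ord0 /= diracE mem_set// => -[].
rewrite big_ord_recl -IH//.
rewrite -[LHS]/((std_normal \x gauss n)%E (@cons_tuple n @^-1` box C)).
rewrite -(product_measure1E std_normal (gauss n))//; last exact: measurable_box.
suff E : @cons_tuple n @^-1` box C =
    C ord0 `*` box (fun i => C (lift ord0 i)).
  by rewrite E.
apply/seteqP; split=> [[x t] H|[x t] [/= H0 H1] i _] /=.
  split=> [|i _]; first exact: (H ord0 I).
  have /= := H (lift ord0 i) I.
  by rewrite (tnth_nth x)/= /preimage/= (tnth_nth x).
have [j ->|->] := unliftP ord0 i; last by rewrite /preimage/= (tnth_nth x).
have := H1 j I.
by rewrite /preimage/= !(tnth_nth x).
Qed.

Lemma ge0_integral_gaussS n (F : n.+1.-tuple R -> \bar R) :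
  measurable_fun setT F -> (forall t, (0 <= F t)%E) ->
  (\int[gauss n.+1]_t F t =
     \int[std_normal]_x \int[gauss n]_t F (cons_tuple (x, t)))%E.
Proof.
move=> mF F0; rewrite [LHS]ge0_integral_distribution//.
rewrite (fubini_tonelli1 (F \o @cons_tuple n)) => // [|xt]; last exact: F0.
by apply: measurableT_comp => //; exact: measurable_cons_tuple.
Qed.

(** The order of integration suited to upper triangular maps, where the first coordinate of the
    image is shifted by the others; the previous lemma suits lower triangular maps. *)
Lemma ge0_integral_gaussS2 n (F : n.+1.-tuple R -> \bar R) :
  measurable_fun setT F -> (forall t, (0 <= F t)%E) ->
  (\int[gauss n.+1]_t F t =
     \int[gauss n]_t \int[std_normal]_x F (cons_tuple (x, t)))%E.
Proof.
move=> mF F0; rewrite [LHS]ge0_integral_distribution//.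
rewrite (fubini_tonelli2 (F \o @cons_tuple n)) => // [|xt]; last exact: F0.
by apply: measurableT_comp => //; exact: measurable_cons_tuple.
Qed.

Lemma measurable_gaussS2 n (F : n.+1.-tuple R -> \bar R) :
  measurable_fun setT F -> (forall t, (0 <= F t)%E) ->
  measurable_fun setT (fun t => \int[std_normal]_x F (cons_tuple (x, t)))%E.
Proof.
move=> mF F0.
apply: (measurable_fun_fubini_tonelli_G (m1 := std_normal) (F \o @cons_tuple n)) => [|xt]; last exact: F0.
by apply: measurableT_comp => //; exact: measurable_cons_tuple.
Qed.

(** [iid_std_normal] prescribes the probabilities of boxes; uniqueness extends them to all
    measurable sets. *)
Lemma iid_std_normal_gauss d (T : measurableType d) (P : probability T R) n
    (G : 'I_n -> {RV P >-> R}) (A : set (n.-tuple R)) :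
  iid_std_normal G -> measurable A ->
  P ((fun t => [tuple G i t | i < n]) @^-1` A) = gauss n A.
Proof.
move=> iidG mA.
have mG : measurable_fun setT (fun t => [tuple G i t | i < n]).
  apply/measurable_fun_tnthP => i; apply: (eq_measurable_fun (G i)) => // t _.
  by rewrite /= tnth_mktuple.
pose GG : {RV P >-> n.-tuple R} := HB.pack (fun t => [tuple G i t | i < n])
  (isMeasurableFun.Build _ _ _ _ _ mG).
rewrite -[LHS]/(distribution P GG A).
apply: measure_tuple_unique => // C mC; rewrite gauss_box//.
rewrite /distribution /pushforward -iidG//; congr (P _).
apply/seteqP; split=> t H i _; have := H i I; by rewrite /preimage/= tnth_mktuple.
Qed.

End gauss_measure.

Section vectors.
Context {R : realType}.

Definition tupv n (v : 'cV[R]_n) : n.-tuple R := [tuple v i 0 | i < n].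

Definition sqn n (v : 'cV[R]_n) : R := (v^T *m v) 0 0.

Lemma tupvK n (v : 'cV[R]_n) : colv (tupv v) = v.
Proof. by apply/colP => i; rewrite mxE tnth_mktuple. Qed.

Lemma colvK n (t : n.-tuple R) : tupv (colv t) = t.
Proof. by apply/eq_from_tnth => i; rewrite tnth_mktuple mxE. Qed.

Lemma colv_cons n x (t : n.-tuple R) :
  colv (cons_tuple (x, t)) = col_mx x%:M (colv t) :> 'cV[R]_(1 + n).
Proof.
apply/colP => i; rewrite mxE; have [j ->|->] := unliftP ord0 i.
  have -> : lift ord0 j = rshift 1 j :> 'I_(1 + n) by exact: val_inj.
  by rewrite col_mxEd mxE !(tnth_nth x).
have -> : ord0 = lshift n ord0 :> 'I_(1 + n) by exact: val_inj.
by rewrite col_mxEu mxE !(tnth_nth x).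
Qed.

Lemma tupv_cons n x (v : 'cV[R]_n) :
  tupv (col_mx x%:M v : 'cV[R]_(1 + n)) = cons_tuple (x, tupv v).
Proof. by rewrite -[RHS]colvK colv_cons tupvK. Qed.

Lemma sqn_col_mx m n (u : 'cV[R]_m) (v : 'cV[R]_n) :
  sqn (col_mx u v) = sqn u + sqn v.
Proof. by rewrite /sqn tr_col_mx mul_row_col addmxE. Qed.

Lemma sqn_scalar (x : R) : sqn (x%:M : 'cV[R]_1) = x ^+ 2.
Proof. by rewrite /sqn tr_scalar_mx -scalar_mxM mxE eqxx mulr1n expr2. Qed.

Lemma sqnE n (v : 'cV[R]_n) : sqn v = \sum_i v i 0 ^+ 2.
Proof. by rewrite /sqn mxE; apply: eq_bigr => i _; rewrite mxE expr2. Qed.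

Context d (T : measurableType d).

Definition measurable_vec n (V : T -> 'cV[R]_n) :=
  forall i, measurable_fun setT (fun t => V t i 0).

Lemma measurable_vec_colv n (X : T -> n.-tuple R) :
  measurable_fun setT X -> measurable_vec (colv \o X).
Proof.
move=> mX i; rewrite (_ : (fun _ => _) = (@tnth _ R)^~ i \o X).
  by apply: measurableT_comp => //; exact: measurable_tnth.
by apply/funext => t; rewrite /= mxE.
Qed.

Lemma measurable_vec_mul m n (A : 'M[R]_(m, n)) V :
  measurable_vec V -> measurable_vec (fun t => A *m V t).
Proof.
move=> mV i; under eq_fun do rewrite mxE.
by apply: measurable_sum => j; apply: measurable_funM.
Qed.

Lemma measurable_vec_add n (V W : T -> 'cV[R]_n) :
  measurable_vec V -> measurable_vec W -> measurable_vec (fun t => V t + W t).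
Proof.
by move=> mV mW i; under eq_fun do rewrite mxE; apply: measurable_funD.
Qed.

Lemma measurable_vec_cst n (v : 'cV[R]_n) : measurable_vec (fun=> v).
Proof. by move=> i; exact: measurable_cst. Qed.

Lemma measurable_tupv n (V : T -> 'cV[R]_n) :
  measurable_vec V -> measurable_fun setT (fun t => tupv (V t)).
Proof.
move=> mV; apply/measurable_fun_tnthP => i.
by rewrite (_ : _ \o _ = fun t => V t i 0)//; apply/funext => t /=; rewrite tnth_mktuple.
Qed.

Lemma measurable_sqn n (V : T -> 'cV[R]_n) :
  measurable_vec V -> measurable_fun setT (fun t => sqn (V t)).
Proof.
move=> mV; under eq_fun do rewrite sqnE.
by apply: measurable_sum => i; apply: measurable_funX.
Qed.

Lemma measurable_wexp (f g : T -> R) : measurable_fun setT f ->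
  measurable_fun setT g -> measurable_fun setT (fun t => wexp (f t) (g t)).
Proof.
move=> mf mg; apply: measurableT_comp => //; apply: measurable_funM => //.
exact: measurable_funB.
Qed.

End vectors.

Section gauss_affine.
Context {R : realType}.

Lemma measurable_colv n : measurable_vec (fun t : n.-tuple R => colv t).
Proof. exact: (measurable_vec_colv (@measurable_id _ _ setT)). Qed.

Lemma wexp_ge0 (a b : R) : 0 <= wexp a b.
Proof. exact: expR_ge0. Qed.

Lemma wexpM (a b c e : R) : wexp a b * wexp c e = wexp (a + c) (b + e).
Proof. by rewrite /wexp -expRD; congr expR; ring. Qed.

(* Lebesgue's change of variables t |-> P t + s on R^n, with the standard
   Gaussian measure as reference measure. *)
Definition gauss_affine n (P : 'M[R]_n) (s : 'cV[R]_n) :=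
  forall F : n.-tuple R -> \bar R,
    measurable_fun setT F -> (forall t, (0 <= F t)%E) ->
    (\int[gauss n]_t (F (tupv (P *m colv t + s)) *
       (wexp (sqn (colv t)) (sqn (P *m colv t + s)) * `|\det P|)%:E) =
     \int[gauss n]_t F t)%E.

Let measurable_vec_aff n (P : 'M[R]_n) s :
  measurable_vec (fun t : n.-tuple R => P *m colv t + s).
Proof.
apply: measurable_vec_add; last exact: measurable_vec_cst.
by apply: measurable_vec_mul; exact: measurable_colv.
Qed.

Lemma measurable_gauss_affine n (P : 'M[R]_n) s (F : n.-tuple R -> \bar R) :
  measurable_fun setT F ->
  measurable_fun setT (fun t => F (tupv (P *m colv t + s)) *
       (wexp (sqn (colv t)) (sqn (P *m colv t + s)) * `|\det P|)%:E)%E.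
Proof.
move=> mF; apply: emeasurable_funM.
  by apply: measurableT_comp => //; apply: measurable_tupv; exact: measurable_vec_aff.
apply/measurable_EFinP; apply: measurable_funM => //; apply: measurable_wexp.
  by apply: measurable_sqn; exact: measurable_colv.
by apply: measurable_sqn; exact: measurable_vec_aff.
Qed.

(** The weights [wexp] telescope along the composition, the middle norm cancelling, and the
    determinants multiply. *)
Lemma gauss_affine_comp n (P Q : 'M[R]_n) s t :
  gauss_affine P s -> gauss_affine Q t -> gauss_affine (P *m Q) (P *m t + s).
Proof.
move=> aP aQ F mF F0; rewrite -(aP F mF F0) -(aQ (fun t => F (tupv (P *m colv t + s)) *
  (wexp (sqn (colv t)) (sqn (P *m colv t + s)) * `|\det P|)%:E)%E); first last.
- by move=> ?; rewrite mule_ge0 ?F0// lee_fin mulr_ge0// wexp_ge0.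
- exact: measurable_gauss_affine.
apply: eq_integral => x _; rewrite tupvK mulmxDr mulmxA addrA -muleA; congr (_ * _)%E.
rewrite -EFinM mulrACA wexpM -normrM -det_mulmx; congr EFin; congr (_ * _).
by rewrite /wexp; congr expR; ring.
Qed.

Lemma gauss_affine0 (P : 'M[R]_0) s : gauss_affine P s.
Proof.
move=> F mF F0; apply: eq_integral => t _.
have -> : tupv (P *m colv t + s) = t by apply/eq_from_tnth => -[].
by rewrite det_mx00 normr1 mulr1 !sqnE !big_ord0 /wexp subr0 mulr0 expR0 mule1.
Qed.

(** For a fixed first coordinate x, the inner integral is a change of variables by [L] with shift
    [x *: w + dsubmx s]. The shift depends on x, so [L] must be handled with arbitrary shifts. *)
Lemma gauss_affine_lower n (a : R) (w : 'cV[R]_n) (L : 'M[R]_n) s :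
  a != 0 -> (forall s', gauss_affine L s') ->
  gauss_affine (block_mx a%:M 0 w L : 'M[R]_(1 + n)) s.
Proof.
move=> a0 aL F mF F0; rewrite ge0_integral_gaussS; first last.
- by move=> ?; rewrite mule_ge0 ?F0// lee_fin mulr_ge0// wexp_ge0.
- exact: measurable_gauss_affine.
pose G y := (\int[gauss n]_t F (cons_tuple (y, t)))%E.
have mG : measurable_fun setT G.
  apply: (measurable_fun_fubini_tonelli_F (F \o @cons_tuple R n)) => [|xt]; last exact: F0.
  by apply: measurableT_comp => //; exact: measurable_cons_tuple.
have G0 y : (0 <= G y)%E by apply: integral_ge0 => t _; exact: F0.
rewrite [RHS](ge0_integral_gaussS mF F0) -/G.
pose s0 := s (lshift n 0) 0.
rewrite -(@ge0_integral_std_normal_affine R a s0 G)//.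
apply: eq_integral => x _.
have mFx : measurable_fun setT (fun t => F (cons_tuple (a * x + s0, t))).
  apply: measurableT_comp => //; apply: (measurableT_comp (@measurable_cons_tuple R n)).
  exact/measurable_fun_pair.
rewrite /G -(aL (x *: w + dsubmx s) _ mFx (fun t => F0 _)).
rewrite -ge0_integralZr//; first last.
- by rewrite lee_fin mulr_ge0// wexp_ge0.
- by move=> ? _; rewrite mule_ge0 ?F0// lee_fin mulr_ge0// wexp_ge0.
- exact: (@measurable_gauss_affine n L _ (fun t => F (cons_tuple (a * x + s0, t)))).
apply: eq_integral => t _; rewrite colv_cons.
have -> : block_mx a%:M 0 w L *m col_mx x%:M (colv t) + s =
    col_mx (a * x + s0)%:M (L *m colv t + (x *: w + dsubmx s)).
  rewrite -[s in LHS]vsubmxK mul_block_col add_col_mx mul0mx addr0 -scalar_mxM.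
  congr col_mx; last by rewrite mul_mx_scalar addrCA addrA.
  by apply/matrixP => i j; rewrite !ord1 !mxE !mulr1n.
rewrite tupv_cons !sqn_col_mx !sqn_scalar det_lblock det_scalar1 normrM -wexpM -muleA.
congr (_ * _)%E; rewrite -EFinM; congr EFin; ring.
Qed.

Lemma gauss_affine_upper n (a : R) (w : 'rV[R]_n) (U : 'M[R]_n) s :
  a != 0 -> (forall s', gauss_affine U s') ->
  gauss_affine (block_mx a%:M w 0 U : 'M[R]_(1 + n)) s.
Proof.
move=> a0 aU F mF F0; rewrite ge0_integral_gaussS2; first last.
- by move=> ?; rewrite mule_ge0 ?F0// lee_fin mulr_ge0// wexp_ge0.
- exact: measurable_gauss_affine.
have mH := measurable_gaussS2 mF F0.
have H0 t : (0 <= \int[std_normal]_x F (cons_tuple (x, t)))%E.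
  by apply: integral_ge0 => x _; exact: F0.
rewrite [RHS](ge0_integral_gaussS2 mF F0) -(aU (dsubmx s) _ mH H0).
apply: eq_integral => t _.
pose s0 := (w *m colv t) 0 0 + s (lshift n 0) 0.
set t' := tupv _.
have mFt : measurable_fun setT (fun x => F (cons_tuple (x, t'))).
  apply: measurableT_comp => //; apply: (measurableT_comp (@measurable_cons_tuple R n)).
  exact/measurable_fun_pair.
rewrite -(@ge0_integral_std_normal_affine R a s0 (fun x => F (cons_tuple (x, t'))))//.
rewrite -ge0_integralZr//; first last.
- by rewrite lee_fin mulr_ge0// wexp_ge0.
- by move=> ? _; rewrite mule_ge0 ?F0// lee_fin mulr_ge0// wexp_ge0.
- have maff : measurable_fun [set: R] (fun x : R => a * x + s0).
    by apply: measurable_funD => //; exact: measurable_funM.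
  apply: emeasurable_funM; first exact: (measurableT_comp mFt).
  apply/measurable_EFinP; apply: measurable_funM => //.
  by apply: measurable_wexp; exact: measurable_funX.
apply: eq_integral => x _; rewrite colv_cons.
have -> : block_mx a%:M w 0 U *m col_mx x%:M (colv t) + s =
    col_mx (a * x + s0)%:M (U *m colv t + dsubmx s).
  rewrite -[s in LHS]vsubmxK mul_block_col add_col_mx mul0mx add0r -scalar_mxM.
  congr col_mx; rewrite [w *m _]mx11_scalar.
  by apply/matrixP => i j; rewrite !ord1 !mxE !mulr1n /s0 mxE addrA.
rewrite tupv_cons !sqn_col_mx !sqn_scalar det_ublock det_scalar1 normrM -wexpM -muleA.
congr (_ * _)%E; rewrite -EFinM; congr EFin; ring.
Qed.

End gauss_affine.

Section gauss_affine_unit.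
Context {R : realType}.

Lemma gauss_affine_trig n (L : 'M[R]_n) : is_trig_mx L ->
  (forall i, L i i != 0) -> forall s, gauss_affine L s.
Proof.
elim: n L => [|n IH] L tL L0 s; first exact: gauss_affine0.
rewrite -[n.+1]/(1 + n)%N in L tL L0 s *.
move: tL L0; rewrite -[L]submxK; set a := ulsubmx L; set b := ursubmx L.
set c := dlsubmx L; set D := drsubmx L => tL L0.
move: (tL); rewrite is_trig_block_mx// => /and3P[/eqP b0 _ tD].
have aE : a = (a 0 0)%:M by exact: mx11_scalar.
rewrite b0 aE; apply: gauss_affine_lower => [|s'].
  by have := L0 (lshift n 0); rewrite block_mxEul.
by apply: IH => // i; have := L0 (rshift 1 i); rewrite block_mxEdr.
Qed.

Lemma gauss_affine_trigT n (U : 'M[R]_n) : is_trig_mx U^T ->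
  (forall i, U i i != 0) -> forall s, gauss_affine U s.
Proof.
elim: n U => [|n IH] U tU U0 s; first exact: gauss_affine0.
rewrite -[n.+1]/(1 + n)%N in U tU U0 s *.
move: tU U0; rewrite -[U]submxK; set a := ulsubmx U; set b := ursubmx U.
set c := dlsubmx U; set D := drsubmx U => tU U0.
move: (tU); rewrite tr_block_mx is_trig_block_mx// => /and3P[/eqP c0 _ tD].
have aE : a = (a 0 0)%:M by exact: mx11_scalar.
have {}c0 : c = 0 by rewrite -[c]trmxK c0 trmx0.
rewrite c0 aE; apply: gauss_affine_upper => [|s'].
  by have := U0 (lshift n 0); rewrite block_mxEul.
by apply: IH => // i; have := U0 (rshift 1 i); rewrite block_mxEdr.
Qed.

Lemma gauss_affine_perm n (s : {perm 'I_n}) : gauss_affine (perm_mx s : 'M[R]_n) 0.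
Proof.
move=> F mF F0.
have permE (t : n.-tuple R) : tupv (perm_mx s *m colv t + 0) = [tuple tnth t (s i) | i < n].
  by apply/eq_from_tnth => i; rewrite !tnth_mktuple addr0 -row_permE !mxE.
pose pi (t : n.-tuple R) := [tuple tnth t (s i) | i < n].
have mpi : measurable_fun setT pi.
  apply/measurable_fun_tnthP => i.
  rewrite (_ : _ \o _ = (@tnth _ R)^~ (s i)); first exact: measurable_tnth.
  by apply/funext => t /=; rewrite tnth_mktuple.
pose mfpi : {mfun n.-tuple R >-> n.-tuple R} := HB.pack pi
  (isMeasurableFun.Build _ _ _ _ _ mpi).
have piE A : measurable A -> gauss n A = distribution (gauss n) mfpi A.
  move=> mA; apply/esym/measure_tuple_unique => // C mC.
  rewrite -[LHS]/(gauss n (pi @^-1` box C)).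
  have -> : pi @^-1` box C = box (fun i => C (s^-1 i)%g).
    apply/seteqP; split=> t H i _.
      by have := H (s^-1 i)%g I; rewrite /preimage/= tnth_mktuple permKV.
    by have := H (s i) I; rewrite /preimage/= tnth_mktuple permK.
  rewrite !gauss_box// (reindex_inj (@perm_inj _ s))/=.
  by apply: eq_bigr => i _; rewrite permK.
rewrite [RHS](eq_measure_integral (distribution (gauss n) mfpi)); last first.
  by move=> A mA _; exact: piE.
rewrite [RHS]ge0_integral_distribution//; apply: eq_integral => t _.
rewrite permE det_perm normrX normrN1 expr1n mulr1.
have -> : sqn (perm_mx s *m colv t + 0) = sqn (colv t).
  rewrite addr0 /sqn trmx_mul -mulmxA (mulmxA (perm_mx s)^T).
  by rewrite tr_perm_mx -perm_mxM mulVg perm_mx1 mul1mx.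
by rewrite /wexp subrr mulr0 expR0 mule1.
Qed.

(** The LUP factorization reduces the map to a permutation, which preserves boxes up to reindexing,
    and two triangular maps. *)
Lemma gauss_affine_unit n (P : 'M[R]_n) s : P \in unitmx -> gauss_affine P s.
Proof.
case: n P s => [|n] P s uP; first exact: gauss_affine0.
have := cormen_lup_correct P; have := cormen_lup_perm P.
have := @cormen_lup_lower R n P; have := @cormen_lup_upper R n P.
have := cormen_lup_detL P.
case: (cormen_lup P) => -[Q L] U/= dL upU lowL /is_perm_mxP[sg QE] PE.
have uL : L \in unitmx by rewrite unitmxE dL unitr1.
have uQ : Q \in unitmx by rewrite QE unitmx_perm.
have uU : U \in unitmx.
  have : Q *m P \in unitmx by rewrite unitmx_mul uQ.
  by rewrite [Q *m P]PE unitmx_mul => /andP[].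
have {}PE : P = perm_mx (sg^-1)%g *m (L *m U).
  by rewrite -[L *m U]/(L * U) -PE mulmxA QE -perm_mxM mulVg perm_mx1 mul1mx.
have trigL : is_trig_mx L.
  by apply/is_trig_mxP => i j ij; rewrite lowL ?(ltnW ij)// -val_eqE/= (ltn_eqF ij).
have trigU : is_trig_mx U^T.
  by apply/is_trig_mxP => i j ij; rewrite mxE upU.
have U0 i : U i i != 0.
  move: uU; rewrite unitmxE unitfE -det_tr det_trig// => /prodf_neq0/(_ i isT).
  by rewrite mxE.
have L0 i : L i i != 0 by rewrite lowL// eqxx oner_neq0.
(* The permutation is treated without a shift, so the whole shift is transported to the factor
   [L]. *)
pose s' := invmx (perm_mx (sg^-1)%g) *m s.
have -> : s = perm_mx (sg^-1)%g *m (L *m 0 + s') + 0.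
  by rewrite mulmx0 add0r addr0 mulKVmx// unitmx_perm.
rewrite PE; apply: gauss_affine_comp; first exact: gauss_affine_perm.
by apply: gauss_affine_comp; [exact: gauss_affine_trig|exact: gauss_affine_trigT].
Qed.

(** An orthogonal map preserves norms, so the weight [wexp] is 1, and so is the absolute
    determinant. *)
Lemma gauss_rotation n (O : 'M[R]_n) (F : n.-tuple R -> \bar R) :
  O *m O^T = 1%:M -> measurable_fun setT F -> (forall t, (0 <= F t)%E) ->
  (\int[gauss n]_t F (tupv (O *m colv t)) = \int[gauss n]_t F t)%E.
Proof.
move=> OO mF F0; have [uO _] := mulmx1_unit OO.
have OTO : O^T *m O = 1%:M by exact: mulmx1C.
rewrite -(gauss_affine_unit 0 uO mF F0); apply: eq_integral => t _.
have -> : `|\det O| = 1.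
  apply/eqP; rewrite -(@eqrXn2 _ 2)// expr1n real_normK ?num_real//.
  by rewrite expr2 -{2}det_tr -det_mulmx OO det1.
rewrite addr0 [X in wexp _ X](_ : _ = sqn (colv t)).
  by rewrite /wexp subrr mulr0 expR0 mulr1 mule1.
by rewrite /sqn trmx_mul -mulmxA (mulmxA O^T) OTO mul1mx.
Qed.

(** The change of variables applied to the constant 1. *)
Lemma gauss_integral n (P : 'M[R]_n) s : P \in unitmx ->
  (\int[gauss n]_t (wexp (sqn (colv t)) (sqn (P *m colv t + s)))%:E =
   (`|\det P|^-1)%:E)%E.
Proof.
move=> uP; have dP : 0 < `|\det P| by rewrite normr_gt0 -unitfE -unitmxE.
have := gauss_affine_unit s uP (F := fun=> 1%E) (measurable_cst _) (fun=> lee01).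
rewrite integral_cst//= probability_setT mule1 => E1.
have := congr1 (fun x => (x * (`|\det P|^-1)%:E)%E) E1.
rewrite mul1e => <-; rewrite -ge0_integralZr//.
- by apply: eq_integral => t _; rewrite mul1e -EFinM mulfK// gt_eqF.
- under eq_fun do rewrite mul1e.
  apply/measurable_EFinP; apply: measurable_funM => //; apply: measurable_wexp.
    by apply: measurable_sqn; exact: measurable_colv.
  apply: measurable_sqn; apply: measurable_vec_add; last exact: measurable_vec_cst.
  by apply: measurable_vec_mul; exact: measurable_colv.
- by move=> t _; rewrite mul1e lee_fin mulr_ge0// wexp_ge0.
Qed.

End gauss_affine_unit.

(** * Integrals of real-valued functions *)

Section expectation.
Context {R : realType} {d} {T : measurableType d} (P : probability T R).
Implicit Types f g : T -> R.

Definition intg f := P.-integrable setT (EFin \o f).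

Definition L2fun f := measurable_fun setT f /\ intg (fun t => f t ^+ 2).

Lemma intg_measurable f : intg f -> measurable_fun setT f.
Proof. by move=> /measurable_int/measurable_EFinP. Qed.

Lemma EFin_Rintegral f : intg f -> (\int[P]_t (f t)%:E)%E = (\int[P]_t f t)%:E.
Proof. by move=> fi; rewrite /Rintegral fineK//; exact: integrable_fin_num. Qed.

Lemma intg_le f g : measurable_fun setT f -> intg g ->
  (forall t, `|f t| <= g t) -> intg f.
Proof.
move=> mf ig fg; apply: (le_integrable measurableT _ _ ig); first exact/measurable_EFinP.
by move=> t _ /=; rewrite lee_fin (le_trans (fg t))// ler_norm.
Qed.

Lemma intg_cst c : intg (fun=> c).
Proof. exact: finite_measure_integrable_cst. Qed.

Lemma intg_bounded f c : measurable_fun setT f -> (forall t, `|f t| <= c) -> intg f.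
Proof. by move=> mf fc; apply: (intg_le mf (intg_cst c)). Qed.

Lemma intgD f g : intg f -> intg g -> intg (fun t => f t + g t).
Proof. by move=> fi gi; have := integrableD measurableT fi gi. Qed.

Lemma intgB f g : intg f -> intg g -> intg (fun t => f t - g t).
Proof. by move=> fi gi; have := integrableB measurableT fi gi. Qed.

Lemma intgZ c f : intg f -> intg (fun t => c * f t).
Proof. by move=> fi; have := integrableZl measurableT c fi. Qed.

Lemma intg_sum (I : Type) (s : seq I) (Q : pred I) (h : I -> T -> R) :
  (forall i, Q i -> intg (h i)) -> intg (fun t => \sum_(i <- s | Q i) h i t).
Proof.
move=> hi; elim: s => [|i s IH].
  by rewrite (_ : (fun _ => _) = fun=> 0); [exact: intg_cst|apply/funext => t; rewrite big_nil].
have [Qi|nQi] := boolP (Q i).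
  rewrite (_ : (fun _ => _) = fun t => h i t + \sum_(j <- s | Q j) h j t).
    by apply: intgD => //; exact: hi.
  by apply/funext => t; rewrite big_cons Qi.
rewrite (_ : (fun _ => _) = fun t => \sum_(j <- s | Q j) h j t)//.
by apply/funext => t; rewrite big_cons (negbTE nQi).
Qed.

Lemma Rintegral_cst1 c : \int[P]_t c = c.
Proof. by rewrite Rintegral_cst//= probability_setT mulr1. Qed.

Lemma Rintegral_sum (I : Type) (s : seq I) (Q : pred I) (h : I -> T -> R) :
  (forall i, Q i -> intg (h i)) ->
  \int[P]_t (\sum_(i <- s | Q i) h i t) = \sum_(i <- s | Q i) \int[P]_t h i t.
Proof.
move=> hi; elim: s => [|i s IH].
  rewrite big_nil -[RHS]Rintegral_cst1.
  by apply: eq_Rintegral => t _; rewrite big_nil.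
rewrite big_cons -IH; have [Qi|Qi] := boolP (Q i).
  rewrite -RintegralD//; [|exact: hi|exact: intg_sum].
  by apply: eq_Rintegral => t _; rewrite big_cons Qi.
by apply: eq_Rintegral => t _; rewrite big_cons (negbTE Qi).
Qed.

Lemma intg_ae f g : intg f -> measurable_fun setT g -> {ae P, forall t, f t = g t} ->
  intg g.
Proof.
move=> fi mg fg; apply/integrableP; split; first exact/measurable_EFinP.
suff -> : (\int[P]_x `|(EFin \o g) x| = \int[P]_x `|(EFin \o f) x|)%E.
  by case/integrableP: fi.
apply: ae_eq_integral => //.
- by apply: measurableT_comp => //; exact/measurable_EFinP.
- by apply: measurableT_comp => //; case/integrableP: fi.
- by apply: filterS fg => t /= -> _.
Qed.

Lemma Rintegral_ae f g : measurable_fun setT f -> measurable_fun setT g ->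
  {ae P, forall t, f t = g t} -> \int[P]_t f t = \int[P]_t g t.
Proof.
move=> mf mg fg; rewrite /Rintegral; congr fine; apply: ae_eq_integral => //.
- exact/measurable_EFinP.
- exact/measurable_EFinP.
- by apply: filterS fg => t /= -> _.
Qed.

Lemma Rintegral_le_ae f g : intg f -> intg g -> {ae P, forall t, f t <= g t} ->
  \int[P]_t f t <= \int[P]_t g t.
Proof.
move=> fi gi fg; have mf := intg_measurable fi; have mg := intg_measurable gi.
(* [g] is replaced by an almost everywhere equal function that dominates [f] everywhere. *)
pose h t := Num.max (f t) (g t).
have mh : measurable_fun setT h by exact: measurable_maxr.
have hg : {ae P, forall t, g t = h t}.
  by apply: filterS fg => t /= /max_r <-.
rewrite (Rintegral_ae mg mh hg); apply: le_Rintegral => //.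
  exact: intg_ae hg.
by move=> t _; rewrite /h le_max lexx.
Qed.

Lemma L2_mul f g : L2fun f -> L2fun g -> intg (fun t => f t * g t).
Proof.
move=> [mf fi] [mg gi]; apply: (intg_le _ (intgD fi gi)); first exact: measurable_funM.
move=> t; rewrite ler_norml; have := sqr_ge0 (f t + g t); have := sqr_ge0 (f t - g t).
by move: (f t) (g t) => x y ? ?; apply/andP; split; nra.
Qed.

Lemma L2_cst c : L2fun (fun=> c).
Proof. by split=> //; exact: intg_cst. Qed.

Lemma L2_intg f : L2fun f -> intg f.
Proof.
by move=> fL; have := L2_mul fL (L2_cst 1); under eq_fun do rewrite mulr1.
Qed.

Lemma L2D f g : L2fun f -> L2fun g -> L2fun (fun t => f t + g t).
Proof.
move=> fL gL; split; first by apply: measurable_funD; [case: fL|case: gL].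
have -> : (fun t => (f t + g t) ^+ 2) =
    (fun t => f t ^+ 2 + (2 * (f t * g t) + g t ^+ 2)).
  by apply/funext => t; ring.
by apply: intgD; [case: fL|apply: intgD; [apply: intgZ; exact: L2_mul|case: gL]].
Qed.

Lemma L2Z c f : L2fun f -> L2fun (fun t => c * f t).
Proof.
move=> [mf fi]; split; first exact: measurable_funM.
by under eq_fun do rewrite exprMn; exact: intgZ.
Qed.

Lemma L2B f g : L2fun f -> L2fun g -> L2fun (fun t => f t - g t).
Proof.
move=> fL gL; under eq_fun do rewrite -mulN1r; apply: L2D => //; exact: L2Z.
Qed.

Lemma L2_sum (I : Type) (s : seq I) (Q : pred I) (h : I -> T -> R) :
  (forall i, Q i -> L2fun (h i)) -> L2fun (fun t => \sum_(i <- s | Q i) h i t).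
Proof.
move=> hi; elim: s => [|i s IH].
  by rewrite (_ : (fun _ => _) = fun=> 0); [exact: L2_cst|apply/funext => t; rewrite big_nil].
have [Qi|nQi] := boolP (Q i).
  rewrite (_ : (fun _ => _) = fun t => h i t + \sum_(j <- s | Q j) h j t).
    by apply: L2D => //; exact: hi.
  by apply/funext => t; rewrite big_cons Qi.
rewrite (_ : (fun _ => _) = fun t => \sum_(j <- s | Q j) h j t)//.
by apply/funext => t; rewrite big_cons (negbTE nQi).
Qed.

Lemma L2_bounded f c : measurable_fun setT f -> (forall t, `|f t| <= c) -> L2fun f.
Proof.
move=> mf fc; split=> //; apply: (@intg_bounded _ (c ^+ 2)); first exact: measurable_funX.
by move=> t; rewrite normrX lerXn2r ?nnegrE// (le_trans (normr_ge0 (f t))).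
Qed.

Lemma L2_le f g : measurable_fun setT f -> L2fun g ->
  (forall t, `|f t| <= `|g t|) -> L2fun f.
Proof.
move=> mf [mg gi] fg; split=> //; apply: (intg_le _ gi); first exact: measurable_funX.
move=> t; rewrite normrX -[g t ^+ 2]ger0_norm ?sqr_ge0// normrX.
by rewrite lerXn2r ?nnegrE.
Qed.

Lemma L2_ae f g : L2fun f -> measurable_fun setT g -> {ae P, forall t, f t = g t} ->
  L2fun g.
Proof.
move=> [mf fi] mg fg; split=> //; apply: (intg_ae fi); first exact: measurable_funX.
by apply: filterS fg => t ->.
Qed.

End expectation.

Section std_normal_moments.
Context {R : realType}.

Let M := (\int[@std_normal R]_x (x ^+ 2)%:E)%E.

Let M_ge0 : (0 <= M)%E.
Proof. by apply: integral_ge0 => x _; rewrite lee_fin sqr_ge0. Qed.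

Let wexp_integral (c : R) : 0 < c ->
  (\int[std_normal]_x (wexp (x ^+ 2) ((c * x) ^+ 2) * c)%:E = 1)%E.
Proof.
move=> c0; have := @ge0_integral_std_normal_affine R c 0 (fun=> 1%E).
rewrite integral_cst//= probability_setT mule1 gtr0_norm// => <-//; last by rewrite gt_eqF.
by apply: eq_integral => x _; rewrite mul1e addr0.
Qed.

Let msqr : measurable_fun [set: R] (fun x : R => (x ^+ 2)%:E).
Proof. by apply/measurable_EFinP; exact: measurable_funX. Qed.

(** The density ratio [wexp (x ^+ 2) ((c * x) ^+ 2) * c] integrates to 1 for every c > 0. The
    inequality 1 + y <= exp y in its exponent bounds the second moment from above when c < 1 and
    from below when c > 1, and both bounds tend to 1 with c. *)
Let M_ub (c : R) : 0 < c < 1 -> (((1 - c ^+ 2) / 2 * c)%:E * M <= (1 - c)%:E)%E.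
Proof.
move=> /andP[c0 c1]; have k0 : 0 <= (1 - c ^+ 2) / 2 * c by nra.
rewrite /M -ge0_integralZl//; last by move=> x _; rewrite lee_fin sqr_ge0.
rewrite EFinB leeBrDr// -(wexp_integral c0).
have -> : c%:E = (\int[std_normal]_x (cst c%:E x))%E.
  by rewrite integral_cst//= probability_setT mule1.
rewrite -ge0_integralD//; first last.
- by move=> x _; rewrite lee_fin ltW.
- exact: measurable_funeM.
- by move=> x _; rewrite -EFinM lee_fin mulr_ge0 ?sqr_ge0.
apply: ge0_le_integral => //.
- by move=> x _; rewrite -EFinM -EFinD lee_fin addr_ge0 ?(ltW c0)// mulr_ge0 ?sqr_ge0.
- by apply: emeasurable_funD => //; exact: measurable_funeM.
- apply/measurable_EFinP; apply: measurable_funM => //.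
  by apply: measurable_wexp; apply: measurable_funX => //; exact: measurable_funM.
- move=> x _; rewrite -EFinM -EFinD lee_fin.
  have := expR_ge1Dx (2^-1 * (x ^+ 2 - (c * x) ^+ 2)); rewrite -/(wexp _ _).
  by move: (wexp _ _) => w; rewrite exprMn; move: (x ^+ 2) => y; nra.
Qed.

Let M_lb (c : R) : 1 < c -> (c%:E <= 1 + ((c ^+ 2 - 1) / 2 * c)%:E * M)%E.
Proof.
move=> c1; have c0 : 0 < c by lra.
have k0 : 0 <= (c ^+ 2 - 1) / 2 * c by nra.
rewrite /M -ge0_integralZl//; last by move=> x _; rewrite lee_fin sqr_ge0.
rewrite -{1}(wexp_integral c0).
have mw : measurable_fun setT (fun x : R => (wexp (x ^+ 2) ((c * x) ^+ 2) * c)%:E).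
  apply/measurable_EFinP; apply: measurable_funM => //.
  by apply: measurable_wexp; apply: measurable_funX => //; exact: measurable_funM.
rewrite -ge0_integralD//; first last.
- exact: measurable_funeM.
- by move=> x _; rewrite -EFinM lee_fin mulr_ge0 ?sqr_ge0.
- by move=> x _; rewrite lee_fin mulr_ge0 ?wexp_ge0// ltW.
have -> : c%:E = (\int[std_normal]_x (cst c%:E x))%E.
  by rewrite integral_cst//= probability_setT mule1.
apply: ge0_le_integral => //.
- by move=> x _; rewrite lee_fin ltW.
- by apply: emeasurable_funD => //; exact: measurable_funeM.
- move=> x _; rewrite -EFinM -EFinD lee_fin.
  have := expR_ge1Dx (2^-1 * (x ^+ 2 - (c * x) ^+ 2)); rewrite -/(wexp _ _).
  by move: (wexp _ _) => w; rewrite exprMn; move: (x ^+ 2) => y; nra.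
Qed.

Lemma std_normal_second_moment : M = 1%E.
Proof.
have Mfin : M \is a fin_num.
  have c12 : 0 < (2^-1 : R) < 1 by lra.
  have := M_ub c12; move: M M_ge0 => [m _||] //.
  by rewrite gt0_muley ?leye_eq// lte_fin; lra.
(* The bounds read m <= 2 / (c (1 + c)) for c < 1 and m >= 2 / (c (1 + c)) for c > 1. They are
   contradicted at the midpoint of 1 / m and 1 if m > 1, and at the midpoint of 1 and 2 - m if m <
   1. *)
have := M_ub; have := M_lb; rewrite -(fineK Mfin); set m := fine M.
have m0 : 0 <= m by exact: fine_ge0.
move=> lb ub; congr EFin; apply/eqP; rewrite eq_le !leNgt; apply/andP; split.
- apply/negP => m1.
  have m2 : 0 < 2 * m by lra.
  have c01 : 0 < (m + 1) / (2 * m) < 1.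
    by rewrite divr_gt0/= ?ltr_pdivrMr//; lra.
  have := ub _ c01; rewrite -EFinM lee_fin leNgt => /negP; apply.
  set c := (m + 1) / (2 * m); have cE : c * (2 * m) = m + 1 by rewrite divfK// gt_eqF.
  have /andP[c0 c1] := c01; rewrite -/c in c0 c1.
  suff : 2 < c * (1 + c) * m by nra.
  by nra.
- apply/negP => m1; pose e := (1 - m) / 2.
  have c1 : 1 < 1 + e by rewrite /e; lra.
  have := lb _ c1; rewrite -EFinM -EFinD lee_fin leNgt => /negP; apply.
  have e0 : 0 < e by rewrite /e; lra.
  have -> : m = 1 - 2 * e by rewrite /e; field.
  suff : 0 < e ^+ 2 * (1 + 5 * e + 2 * e ^+ 2) by nra.
  by apply: mulr_gt0; [exact: exprn_gt0|nra].
Qed.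

End std_normal_moments.

Section same_law.
Context {R : realType} {d} {T : measurableType d} (P : probability T R).
Context {d'} {T' : measurableType d'} (Q : probability T' R) (X : T -> T').
Hypothesis mX : measurable_fun setT X.
Hypothesis lawX : forall A, measurable A -> P (X @^-1` A) = Q A.

Let XX : {RV P >-> T'} :=
  HB.pack X (isMeasurableFun.Build _ _ _ _ _ mX).

Lemma ge0_integral_law (f : T' -> \bar R) : measurable_fun setT f ->
  (forall y, (0 <= f y)%E) -> (\int[P]_t f (X t) = \int[Q]_y f y)%E.
Proof.
move=> mf f0; rewrite -[LHS](ge0_integral_distribution XX mf f0).
by apply: eq_measure_integral => A mA _; exact: lawX.
Qed.

Lemma intg_law (f : T' -> R) : intg Q f -> intg P (f \o X).
Proof.
move=> fi; have mf := intg_measurable fi; apply/integrableP; split.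
  by apply/measurable_EFinP; exact: measurableT_comp.
have mf' : measurable_fun setT (fun y => `|(f y)%:E|%E).
  by apply: measurableT_comp => //; exact/measurable_EFinP.
by rewrite (ge0_integral_law mf') //; case/integrableP: fi.
Qed.

Lemma L2_law (f : T' -> R) : L2fun Q f -> L2fun P (f \o X).
Proof. by move=> [mf fi]; split; [exact: measurableT_comp|exact: (intg_law fi)]. Qed.

Lemma Rintegral_law (f : T' -> R) : intg Q f ->
  \int[P]_t f (X t) = \int[Q]_y f y.
Proof.
move=> fi; rewrite /Rintegral; congr fine.
have mf : measurable_fun setT (EFin \o f) by case/integrableP: fi.
rewrite -[LHS](integral_distribution (X := XX) mf); last exact: intg_law.
by apply: eq_measure_integral => A mA _; exact: lawX.
Qed.

End same_law.

Section gauss_moments.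
Context {R : realType} {n : nat}.
Implicit Types i j : 'I_n.
Local Notation gauss := (@gauss R n).

Lemma gauss_coord i A : measurable A -> gauss ((@tnth _ R)^~ i @^-1` A) = std_normal A.
Proof.
move=> mA; have -> : (@tnth _ R)^~ i @^-1` A = box (fun j => if j == i then A else setT).
  apply/seteqP; split=> [t At j _|t]; rewrite /preimage/=; first by case: ifPn => // /eqP ->.
  by move=> /(_ i I); rewrite /preimage/= eqxx.
rewrite gauss_box; last by move=> j; case: ifP.
rewrite (bigD1 i)//= eqxx big1 ?mule1// => j /negbTE ->.
exact: probability_setT.
Qed.

Lemma std_normal_L2 : L2fun (@std_normal R) idfun.
Proof.
split; first exact: measurable_id.
rewrite /intg; apply/integrableP; split.
  apply/measurable_EFinP; apply: (@measurable_funX _ _ _ _ idfun).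
  exact: measurable_id.
under eq_integral do rewrite /= ger0_norm ?sqr_ge0//.
by rewrite std_normal_second_moment ltry.
Qed.

Lemma gauss_coord_L2 i : L2fun gauss (fun t => tnth t i).
Proof. exact: (L2_law (measurable_tnth i) (@gauss_coord i) std_normal_L2). Qed.

Lemma gauss_coord_second i : \int[gauss]_t (tnth t i ^+ 2) = 1.
Proof.
rewrite -[RHS]/(fine 1%E) -std_normal_second_moment.
exact: (Rintegral_law (measurable_tnth i) (@gauss_coord i) std_normal_L2.2).
Qed.

Let flip i : 'M[R]_n := diag_mx (\row_j (if j == i then -1 else 1)).

Let flip_orth i : flip i *m (flip i)^T = 1%:M.
Proof.
rewrite /flip tr_diag_mx mulmx_diag -diag_const_mx; congr diag_mx.
by apply/rowP => j; rewrite !mxE; case: ifP; rewrite ?mulrNN mulr1.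
Qed.

Let flipE i j (t : n.-tuple R) :
  tnth (tupv (flip i *m colv t)) j = (if j == i then -1 else 1) * tnth t j.
Proof. by rewrite tnth_mktuple mul_diag_mx !mxE. Qed.

(* The reflection of coordinate i leaves the law unchanged, so the two squares
   below have the same integral. *)
Let flip_mean i (g : n.-tuple R -> R) : L2fun gauss g ->
  (forall t, g (tupv (flip i *m colv t)) = g t) ->
  \int[gauss]_t (tnth t i * g t) = 0.
Proof.
move=> gL gflip; have tL := gauss_coord_L2 i; have [mg gi] := gL; have [_ ti] := tL.
have mF : measurable_fun setT (fun t : n.-tuple R => ((tnth t i + g t) ^+ 2)%:E).
  apply/measurable_EFinP; apply: measurable_funX; apply: measurable_funD => //.
  exact: measurable_tnth.
have F0 t : (0 <= ((tnth t i + g t) ^+ 2)%:E)%E by rewrite lee_fin sqr_ge0.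
(* Rotation invariance is stated for nonnegative integrands, hence the detour through squares. *)
have := gauss_rotation (flip_orth i) mF F0.
under eq_integral do rewrite gflip flipE eqxx mulN1r.
move=> /(congr1 fine).
rewrite -[LHS]/(\int[gauss]_t ((- tnth t i + g t) ^+ 2)).
rewrite -[RHS]/(\int[gauss]_t ((tnth t i + g t) ^+ 2)).
have tg : intg gauss (fun t => tnth t i * g t) by exact: L2_mul.
have sgn (e : R) : e ^+ 2 = 1 -> \int[gauss]_t ((e * tnth t i + g t) ^+ 2) =
    1 + (2 * e * \int[gauss]_t (tnth t i * g t) + \int[gauss]_t (g t ^+ 2)).
  move=> e2; rewrite -[X in _ = X + _](gauss_coord_second i) -RintegralZl// -RintegralD//; last exact: intgZ.
  rewrite -RintegralD//; last by apply: intgD => //; exact: intgZ.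
  apply: eq_Rintegral => t _.
  move: (tnth t i) (g t) => x y; transitivity (e ^+ 2 * x ^+ 2 + (2 * e * (x * y) + y ^+ 2)); first by ring.
  by rewrite e2 mul1r.
have := sgn (-1); rewrite sqrrN expr1n => /(_ erefl).
have := sgn 1; rewrite expr1n => /(_ erefl).
under eq_Rintegral do rewrite mul1r; move=> ->.
under eq_Rintegral do rewrite mulN1r; move=> ->.
by move=> H; lra.
Qed.

Lemma gauss_mean_mul i (g : n.-tuple R -> R) : L2fun gauss g ->
  (forall t t', (forall j, j != i -> tnth t j = tnth t' j) -> g t = g t') ->
  \int[gauss]_t (tnth t i * g t) = 0.
Proof.
move=> gL gi; apply: flip_mean => // t; apply: gi => j /negbTE ji.
by rewrite flipE ji mul1r.
Qed.

Lemma gauss_second_moment i j :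
  \int[gauss]_t (tnth t i * tnth t j) = (i == j)%:R.
Proof.
have [<-|ij] := eqVneq i j.
  by rewrite -[RHS](gauss_coord_second i); apply: eq_Rintegral => t _; rewrite expr2.
apply: flip_mean; first exact: gauss_coord_L2.
by move=> t; rewrite flipE eq_sym (negbTE ij) mul1r.
Qed.

End gauss_moments.

Section quadratic.
Context {R : realType}.

Definition qf n (M : 'M[R]_n) (v : 'cV[R]_n) : R := (v^T *m M *m v) 0 0.

Lemma qfB n (M : 'M[R]_n) u v : M^T = M ->
  qf M (u - v) = qf M u - 2 * (u^T *m M *m v) 0 0 + qf M v.
Proof.
move=> sM; rewrite /qf [(_ - _)^T]linearB/= !mulmxBl !mulmxBr !(addmxE, oppmxE).
by rewrite (bilin_sym v u sM); ring.
Qed.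

Lemma qf1 n (v : 'cV[R]_n) : qf 1%:M v = sqn v.
Proof. by rewrite /qf mulmx1. Qed.

Lemma qf_congr m n (A : 'M[R]_(m, n)) (M : 'M[R]_m) v :
  qf (A^T *m M *m A) v = qf M (A *m v).
Proof. by rewrite /qf trmx_mul !mulmxA. Qed.

Lemma qfE n (M : 'M[R]_n) v : qf M v = \sum_i \sum_j M i j * (v i 0 * v j 0).
Proof.
rewrite /qf mxE exchange_big/=; apply: eq_bigr => j _; rewrite mxE big_distrl/=.
by apply: eq_bigr => i _; rewrite mxE; ring.
Qed.

Lemma qfD_mx n (M N : 'M[R]_n) v : qf (M + N) v = qf M v + qf N v.
Proof. by rewrite /qf mulmxDr mulmxDl addmxE. Qed.

Lemma qfN_mx n (M : 'M[R]_n) v : qf (- M) v = - qf M v.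
Proof. by rewrite /qf mulmxN mulNmx oppmxE. Qed.

End quadratic.

Section centered_gaussian_law.
Context {R : realType} {k : nat} {d} {T : measurableType d}.
Variables (P : probability T R) (X : T -> k.-tuple R) (S : 'M[R]_k).
Hypothesis mX : measurable_fun setT X.
Hypothesis gX : centered_gaussian P X S.

Lemma centered_gaussian_law : exists (r : nat) (A : 'M[R]_(k, r)),
  A *m A^T = S /\ forall F : k.-tuple R -> \bar R,
    measurable_fun setT F -> (forall x, (0 <= F x)%E) ->
    (\int[P]_t F (X t) = \int[gauss r]_g F (tupv (A *m colv g)))%E.
Proof.
case: gX => r [A [G [iidG AS XE]]]; exists r, A; split=> // F mF F0.
have mG : measurable_fun setT (fun t => [tuple G i t | i < r]).
  apply/measurable_fun_tnthP => i; apply: (eq_measurable_fun (G i)) => // t _.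
  by rewrite /= tnth_mktuple.
have mAG : measurable_fun setT (fun g : r.-tuple R => F (tupv (A *m colv g))).
  apply: measurableT_comp => //; apply: measurable_tupv; apply: measurable_vec_mul.
  exact: measurable_colv.
have lawG A' : measurable A' ->
    P ((fun t => [tuple G i t | i < r]) @^-1` A') = gauss r A'.
  exact: iid_std_normal_gauss.
rewrite -(ge0_integral_law mG lawG mAG) => [|g]; last exact: F0.
apply: ge0_ae_eq_integral => //.
- exact: measurableT_comp.
- exact: (measurableT_comp mAG mG).
- apply: filterS XE => t XE _; congr F; rewrite -[LHS]colvK XE; congr tupv.
  by congr (_ *m _); apply/colP => i; rewrite !mxE tnth_mktuple.
Qed.

Lemma centered_gaussian_moments :
  (forall i, L2fun P (fun t => tnth (X t) i)) /\
  (forall i j, \int[P]_t (tnth (X t) i * tnth (X t) j) = S i j).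
Proof.
case: gX => r [A [G [iidG AS XE]]].
have mG : measurable_fun setT (fun t => [tuple G i t | i < r]).
  apply/measurable_fun_tnthP => i; apply: (eq_measurable_fun (G i)) => // t _.
  by rewrite /= tnth_mktuple.
have lawG A' : measurable A' ->
    P ((fun t => [tuple G i t | i < r]) @^-1` A') = gauss r A'.
  exact: iid_std_normal_gauss.
have GL i : L2fun P (G i).
  have := L2_law mG lawG (gauss_coord_L2 i).
  by rewrite (_ : _ \o _ = G i)//; apply/funext => t /=; rewrite tnth_mktuple.
have GG i j : \int[P]_t (G i t * G j t) = (i == j)%:R.
  have := Rintegral_law mG lawG (L2_mul (gauss_coord_L2 i) (gauss_coord_L2 j)).
  rewrite gauss_second_moment => <-.
  by apply: eq_Rintegral => t _; rewrite !tnth_mktuple.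
pose Y i t := \sum_j A i j * G j t.
have YL i : L2fun P (Y i) by apply: L2_sum => j _; exact: L2Z.
have XY i : {ae P, forall t, Y i t = tnth (X t) i}.
  apply: filterS XE => t /(congr1 (fun v : 'cV_k => v i 0)).
  by rewrite !mxE => ->; apply: eq_bigr => j _; rewrite mxE.
have mXi i : measurable_fun setT (fun t => tnth (X t) i).
  exact: (measurableT_comp (measurable_tnth i) mX).
have XL i : L2fun P (fun t => tnth (X t) i) by exact: (L2_ae (YL i) (mXi i) (XY i)).
split=> // i j.
rewrite -(@Rintegral_ae _ _ _ P (fun t => Y i t * Y j t)); first last.
- by apply: filterS2 (XY i) (XY j) => t -> ->.
- exact: measurable_funM.
- by apply: measurable_funM; [case: (YL i)|case: (YL j)].
have intA a b : intg P (fun t => A i a * A j b * (G a t * G b t)).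
  by apply: intgZ; exact: L2_mul.
transitivity (\int[P]_t (\sum_a \sum_b A i a * A j b * (G a t * G b t))).
  apply: eq_Rintegral => t _; rewrite /Y big_distrl/=; apply: eq_bigr => a _.
  by rewrite big_distrr/=; apply: eq_bigr => b _; ring.
rewrite Rintegral_sum => [|a _]; last by apply: intg_sum.
rewrite -AS mxE; apply: eq_bigr => a _.
rewrite Rintegral_sum => [|b _]; last exact: intA.
rewrite (bigD1 a)//= big1 => [|b ba].
  by rewrite RintegralZl ?GG ?eqxx ?mulr1 ?addr0 ?mxE//; exact: L2_mul.
by rewrite RintegralZl ?GG 1?eq_sym ?(negbTE ba) ?mulr0//; exact: L2_mul.
Qed.

(** The normalization of N(m, Q^-1), written relative to N(0, S). The vector is A g with A of size k
    by r, where r may exceed k, so the square is completed in the space of g. *)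
Lemma centered_gaussian_exp_quadratic (Q : 'M[R]_k) (m : 'cV[R]_k) :
  pdmx S -> pdmx Q ->
  (\int[P]_t (wexp (qf (invmx S) (colv (X t))) (qf Q (colv (X t) - m)))%:E =
   (Num.sqrt (\det Q * \det S))^-1%:E)%E.
Proof.
move=> pdS pdQ; have [r [A [AS lawX]]] := centered_gaussian_law.
have uS := pdmx_unit pdS; have pdSi := pdmx_inv pdS; set Si := invmx S in pdSi *.
(* The first two terms form the orthogonal projection onto the kernel of [A]: the noise invisible in
   X keeps its standard law, and only the visible part feels [Q]. *)
pose N := 1%:M - A^T *m Si *m A + A^T *m Q *m A.
have psdN : psdmx N.
  apply: psdmxD; last exact/psdmx_congr/pdmx_psdmx.
  set Pi := _ - _; suff -> : Pi = Pi *m Pi^T by exact: psdmx_mulmxT.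
  have -> : Pi^T = Pi.
    by rewrite /Pi linearB/= trmx1 !trmx_mul trmxK pdSi.1 mulmxA.
  rewrite /Pi mulmxBl mul1mx mulmxBr mulmx1.
  suff -> : A^T *m Si *m A *m (A^T *m Si *m A) = A^T *m Si *m A by rewrite subrr subr0.
  by rewrite !mulmxA -(mulmxA _ A A^T) AS -(mulmxA _ Si S) mulVmx// mulmx1.
have detN : \det N = \det Q * \det S.
  have -> : N = 1%:M + A^T *m ((Q - Si) *m A).
    by rewrite /N mulmxBl mulmxBr !mulmxA addrAC addrA.
  rewrite det_1_mulmx -mulmxA AS mulmxBl mulVmx// addrC subrK det_mulmx.
  by [].
have dN : 0 < \det N by rewrite detN mulr_gt0 ?pdmx_det_gt0.
have [L [tL L0 NL]] := pdmx_cholesky (psdmx_det_gt0 psdN dN).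
have uLT : L^T \in unitmx.
  by rewrite unitmx_tr unitmxE unitfE det_trig// gt_eqF// prodr_gt0.
have detL : `|\det L^T| = Num.sqrt (\det N).
  by rewrite det_tr NL det_mulmx det_tr -expr2 sqrtr_sqr.
(* [A] sends the center A^T S^-1 m to m, so [A *m y g] is the vector at which [Q] is evaluated. *)
pose y g := colv g - A^T *m Si *m m : 'cV[R]_r.
have mF : measurable_fun setT (fun x : k.-tuple R =>
    (wexp (qf Si (colv x)) (qf Q (colv x - m)))%:E).
  have mq (M : 'M[R]_k) (V : k.-tuple R -> 'cV[R]_k) :
      measurable_vec V -> measurable_fun setT (fun x => qf M (V x)).
    move=> mV; under eq_fun do rewrite qfE.
    apply: measurable_sum => i; apply: measurable_sum => j.
    by apply: measurable_funM => //; exact: measurable_funM.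
  apply/measurable_EFinP; apply: measurable_wexp; apply: mq; first exact: measurable_colv.
  by apply: measurable_vec_add; [exact: measurable_colv|exact: measurable_vec_cst].
rewrite (lawX _ mF); last by move=> x; rewrite lee_fin wexp_ge0.
rewrite -detN -detL -(gauss_integral (- (L^T *m (A^T *m Si *m m))) uLT).
apply: eq_integral => g _; congr EFin; rewrite tupvK.
have -> : L^T *m colv g - L^T *m (A^T *m Si *m m) = L^T *m y g by rewrite -mulmxBr.
have -> : sqn (L^T *m y g) = qf N (y g).
  by rewrite NL /sqn /qf trmx_mul trmxK !mulmxA.
have Ay : A *m y g = A *m colv g - m.
  by rewrite /y mulmxBr !mulmxA AS mulmxV// mul1mx.
rewrite /N !qfD_mx qfN_mx !qf_congr qf1 Ay.
have -> : qf Si (A *m colv g - m) = qf Si (A *m colv g) -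
    2 * ((A *m colv g)^T *m Si *m m) 0 0 + qf Si m by rewrite qfB ?pdSi.1.
have -> : sqn (y g) = sqn (colv g) - 2 * ((A *m colv g)^T *m Si *m m) 0 0 + qf Si m.
  rewrite /y -qf1 qfB ?trmx1// mulmx1 qf1 trmx_mul !mulmxA; congr (_ + _).
  rewrite qf1 /sqn /qf !trmx_mul trmxK pdSi.1 !mulmxA.
  by rewrite -(mulmxA _ A A^T) AS -(mulmxA _ Si S) mulVmx// mulmx1.
by rewrite /wexp; congr expR; ring.
Qed.

End centered_gaussian_law.

(** * Regression and conditional probabilities *)

Section quantizer.
Context {R : realType}.

Lemma measurable_truncn : measurable_fun [set: R] (fun x : R => Num.truncn x).
Proof.
have mgt n : measurable [set x : R | (n < Num.truncn x)%N].
  rewrite (_ : [set _ | _] = `[n.+1%:R, +oo[%classic); first exact: measurable_itv.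
  by apply/seteqP; split=> x /=; rewrite truncn_gt_nat in_itv/= andbT.
move=> _ A _; rewrite setTI.
rewrite (_ : _ @^-1` A = \bigcup_(n in A) [set x : R | Num.truncn x = n]); last first.
  apply/seteqP; split=> [x Ax|x [n An /= xn]]; first by exists (Num.truncn x).
  by rewrite /preimage/= xn.
apply: bigcup_measurable => n _.
case: n => [|n].
  rewrite (_ : [set _ | _] = ~` [set x : R | (0 < Num.truncn x)%N]).
    exact: measurableC.
  apply/seteqP; split=> x /=; first by move=> ->.
  by move/negP; rewrite -eqn0Ngt => /eqP.
rewrite (_ : [set _ | _] = [set x : R | (n < Num.truncn x)%N] `\`
    [set x : R | (n.+1 < Num.truncn x)%N]); first exact: measurableD.
apply/seteqP; split=> x /=; first by move=> ->; rewrite ltnn ltnSn.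
by move=> [n1 /negP]; rewrite -leqNgt => n2; apply/eqP; rewrite eqn_leq n1 n2.
Qed.

Definition quant_bound n := (2 * n.+1 * n.+1).+1.

Lemma quant_proof n (x : R) :
  (minn (Num.truncn ((x + n.+1%:R) * n.+1%:R)) (2 * n.+1 * n.+1) < quant_bound n)%N.
Proof. by rewrite ltnS geq_minr. Qed.

(* The index of the cell of x in the grid of step 1/(n+1) of [-(n+1), n+1];
   points outside of the interval are put in the extreme cells. *)
Definition quant n (x : R) : 'I_(quant_bound n) := Ordinal (quant_proof n x).

Definition quant_val n (i : 'I_(quant_bound n)) : R := i%:R / n.+1%:R - n.+1%:R.

Lemma measurable_quant n (i : 'I_(quant_bound n)) :
  measurable (quant n @^-1` [set i]).
Proof.
pose f (x : R) := Num.truncn ((x + n.+1%:R) * n.+1%:R).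
have mf : measurable_fun setT f.
  apply: (measurableT_comp measurable_truncn); apply: measurable_funM => //.
  exact: measurable_funD.
rewrite (_ : _ @^-1` _ = f @^-1` [set m | minn m (2 * n.+1 * n.+1) = i]).
  by rewrite -[X in measurable X]setTI; exact: mf.
apply/seteqP; split=> x; rewrite /preimage/=; first by move=> <-.
by move=> E; apply: val_inj.
Qed.

Lemma quantP n (x : R) : `|x| <= n.+1%:R ->
  quant_val (quant n x) <= x <= quant_val (quant n x) + n.+1%:R^-1.
Proof.
have n0 : 0 < n.+1%:R :> R by rewrite ltr0n.
move=> xn; set y := (x + n.+1%:R) * n.+1%:R; have y0 : 0 <= y.
  by rewrite mulr_ge0 ?ler0n//; move: xn; rewrite ler_norml; lra.
have yle : y <= (2 * n.+1 * n.+1)%:R.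
  rewrite !natrM ler_wpM2r// mulr_natl.
  by move: xn; rewrite ler_norml mulr2n; lra.
have /andP[ty yt] := truncn_itv y0.
have qE : (quant n x : nat) = Num.truncn y.
  by apply/minn_idPl; rewrite -(ler_nat R) (le_trans ty).
rewrite /quant_val qE; set m := Num.truncn y in ty yt *.
rewrite lerBlDr ler_pdivrMr// ty/=.
have : x + n.+1%:R < (m%:R + 1) / n.+1%:R by rewrite ltr_pdivlMr// natr1.
by rewrite mulrDl mul1r => /ltW; rewrite -lerBrDr addrAC.
Qed.

(** Outside of the grid the value is the nearer endpoint, so the error is at most |x|. This bound,
    uniform in n up to a constant, feeds dominated convergence. *)
Lemma quant_dist n (x : R) : `|x - quant_val (quant n x)| <= n.+1%:R^-1 + `|x|.
Proof.
have n0 : 0 < n.+1%:R :> R by rewrite ltr0n.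
have n1 : 0 <= n.+1%:R^-1 :> R by rewrite invr_ge0 ltW.
have [/quantP/andP[qx xq]|xn] := lerP `|x| n.+1%:R.
  rewrite ger0_norm ?subr_ge0// lerBlDl; apply: (le_trans xq).
  by rewrite lerD2l lerDl.
have [x0|x0] := lerP 0 x.
  rewrite (ger0_norm x0) in xn *.
  suff -> : quant_val (quant n x) = n.+1%:R.
    rewrite ger0_norm ?subr_ge0 ?ltW//.
    by move: n0 xn n1; move: (n.+1%:R^-1 : R) (n.+1%:R : R) => a b; lra.
  rewrite /quant_val (_ : (quant n x : nat) = 2 * n.+1 * n.+1)%N; last first.
    apply/minn_idPr; rewrite truncn_ge_nat; last first.
      by rewrite mulr_ge0 ?addr_ge0 ?(ltW n0).
    by rewrite !natrM ler_wpM2r// mulr_natl mulr2n lerD2r ltW.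
  by rewrite !natrM mulfK ?gt_eqF// mulr_natl mulr2n addrK.
rewrite ltr0_norm// in xn *.
suff -> : quant_val (quant n x) = - n.+1%:R.
  rewrite opprK ler0_norm; first by move: n1 n0; move: (n.+1%:R^-1 : R) (n.+1%:R : R) => a b; lra.
  by move: xn; lra.
rewrite /quant_val (_ : (quant n x : nat) = 0)%N ?mul0r ?sub0r//.
apply/eqP; rewrite -leqn0 geq_min; apply/orP; left.
rewrite leqn0 -[_ == _]negbK -lt0n truncn_gt0 -ltNge.
apply: (@le_lt_trans _ _ 0) => //.
by rewrite nmulr_rle0//; move: xn; lra.
Qed.

End quantizer.

Section dominated_convergence_real.
Context {R : realType} {d} {T : measurableType d} (P : probability T R).

Lemma quant_cvg (x : R) : (fun n => quant_val (quant n x)) @ \oo --> x.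
Proof.
apply/cvgrPdist_le => e e0; near=> n.
have /quantP/andP[qx xq] : `|x| <= n.+1%:R.
  rewrite -natr1 (@le_trans _ _ n%:R) ?lerDl//.
  by near: n; exact: nbhs_infty_ger.
have ne : n.+1%:R^-1 <= e.
  rewrite invf_ple ?posrE// -natr1 (@le_trans _ _ n%:R) ?lerDl//.
  by near: n; exact: nbhs_infty_ger.
by rewrite ger0_norm ?subr_ge0// lerBlDl (le_trans xq)// lerD2l.
Unshelve. all: by end_near. Qed.

Lemma Rintegral_cvg (f_ : nat -> T -> R) (f g : T -> R) :
  (forall n, measurable_fun setT (f_ n)) -> measurable_fun setT f -> intg P g ->
  (forall t, (fun n => f_ n t) @ \oo --> f t) -> (forall n t, `|f_ n t| <= g t) ->
  (fun n => \int[P]_t f_ n t) @ \oo --> \int[P]_t f t.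
Proof.
move=> mf_ mf ig cf fg.
have [] := @dominated_convergence _ _ _ P _ measurableT (fun n => EFin \o f_ n)
   (EFin \o f) (EFin \o g).
- by move=> n; exact/measurable_EFinP.
- exact/measurable_EFinP.
- by apply: aeW => t _ /=; apply: cvg_EFin; [exact: nearW|exact: cf].
- exact: ig.
- by apply: aeW => t n _ /=; rewrite lee_fin.
move=> fi _ cvgI; apply: fine_cvg; move: cvgI; congr (_ @ _ --> _).
by rewrite EFin_Rintegral.
Qed.

End dominated_convergence_real.

Section regression.
Context {R : realType} {d} {T : measurableType d} (P : probability T R).
Context {d'} {TU : measurableType d'} (U : T -> TU).
Hypothesis mU : measurable_fun setT U.
Implicit Types (f : T -> R) (g phi : TU -> R).

Lemma measurable_preimageU C : measurable C -> measurable (U @^-1` C).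
Proof. by move=> mC; rewrite -[X in measurable X]setTI; exact: mU. Qed.

Lemma intg_indic (D : set T) f : measurable D -> intg P f ->
  intg P (fun t => \1_D t * f t).
Proof.
move=> mD fi; apply: (@intg_le _ _ _ _ _ (fun t => `|f t|)).
- by apply: measurable_funM; [exact: measurable_indic|exact: intg_measurable fi].
- by have := integrable_norm fi.
- by move=> t; rewrite normrM ler_piMl// indicE; case: (_ \in _); rewrite ?normr1 ?normr0.
Qed.

Lemma integral_indic_mul (D : set T) f : measurable D -> intg P f ->
  (\int[P]_(t in D) (f t)%:E = (\int[P]_t (\1_D t * f t))%:E)%E.
Proof.
move=> mD fi; rewrite -EFin_Rintegral; last exact: intg_indic.
rewrite integral_mkcond; apply: eq_integral => t _.
by rewrite epatch_indic /= -EFinM mulrC.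
Qed.

Lemma is_regressionP f g : intg P f -> is_regression P U f g <->
  [/\ measurable_fun setT g, intg P (g \o U) & forall C, measurable C ->
     \int[P]_t (\1_C (U t) * g (U t)) = \int[P]_t (\1_C (U t) * f t)].
Proof.
move=> fi; split=> -[mg gi gf]; split=> // C mC; have := gf C mC;
  have mUC := measurable_preimageU mC.
  by rewrite (integral_indic_mul mUC gi) (integral_indic_mul mUC fi) => -[].
by rewrite (integral_indic_mul mUC gi) (integral_indic_mul mUC fi) => E; congr EFin.
Qed.

(** The integral of [f] over the preimage of a set is a charge on [TU], dominated by the law of [U].
    Its Radon-Nikodym derivative, taken on [TU], is the regression function. *)
Lemma is_regression_exists f : intg P f -> exists g, is_regression P U f g.
Proof.
move=> fi.
pose UU : {RV P >-> TU} := HB.pack U (isMeasurableFun.Build _ _ _ _ _ mU).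
pose mu := distribution P UU.
pose nu : {charge set TU -> \bar R} :=
  measure_function_pushforward__canonical__charge_Charge (induced_charge fi) mU.
have nuE C : nu C = (\int[P]_(t in U @^-1` C) (f t)%:E)%E by [].
have dom : nu `<< mu.
  apply/null_content_dominatesP => C mC muC0; rewrite nuE.
  have mUC := measurable_preimageU mC.
  by apply: null_set_integral => //; apply: measurable_funTS; have /integrableP[] := fi.
pose h := Radon_Nikodym nu mu; have hi : mu.-integrable setT h.
  exact: Radon_Nikodym_integrable.
have hfin x : h x \is a fin_num by exact: Radon_Nikodym_fin_num.
have mh : measurable_fun setT h by have /integrableP[] := hi.
have hE : (EFin \o (fine \o h)) = h by apply/funext => x /=; rewrite fineK.
have hUi : P.-integrable setT (h \o U).
  apply/integrableP; split; first exact: measurableT_comp.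
  have mah : measurable_fun setT (fun y => `|h y|%E) by exact: measurableT_comp.
  have := ge0_integral_distribution UU mah (fun y => abse_ge0 (h y)).
  by move=> /= <-; have /integrableP[] := hi.
exists (fine \o h); split.
- exact: measurableT_comp.
- by rewrite compA hE.
- move=> C mC; rewrite -nuE (Radon_Nikodym_integral dom mC) -/h.
  under eq_integral do rewrite /= fineK//.
  apply/esym; apply: (integral_pushforward mU mh) => //.
  apply: integrableS hUi => //; exact: measurable_preimageU.
Qed.

(** The two regressions are tested on the set where the order fails: there the integral of a
    nonnegative function is at most 0. *)
Lemma is_regression_le f1 f2 g1 g2 : intg P f1 -> intg P f2 ->
  is_regression P U f1 g1 -> is_regression P U f2 g2 ->
  (forall t, f1 t <= f2 t) -> {ae P, forall t, g1 (U t) <= g2 (U t)}.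
Proof.
move=> f1i f2i /(is_regressionP g1 f1i)[mg1 g1i gf1] /(is_regressionP g2 f2i)[mg2 g2i gf2] f12.
pose C := [set y | g2 y < g1 y].
have mC : measurable C.
  by have := measurable_fun_ltr mg2 mg1 measurableT (_ : measurable [set true]); rewrite setTI; apply.
have mUC := measurable_preimageU mC.
pose h t := \1_C (U t) * (g1 (U t) - g2 (U t)).
have hE t : h t = \1_C (U t) * g1 (U t) - \1_C (U t) * g2 (U t) by rewrite /h mulrBr.
have hi : intg P h by apply: (intg_indic mUC); exact: intgB.
have h0 t : 0 <= h t.
  rewrite /h indicE; have [|_] := boolP (U t \in C); last by rewrite mul0r.
  by rewrite inE /C/= mul1r subr_ge0 => /ltW.
have : \int[P]_t h t <= 0.
  rewrite (@eq_Rintegral _ _ _ _ _ (fun t => \1_C (U t) * g1 (U t) -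
    \1_C (U t) * g2 (U t)) h) => [|t _]; last exact: hE.
  rewrite RintegralB//; [|exact: (intg_indic mUC)..].
  rewrite gf1// gf2// subr_le0; apply: le_Rintegral => //; [exact: (intg_indic mUC)..|].
  by move=> t _; rewrite ler_wpM2l.
move=> hle0; have hint0 : (\int[P]_t `|(h t)%:E| = 0)%E.
  rewrite (eq_integral (EFin \o h)) => [|t _]; last by rewrite gee0_abs// lee_fin.
  rewrite EFin_Rintegral//; congr EFin; apply/eqP; rewrite eq_le hle0.
  by rewrite Rintegral_ge0.
have mh : measurable_fun setT (EFin \o h) by have /integrableP[] := hi.
have /(ae_eq_integral_abs P measurableT mh) := hint0.
apply: filterS => t /= /(_ I)[]; rewrite /h indicE; have [|] := boolP (U t \in C).
  by rewrite inE /C/= mul1r => g21 /eqP; rewrite subr_eq0 => /eqP ->.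
by rewrite notin_setE/= /C/= => /negP; rewrite -leNgt.
Qed.

Lemma is_regression_uniq f g1 g2 : intg P f ->
  is_regression P U f g1 -> is_regression P U f g2 ->
  {ae P, forall t, g1 (U t) = g2 (U t)}.
Proof.
move=> fi r1 r2; have le1 := is_regression_le fi fi r1 r2 (fun=> lexx _).
have le2 := is_regression_le fi fi r2 r1 (fun=> lexx _).
by apply: filterS2 le1 le2 => t h1 h2; apply/le_anti/andP.
Qed.

(** True for combinations of indicators by definition; [phi] is the pointwise limit of its grid
    values, and dominated convergence needs only the two products to be integrable. *)
Lemma is_regression_pullout f g phi : intg P f -> is_regression P U f g ->
  measurable_fun setT phi -> intg P (fun t => phi (U t) * f t) ->
  intg P (fun t => phi (U t) * g (U t)) ->
  \int[P]_t (phi (U t) * f t) = \int[P]_t (phi (U t) * g (U t)).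
Proof.
move=> fi /(is_regressionP g fi)[mg gi gf] mphi phifi phigi.
pose s n (y : TU) : R := quant_val (quant n (phi y)).
have mcell n i : measurable (phi @^-1` (quant n @^-1` [set i])).
  by rewrite -[X in measurable X]setTI; apply: mphi => //; exact: measurable_quant.
have sE n y : s n y = \sum_i quant_val i * \1_(phi @^-1` (quant n @^-1` [set i])) y.
  rewrite (bigD1 (quant n (phi y)))//= big1 => [|i ne].
    by rewrite indicE mem_set// mulr1 addr0.
  by rewrite indicE memNset ?mulr0// /preimage/= => E; rewrite E eqxx in ne.
have ms n : measurable_fun setT (s n).
  rewrite (_ : s n = fun y => \sum_i quant_val i * \1_(phi @^-1` (quant n @^-1` [set i])) y).
    by apply: measurable_sum => i; apply: measurable_funM => //; exact: measurable_indic.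
  exact/funext/sE.
have eqs n : \int[P]_t (s n (U t) * f t) = \int[P]_t (s n (U t) * g (U t)).
  have expand (h : T -> R) : intg P h -> \int[P]_t (s n (U t) * h t) =
     \sum_i quant_val i * \int[P]_t (\1_(phi @^-1` (quant n @^-1` [set i])) (U t) * h t).
    move=> hi.
    have ii i : intg P (fun t => \1_(phi @^-1` (quant n @^-1` [set i])) (U t) * h t).
      by apply: (intg_indic (measurable_preimageU (mcell n i))).
    transitivity (\sum_i \int[P]_t (quant_val i *
        (\1_(phi @^-1` (quant n @^-1` [set i])) (U t) * h t))); last first.
      by apply: eq_bigr => i _; rewrite RintegralZl//; exact: ii.
    rewrite -Rintegral_sum => [|i _]; last exact: intgZ.
    apply: eq_Rintegral => t _; rewrite sE big_distrl/=.
    by apply: eq_bigr => i _; rewrite mulrA.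
  by rewrite !expand//; apply: eq_bigr => i _; rewrite gf.
have cv (h : T -> R) : intg P h -> intg P (fun t => phi (U t) * h t) ->
    (fun n => \int[P]_t (s n (U t) * h t)) @ \oo --> \int[P]_t (phi (U t) * h t).
  move=> hi phihi; have mh := intg_measurable hi.
  (* By [quant_dist], the grid values are bounded by 1 + 2 |phi|. *)
  apply: (@Rintegral_cvg _ _ _ P _ _ (fun t => 2 * `|phi (U t) * h t| + `|h t|)).
  - by move=> n; apply: measurable_funM => //; exact: (measurableT_comp (ms n)).
  - by apply: measurable_funM => //; exact: (measurableT_comp mphi).
  - apply: intgD; last by have := integrable_norm hi.
    by apply: intgZ; have := integrable_norm phihi.
  - move=> t; apply: cvgM; last exact: cvg_cst.
    exact: quant_cvg.
  - move=> n t; rewrite normrM [in leRHS]normrM mulrA -[X in _ + X]mul1r -mulrDl ler_wpM2r//.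
    have := quant_dist n (phi (U t)); rewrite distrC => h1.
    have h2 : `|s n (U t)| <= `|s n (U t) - phi (U t)| + `|phi (U t)|.
      by rewrite -{1}(subrK (phi (U t)) (s n (U t))) ler_normD.
    have h3 : n.+1%:R^-1 <= 1 :> R by rewrite invf_le1// ler1n.
    apply: (le_trans h2).
    apply: (@le_trans _ _ (n.+1%:R^-1 + `|phi (U t)| + `|phi (U t)|)); first by rewrite lerD2r.
    by rewrite -addrA addrC mulr_natl mulr2n lerD2l.
have := cv _ fi phifi; under eq_fun do rewrite eqs.
by move/(cvg_unique _ (cv _ gi phigi)) => ->.
Qed.

End regression.

Section conditional_probability.
Context {R : realType} {d} {T : measurableType d} (P : probability T R).

Definition pr (E : set T) : R := fine (P E).

Lemma intg_indic1 E : measurable E -> intg P (\1_E : T -> R).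
Proof.
move=> mE; apply: (@intg_bounded _ _ _ _ _ 1); first exact: measurable_indic.
by move=> t; rewrite indicE ger0_norm ?ler0n// lern1 leq_b1.
Qed.

Lemma Rintegral_indic E : measurable E -> \int[P]_t \1_E t = pr E.
Proof. by move=> mE; rewrite /Rintegral integral_indic// setIT. Qed.

Section conditioning_variable.
Context {d'} {TU : measurableType d'} (U : T -> TU).
Hypothesis mU : measurable_fun setT U.

Lemma cond_expP f : intg P f -> exists2 g, is_regression P U f g &
  cond_exp P U f = g \o U.
Proof.
move=> fi; exists (xget (fun=> 0) [set g | is_regression P U f g]) => //.
exact: (xgetPex _ (is_regression_exists mU fi)).
Qed.

Lemma cond_exp_ae f g : intg P f -> is_regression P U f g ->
  {ae P, forall t, cond_exp P U f t = g (U t)}.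
Proof.
by move=> fi rg; have [h rh ->] := cond_expP fi; exact: (is_regression_uniq mU fi rh rg).
Qed.

Lemma intg_cond_exp f : intg P f -> intg P (cond_exp P U f).
Proof. by move=> fi; have [g [_ gi _] ->] := cond_expP fi. Qed.

Lemma Rintegral_cond_exp f : intg P f -> \int[P]_t cond_exp P U f t = \int[P]_t f t.
Proof.
move=> fi; have [g /(is_regressionP mU g fi)[mg gi gf] ->] := cond_expP fi.
have := gf _ measurableT.
have one (h : T -> R) : \int[P]_t (\1_[set: TU] (U t) * h t) = \int[P]_t h t.
  by apply: eq_Rintegral => t _; rewrite indicT mul1r.
by rewrite !one.
Qed.

Lemma is_regression_sum (I : finType) (f : I -> T -> R) (g : I -> TU -> R) :
  (forall i, intg P (f i)) -> (forall i, is_regression P U (f i) (g i)) ->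
  is_regression P U (fun t => \sum_i f i t) (fun y => \sum_i g i y).
Proof.
move=> fi rg; have rg' i := (is_regressionP mU (g i) (fi i)).1 (rg i).
apply/(is_regressionP mU); first exact: intg_sum.
split.
- by apply: measurable_sum => i; case: (rg' i).
- by apply: intg_sum => i _; case: (rg' i).
- move=> C mC; have mUC := measurable_preimageU mU mC.
  have ex (h : I -> T -> R) : (forall i, intg P (h i)) ->
      \int[P]_t (\1_C (U t) * \sum_i h i t) = \sum_i \int[P]_t (\1_C (U t) * h i t).
    move=> hi; rewrite -Rintegral_sum => [|i _]; last exact: (intg_indic mUC).
    by apply: eq_Rintegral => t _; rewrite big_distrr.
  rewrite (ex (fun i t => g i (U t))); last by move=> i; case: (rg' i).
  by rewrite ex//; apply: eq_bigr => i _; case: (rg' i) => _ _ ->.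
Qed.

Lemma is_regression_cst c : is_regression P U (fun=> c) (fun=> c).
Proof. by apply/(is_regressionP mU); [exact: intg_cst|split=> //; exact: intg_cst]. Qed.

Lemma intg_cond_prob E : measurable E -> intg P (cond_prob P U E).
Proof. by move=> mE; apply: intg_cond_exp; exact: intg_indic1. Qed.

Lemma measurable_cond_prob E : measurable E -> measurable_fun setT (cond_prob P U E).
Proof. by move=> mE; apply: intg_measurable; exact: intg_cond_prob. Qed.

Lemma Rintegral_cond_prob E : measurable E -> \int[P]_t cond_prob P U E t = pr E.
Proof.
by move=> mE; rewrite Rintegral_cond_exp ?Rintegral_indic//; exact: intg_indic1.
Qed.

Lemma cond_prob_ge0 E : measurable E -> {ae P, forall t, 0 <= cond_prob P U E t}.
Proof.
move=> mE; rewrite /cond_prob; have [g rg ->] := cond_expP (intg_indic1 mE).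
exact: (is_regression_le mU (intg_cst P 0) (intg_indic1 mE) (is_regression_cst 0) rg).
Qed.

Lemma cond_prob_le1 E : measurable E -> {ae P, forall t, cond_prob P U E t <= 1}.
Proof.
move=> mE; rewrite /cond_prob; have [g rg ->] := cond_expP (intg_indic1 mE).
apply: (is_regression_le mU (intg_indic1 mE) (intg_cst P 1) rg (is_regression_cst 1)).
by move=> t; rewrite indicE lern1 leq_b1.
Qed.

(** Assuming only an identity between indicators lets this serve both marginals of a product
    partition as well as the total mass. *)
Lemma cond_prob_sum (I : finType) (E : I -> set T) D :
  (forall i, measurable (E i)) -> measurable D ->
  (forall t, \sum_i \1_(E i) t = \1_D t :> R) ->
  {ae P, forall t, \sum_i cond_prob P U (E i) t = cond_prob P U D t}.
Proof.
move=> mE mD ED; rewrite /cond_prob.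
have [g rg] : {g : I -> TU -> R & forall i, is_regression P U (\1_(E i)) (g i) /\
    cond_exp P U (\1_(E i)) = g i \o U}.
  apply: (@choice _ _ (fun i g => is_regression P U (\1_(E i)) g /\
    cond_exp P U (\1_(E i)) = g \o U)) => i.
  by have [g ? ?] := cond_expP (intg_indic1 (mE i)); exists g.
have rs := is_regression_sum (fun i => intg_indic1 (mE i)) (fun i => (rg i).1).
have fE : (fun t => \sum_i \1_(E i) t) = (\1_D : T -> R) by apply/funext.
rewrite fE in rs; apply: filterS (cond_exp_ae (intg_indic1 mD) rs) => t ->.
by apply: eq_bigr => i _; rewrite (rg i).2.
Qed.

Lemma cond_prob_indep E : measurable E ->
  (forall C, measurable C -> (P (E `&` U @^-1` C) = P E * P (U @^-1` C))%E) ->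
  {ae P, forall t, cond_prob P U E t = pr E}.
Proof.
move=> mE ind; apply: (cond_exp_ae (intg_indic1 mE) (g := fun=> pr E)).
apply/(is_regressionP mU); first exact: intg_indic1.
split=> //; first exact: intg_cst.
move=> C mC; have mUC := measurable_preimageU mU mC.
transitivity (\int[P]_t (pr E * \1_(U @^-1` C) t)).
  by apply: eq_Rintegral => t _; rewrite mulrC.
rewrite RintegralZl//; last exact: intg_indic1.
rewrite Rintegral_indic// /pr -fineM ?fin_num_measure// -ind//.
rewrite -/(pr _) -Rintegral_indic; last exact: measurableI.
by apply: eq_Rintegral => t _; rewrite indicI mulrC.
Qed.

End conditioning_variable.
End conditional_probability.

Section pointwise_information.
Context {R : realType}.

Definition xlnx (x : R) := x * ln x.

(** Away from 0 the inverse is exp(- ln |x|) up to sign, and it is 0 at 0. *)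
Lemma measurable_inv : measurable_fun [set: R] (fun x : R => x^-1).
Proof.
rewrite (_ : (fun _ => _) = fun x => \1_[set` `]0, +oo[%R] x * expR (- ln x) -
  \1_[set` `]-oo, 0[%R] x * expR (- ln (- x))).
  have mm (i : interval R) (f : R -> R) : measurable_fun setT f ->
      measurable_fun setT (fun x => \1_[set` i] x * expR (- ln (f x))).
    move=> mf; apply: measurable_funM; first by apply: measurable_indic; exact: measurable_itv.
    by do 2 apply: measurableT_comp => //; exact: (measurableT_comp (@measurable_ln R)).
  by apply: measurable_funB; apply: mm => //; exact: measurable_funN.
apply/funext => x; rewrite !indicE !mem_setE !in_itv/= andbT.
have [x0|x0|->] := ltgtP x 0; last by rewrite !mul0r subrr invr0.
- by rewrite mul0r mul1r sub0r expRN lnK ?posrE ?oppr_gt0// invrN opprK.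
- by rewrite mul0r mul1r subr0 expRN lnK.
Qed.

(** The tangent inequality of the logarithm with a free reference value [c] for the posterior pq /
    q. Apart from [pq * ln p], the bound is linear in [pq] and [q], so it can be averaged over a
    conditioning variable. *)
Lemma discrete_info_term_lower (pq p q c : R) : 0 <= pq -> pq <= p -> pq <= q -> 0 < c ->
  pq * (ln c + 1) - q * c - pq * ln p <= pq * ln (pq / (p * q)).
Proof.
move=> pq0 pqp pqq c0; have [->|pqn0] := eqVneq pq 0.
  by rewrite !mul0r subr0 sub0r oppr_le0 mulr_ge0 ?(le_trans pq0 pqq) ?ltW.
have {pq0 pqn0}pq0 : 0 < pq by rewrite lt_neqAle eq_sym pqn0.
have p0 : 0 < p by exact: lt_le_trans pqp.
have q0 : 0 < q by exact: lt_le_trans pqq.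
have -> : ln (pq / (p * q)) = ln pq - ln p - ln q.
  by rewrite ln_div ?posrE ?mulr_gt0// lnM ?posrE// opprD addrA.
have : ln (q * c / pq) <= q * c / pq - 1 by apply: ln_le_subr1; rewrite divr_gt0 ?mulr_gt0.
rewrite ln_div ?posrE ?mulr_gt0// lnM ?posrE// => h.
have := ler_wpM2l (ltW pq0) h.
have -> : pq * (q * c / pq - 1) = q * c - pq.
  by rewrite mulrBr mulr1 mulrC divfK ?gt_eqF.
by move: (ln q) (ln c) (ln pq) (ln p) => *; lra.
Qed.

(** Both sides come from ln x <= x - 1, at the ratio and at its inverse. It makes the conditional
    information of a quantization integrable. *)
Lemma discrete_info_term_bound (pq p q : R) : 0 <= pq -> pq <= p -> pq <= q ->
  p <= 1 -> q <= 1 -> `|pq * ln (pq / (p * q))| <= 1.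
Proof.
move=> pq0 pqp pqq p1 q1; have [->|pqn0] := eqVneq pq 0; first by rewrite mul0r normr0.
have {pq0 pqn0}pq0 : 0 < pq by rewrite lt_neqAle eq_sym pqn0.
have p0 : 0 < p by exact: lt_le_trans pqp.
have q0 : 0 < q by exact: lt_le_trans pqq.
have x0 : 0 < pq / (p * q) by rewrite divr_gt0 ?mulr_gt0.
rewrite ler_norml; apply/andP; split.
  have : ln (p * q / pq) <= p * q / pq - 1 by apply: ln_le_subr1; rewrite divr_gt0 ?mulr_gt0.
  rewrite -invf_div lnV ?posrE// => h.
  have := ler_wpM2l (ltW pq0) h; rewrite invf_div.
  have -> : pq * (p * q / pq - 1) = p * q - pq.
    by rewrite mulrBr mulr1 mulrC divfK ?gt_eqF.
  have : 0 < p * q by rewrite mulr_gt0.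
  by move: (ln _) => l; nra.
have := ler_wpM2l (ltW pq0) (ln_le_subr1 x0); move/le_trans; apply.
rewrite mulrBr mulr1 mulrA lerBlDr (@le_trans _ _ 1) ?lerDl ?(ltW pq0)//.
by rewrite ler_pdivrMr ?mulr_gt0// mul1r; apply: ler_pM => //; exact: ltW.
Qed.

Lemma discrete_info_lower n m (pq : 'I_n -> 'I_m -> R) p q (c : 'I_n -> 'I_m -> R) :
  (forall i j, 0 <= pq i j) -> (forall i, \sum_j pq i j = p i) ->
  (forall j, \sum_i pq i j = q j) -> (forall i j, 0 < c i j) ->
  \sum_i \sum_j (pq i j * (ln (c i j) + 1) - q j * c i j) - \sum_i xlnx (p i)
    <= discrete_info pq p q.
Proof.
move=> pq0 pE qE c0; rewrite /discrete_info -sumrB ler_sum// => i _.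
rewrite /xlnx -{1}pE big_distrl/= -sumrB ler_sum// => j _.
apply: discrete_info_term_lower => //.
- by rewrite -pE (bigD1 j)//= lerDl sumr_ge0.
- by rewrite -qE (bigD1 i)//= lerDl sumr_ge0.
Qed.

End pointwise_information.

(** * Mutual information and posterior entropies *)

Section quantization.
Context {R : realType} {d} {T : measurableType d} (P : probability T R).

Lemma intg_ae_bounded (f : T -> R) c : measurable_fun setT f ->
  {ae P, forall t, `|f t| <= c} -> intg P f.
Proof.
move=> mf fc; have [c0|c0] := ltrP c 0.
  have /(intg_ae (intg_cst P 0)) : measurable_fun setT f by [].
  apply; apply: filterS fc => t /(le_lt_trans)/(_ c0).
  by rewrite ltNge normr_ge0.
pose g t := Num.max (- c) (Num.min c (f t)).
have mg : measurable_fun setT g.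
  by apply: measurable_maxr => //; exact: measurable_minr.
apply: (@intg_ae _ _ _ P g) => //.
  apply: (@intg_bounded _ _ _ _ _ c) => // t; rewrite ler_norml /g.
  by rewrite le_max lexx/= ge_max ge_min lexx/= andbT; lra.
apply: filterS fc => t; rewrite ler_norml => /andP[fc1 fc2].
by rewrite /g min_r// max_r.
Qed.

Lemma xlnx_bound (x : R) : 0 <= x <= 1 -> `|xlnx x| <= 1.
Proof.
move=> /andP[x0 x1]; rewrite /xlnx; have [->|xn0] := eqVneq x 0; first by rewrite mul0r normr0.
have {x0 xn0}x0 : 0 < x by rewrite lt_neqAle eq_sym xn0.
rewrite ler0_norm; last by rewrite mulr_ge0_le0 ?ln_le0// ltW.
rewrite -mulrN -lnV ?posrE//.
have xV : 0 < x^-1 by rewrite invr_gt0.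
have := ler_wpM2l (ltW x0) (ln_le_subr1 xV); rewrite mulrBr mulfV ?gt_eqF// mulr1.
by move/le_trans; apply; rewrite gerBl ltW.
Qed.

Lemma measurable_xlnx (f : T -> R) : measurable_fun setT f ->
  measurable_fun setT (fun t => xlnx (f t)).
Proof.
by move=> mf; apply: measurable_funM => //; exact: (measurableT_comp (@measurable_ln R)).
Qed.

Context {d'} {TU : measurableType d'} (U : T -> TU).
Hypothesis mU : measurable_fun setT U.

(* minus the conditional entropy of the partition E given U *)
Definition cond_xlnx n (E : 'I_n -> set T) : R :=
  \int[P]_t \sum_i xlnx (cond_prob P U (E i) t).

Lemma intg_cond_xlnx n (E : 'I_n -> set T) : (forall i, measurable (E i)) ->
  intg P (fun t => \sum_i xlnx (cond_prob P U (E i) t)).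
Proof.
move=> mE; apply: intg_sum => i _; apply: (@intg_ae_bounded _ 1).
  exact/measurable_xlnx/measurable_cond_prob.
have p0 := cond_prob_ge0 P mU (mE i); have p1 := cond_prob_le1 P mU (mE i).
by apply: filterS2 p0 p1 => t ? ?; apply: xlnx_bound; apply/andP.
Qed.

(** The cells of a quantization live on [TU] and need a posterior with values in [0, 1] everywhere;
    clipping changes it on a null set only. *)
Lemma cond_prob_clip E : measurable E -> exists g : TU -> R,
  [/\ is_regression P U \1_E g, forall y, 0 <= g y <= 1 &
      {ae P, forall t, cond_prob P U E t = g (U t)}].
Proof.
move=> mE; have [h rh ph] := cond_expP mU (intg_indic1 P mE).
have [mh hi gh] := (is_regressionP mU h (intg_indic1 P mE)).1 rh.
pose g y := Num.max 0 (Num.min 1 (h y)).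
have mg : measurable_fun setT g by apply: measurable_maxr => //; exact: measurable_minr.
have hg : {ae P, forall t, h (U t) = g (U t)}.
  have p0 := cond_prob_ge0 P mU mE; have p1 := cond_prob_le1 P mU mE.
  rewrite /cond_prob ph in p0 p1.
  by apply: filterS2 p0 p1 => t h0 h1; rewrite /g min_r// max_r.
exists g; split=> [|y|].
- apply/(is_regressionP mU); first exact: intg_indic1.
  have mgU : measurable_fun setT (g \o U) by exact: measurableT_comp.
  have mhU : measurable_fun setT (h \o U) by exact: measurableT_comp.
  split=> //; first exact: (intg_ae hi mgU).
  move=> C mC; have mUC := measurable_preimageU mU mC.
  rewrite -gh//; apply: Rintegral_ae.
  + by apply: measurable_funM => //; exact: (measurableT_comp (measurable_indic mC) mU).
  + by apply: measurable_funM => //; exact: (measurableT_comp (measurable_indic mC) mU).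
  + by apply: filterS hg => t ->.
- by rewrite /g le_max lexx/= ge_max ler01 ge_min lexx.
- by rewrite /cond_prob ph.
Qed.

(* Grid cells of the posterior probabilities; c i j is an upper bound of the
   posterior of E i on B j, tight up to 1 / (N + 1). *)
Lemma quantize_posterior n (E : 'I_n -> set T) N : (forall i, measurable (E i)) ->
  exists m (B : 'I_m -> set TU) (c : 'I_n -> 'I_m -> R),
    [/\ finite_partition B, forall i j, 0 < c i j &
      cond_xlnx E - n%:R / N.+1%:R <=
      \sum_i \sum_j (pr P (E i `&` U @^-1` B j) * (ln (c i j) + 1) -
                     pr P (U @^-1` B j) * c i j)].
Proof.
move=> mE.
have [g gP] : {g : 'I_n -> TU -> R & forall i,
    [/\ is_regression P U \1_(E i) (g i), forall y, 0 <= g i y <= 1 &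
      {ae P, forall t, cond_prob P U (E i) t = g i (U t)}]}.
  apply: (@choice _ _ (fun i g => [/\ is_regression P U \1_(E i) g, forall y, 0 <= g y <= 1 &
      {ae P, forall t, cond_prob P U (E i) t = g (U t)}])) => i.
  by have [g ?] := cond_prob_clip (mE i); exists g.
(* A cell fixes the grid values of all [n] posteriors simultaneously. *)
pose F := {ffun 'I_n -> 'I_(quant_bound N)}.
pose q y : F := [ffun i => quant N (g i y)].
pose B (j : 'I_#|{: F}|) := [set y | q y = enum_val j].
(* Lower grid value plus one step; the positive part keeps [c] positive, so that [ln] is
   meaningful. *)
pose c (i : 'I_n) (j : 'I_#|{: F}|) : R :=
  Num.max 0 (quant_val (enum_val j i)) + N.+1%:R^-1.
have N0 : 0 < N.+1%:R^-1 :> R by rewrite invr_gt0 ltr0n.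
have c0 i j : 0 < c i j by rewrite ltr_wpDl// le_max lexx.
have mg i : measurable_fun setT (g i) by case: (gP i) => -[].
have mB j : measurable (B j).
  rewrite (_ : B j = \bigcap_(i in [set: 'I_n])
      (g i @^-1` (quant N @^-1` [set (enum_val j : F) i]))).
    apply: fin_bigcap_measurable => [|i _]; first exact: finite_finset.
    by rewrite -[X in measurable X]setTI; apply: mg => //; exact: measurable_quant.
  apply/seteqP; split=> [y /= <- i _|y qy]; first by rewrite /preimage/= ffunE.
  by apply/ffunP => i; rewrite ffunE; exact: (qy i I).
have inB j y : (y \in B j) = (j == enum_rank (q y)).
  apply/idP/eqP => [|->]; rewrite ?inE /B/=; last by rewrite enum_rankK.
  by move=> ->; rewrite enum_valK.
exists #|{: F}|, B, c; split=> //.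
  split=> //; first by move=> i j _ _ [y [/= qi qj]]; apply: enum_val_inj; rewrite -qi -qj.
  by apply/seteqP; split=> // y _; exists (enum_rank (q y)) => //; rewrite /B/= enum_rankK.
have mUB j : measurable (U @^-1` B j) by exact: measurable_preimageU.
have sumB y (a : 'I_#|{: F}| -> R) : \sum_j \1_(B j) y * a j = a (enum_rank (q y)).
  rewrite (bigD1 (enum_rank (q y)))//= big1 => [|j jq].
    by rewrite indicE inB eqxx mul1r addr0.
  by rewrite indicE inB (negbTE jq) mul0r.
have gi i : intg P (g i \o U) by case: (gP i) => -[].
have prE i j : pr P (E i `&` U @^-1` B j) = \int[P]_t (\1_(B j) (U t) * g i (U t)).
  rewrite -Rintegral_indic; last exact: measurableI.
  have [/(is_regressionP mU _ (intg_indic1 P (mE i)))[_ _ ->]// _ _] := gP i.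
  by apply: eq_Rintegral => t _; rewrite indicI mulrC.
pose G i j t := \1_(B j) (U t) * (g i (U t) * (ln (c i j) + 1) - c i j).
have BgI i j : intg P (fun t => \1_(B j) (U t) * g i (U t)).
  exact: (intg_indic (mUB j) (gi i)).
have GI i j : intg P (G i j).
  have hi : intg P (fun t => g i (U t) * (ln (c i j) + 1) - c i j).
    apply: intgB; last exact: intg_cst.
    by under eq_fun do rewrite mulrC; apply: intgZ; exact: gi.
  exact: (intg_indic (mUB j) hi).
have intG : \sum_i \sum_j (pr P (E i `&` U @^-1` B j) * (ln (c i j) + 1) -
      pr P (U @^-1` B j) * c i j) = \int[P]_t \sum_i \sum_j G i j t.
  rewrite Rintegral_sum => [|i _]; last by apply: intg_sum.
  apply: eq_bigr => i _; rewrite Rintegral_sum => [|j _]; last exact: GI.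
  apply: eq_bigr => j _; rewrite prE -(Rintegral_indic P (mUB j)).
  have e1 := RintegralZr (ln (c i j) + 1) measurableT (BgI i j).
  have e2 := RintegralZr (c i j) measurableT (intg_indic1 P (mUB j)).
  rewrite -e1 -e2 -RintegralB//.
  - by apply: eq_Rintegral => t _; rewrite /G mulrBr mulrA.
  - by under eq_fun do rewrite mulrC; apply: intgZ; exact: BgI.
  - by under eq_fun do rewrite mulrC; apply: intgZ; exact: intg_indic1.
rewrite intG /cond_xlnx -[X in _ - X](Rintegral_cst1 P).
rewrite -RintegralB//; [|exact: intg_cond_xlnx|exact: intg_cst].
apply: Rintegral_le_ae.
- by apply: intgB; [exact: intg_cond_xlnx|exact: intg_cst].
- by apply: intg_sum => i _; apply: intg_sum.
have pg : {ae P, forall t, forall i, cond_prob P U (E i) t = g i (U t)}.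
  by apply: filter_forall => i; case: (gP i).
apply: filterS pg => t pg; rewrite exchange_big/=.
under [X in _ <= X]eq_bigr do rewrite /G -big_distrr/=.
rewrite (sumB (U t) (fun j => \sum_i (g i (U t) * (ln (c i j) + 1) - c i j))).
have -> : n%:R / N.+1%:R = \sum_(i < n) (N.+1%:R^-1 : R).
  by rewrite sumr_const card_ord mulr_natl.
rewrite -sumrB ler_sum// => i _; rewrite pg /c enum_rankK ffunE.
have [_ /(_ (U t)) /andP[g0 g1] _] := gP i.
have /quantP/andP[qx xq] : `|g i (U t)| <= N.+1%:R.
  by rewrite ger0_norm// (le_trans g1)// ler1n.
(* With x <= w <= x + 1 / (N + 1), monotonicity of the logarithm gives x ln x - 1 / (N + 1) <= x (ln
   w + 1) - w; one such loss for each of the [n] sets yields [n%:R / N.+1%:R]. *)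
move: (g i (U t)) g0 g1 qx xq => x x0 x1; set v := quant_val _ => vx xv.
set w := Num.max 0 v + N.+1%:R^-1.
have w0 : 0 < w by rewrite ltr_wpDl// le_max lexx.
have xw : x <= w by rewrite (le_trans xv)// lerD2r le_max lexx orbT.
have wx : w <= x + N.+1%:R^-1 by rewrite lerD2r ge_max x0.
have [xn0|xn0] := eqVneq x 0.
  by rewrite xn0 add0r in wx; rewrite xn0 /xlnx !mul0r !sub0r lerN2.
have {x0 xn0}x0 : 0 < x by rewrite lt_neqAle eq_sym xn0.
have lnxw : ln x <= ln w by rewrite ler_ln.
have := ler_wpM2l (ltW x0) lnxw; rewrite /xlnx mulrDr mulr1 => h.
rewrite -addrA lerD// lerBrDl; move: wx; rewrite -lerBlDr.
by rewrite lerBlDl addrC.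
Qed.

End quantization.

Section chain_rule.
Context {R : realType} {d} {T : measurableType d} (P : probability T R).

Lemma sum_indic_partition d' (T' : measurableType d') n (B : 'I_n -> set T') y :
  finite_partition B -> \sum_j \1_(B j) y = 1 :> R.
Proof.
move=> [_ tB uB]; have [j _ Bj] : (\bigcup_i B i) y by rewrite uB.
rewrite (bigD1 j)//= big1 => [|i ij]; first by rewrite indicE mem_set// addr0.
rewrite indicE memNset// => Bi; move/eqP: ij; apply.
by apply: tB => //; exists y.
Qed.

Lemma le_of_le_div (a b c : R) : 0 <= c ->
  (forall N, a - c / N.+1%:R <= b) -> a <= b.
Proof.
move=> c0 h; apply/ler_addgt0Pr => e e0; rewrite -lerBlDr.
apply: le_trans (h (Num.truncn (c / e))); rewrite lerD2l lerN2.
have := truncnS_gt (c / e); rewrite ltr_pdivrMr// => /ltW.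
by rewrite ler_pdivrMr ?ltr0n// mulrC.
Qed.

Context {d1} {T1 : measurableType d1} {d2} {T2 : measurableType d2}.
Variables (X : T -> T1) (Y : T -> T2).
Hypotheses (mX : measurable_fun setT X) (mY : measurable_fun setT Y).

(** Quantizing [Y] along its own posteriors makes the information of one finite partition exceed
    [cond_xlnx] at [Y] minus [cond_xlnx] at [V], up to n / (N + 1). The same reference values [c]
    are used for [Y] and, pointwise, given [V]. *)
Lemma cond_mutual_info_chain d3 (T3 : measurableType d3) (V : T -> T3) rho n
    (A : 'I_n -> set T1) : measurable_fun setT V -> finite_partition A ->
  (cond_mutual_info P X Y V <= rho%:E)%E ->
  cond_xlnx P Y (fun i => X @^-1` A i) <= cond_xlnx P V (fun i => X @^-1` A i) + rho.
Proof.
move=> mV pA Irho; apply: (@le_of_le_div _ _ n%:R) => // N.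
have mE i : measurable (X @^-1` A i) by apply: measurable_preimageU => //; case: pA.
have [m [B [c [pB c0 le1]]]] := quantize_posterior P mY N mE; apply: (le_trans le1).
have mB j : measurable (Y @^-1` B j) by apply: measurable_preimageU => //; case: pB.
have mEB i j : measurable (X @^-1` A i `&` Y @^-1` B j) by exact: measurableI.
pose pq i j t := cond_prob P V (X @^-1` A i `&` Y @^-1` B j) t.
pose p i t := cond_prob P V (X @^-1` A i) t.
pose q j t := cond_prob P V (Y @^-1` B j) t.
pose D t := discrete_info (fun i j => pq i j t) (p^~ t) (q^~ t).
have mpq i j : measurable_fun setT (pq i j) by exact: measurable_cond_prob.
have mp i : measurable_fun setT (p i) by exact: measurable_cond_prob.
have mq j : measurable_fun setT (q j) by exact: measurable_cond_prob.
have mD : measurable_fun setT D.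
  apply: measurable_sum => i; apply: measurable_sum => j; apply: measurable_funM => //.
  apply: (measurableT_comp (@measurable_ln R)); apply: measurable_funM => //.
  by apply: (measurableT_comp (@measurable_inv R)); exact: measurable_funM.
have ae_pq0 : {ae P, forall t, forall i j, 0 <= pq i j t}.
  by apply: filter_forall => i; apply: filter_forall => j; exact: cond_prob_ge0.
have ae_p : {ae P, forall t, forall i, \sum_j pq i j t = p i t}.
  apply: filter_forall => i; apply: cond_prob_sum => // t.
  under eq_bigr do rewrite indicI.
  by rewrite -big_distrr/= (sum_indic_partition (Y t) pB) mulr1.
have ae_q : {ae P, forall t, forall j, \sum_i pq i j t = q j t}.
  apply: filter_forall => j; apply: cond_prob_sum => // t.
  under eq_bigr do rewrite indicI.
  by rewrite -big_distrl/= (sum_indic_partition (X t) pA) mul1r.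
have ae_p1 : {ae P, forall t, forall i, p i t <= 1}.
  by apply: filter_forall => i; exact: cond_prob_le1.
have ae_q1 : {ae P, forall t, forall j, q j t <= 1}.
  by apply: filter_forall => j; exact: cond_prob_le1.
have ae_all : {ae P, forall t, [/\ forall i j, 0 <= pq i j t,
    forall i, \sum_j pq i j t = p i t, forall j, \sum_i pq i j t = q j t,
    forall i, p i t <= 1 & forall j, q j t <= 1]}.
  have ae_marg : {ae P, forall t, (forall i, \sum_j pq i j t = p i t) /\
      forall j, \sum_i pq i j t = q j t} by apply: filterS2 ae_p ae_q.
  have ae_le1 : {ae P, forall t, (forall i, p i t <= 1) /\ forall j, q j t <= 1}.
    exact: filterS2 ae_p1 ae_q1.
  by apply: filterS3 ae_pq0 ae_marg ae_le1 => t ? [? ?] [].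
have Di : intg P D.
  apply: (@intg_ae_bounded _ _ _ _ _ (n * m)%:R) => //.
  apply: filterS ae_all => t [pq0 pE qE p1 q1].
  apply: (le_trans (ler_norm_sum _ _ _)); rewrite natrM mulr_natl -[n in leRHS]card_ord.
  rewrite -sumr_const; apply: ler_sum => i _; apply: (le_trans (ler_norm_sum _ _ _)).
  rewrite -[m in leRHS]card_ord -sumr_const; apply: ler_sum => j _.
  apply: discrete_info_term_bound => //.
  + by rewrite -pE (bigD1 j)//= lerDl sumr_ge0.
  + by rewrite -qE (bigD1 i)//= lerDl sumr_ge0.
have le2 : \int[P]_t D t <= rho.
  rewrite -lee_fin -EFin_Rintegral//; apply: le_trans Irho; apply: ereal_sup_ubound.
  by exists n, m, A, B.
(* [c] does not depend on t, so integration turns the probabilities given [V] into unconditional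
   ones and recovers the sum produced by [quantize_posterior]. *)
pose G t := \sum_i \sum_j (pq i j t * (ln (c i j) + 1) - q j t * c i j).
have pqi i j : intg P (pq i j) by exact: intg_cond_prob.
have qi j : intg P (q j) by exact: intg_cond_prob.
have pqci i j : intg P (fun t => pq i j t * (ln (c i j) + 1)).
  by under eq_fun do rewrite mulrC; exact: intgZ.
have qci i j : intg P (fun t => q j t * c i j).
  by under eq_fun do rewrite mulrC; exact: intgZ.
have GI i j : intg P (fun t => pq i j t * (ln (c i j) + 1) - q j t * c i j).
  by apply: intgB; [exact: pqci|exact: qci].
have Gi : intg P G by apply: intg_sum => i _; apply: intg_sum.
have intG : \int[P]_t G t = \sum_i \sum_j
    (pr P (X @^-1` A i `&` Y @^-1` B j) * (ln (c i j) + 1) - pr P (Y @^-1` B j) * c i j).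
  rewrite Rintegral_sum => [|i _]; last by apply: intg_sum.
  apply: eq_bigr => i _; rewrite Rintegral_sum => [|j _]; last exact: GI.
  apply: eq_bigr => j _; rewrite (RintegralB measurableT (pqci i j) (qci i j)).
  rewrite (RintegralZr _ measurableT (pqi i j)) (RintegralZr _ measurableT (qi j)).
  by rewrite (Rintegral_cond_prob P mV (mEB i j)) (Rintegral_cond_prob P mV (mB j)).
rewrite -intG -lerBlDl /cond_xlnx -RintegralB//; last exact: intg_cond_xlnx.
apply: le_trans le2; apply: Rintegral_le_ae => //.
  by apply: intgB => //; exact: intg_cond_xlnx.
apply: filterS ae_all => t [pq0 pE qE p1 q1].
exact: discrete_info_lower.
Qed.

(** The unconditional counterpart, through which the converse bound reaches the test channel. *)
Lemma mutual_info_chain rho n (A : 'I_n -> set T1) : finite_partition A ->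
  (mutual_info P X Y <= rho%:E)%E ->
  cond_xlnx P Y (fun i => X @^-1` A i) <= \sum_i xlnx (pr P (X @^-1` A i)) + rho.
Proof.
move=> pA Irho; apply: (@le_of_le_div _ _ n%:R) => // N.
have mE i : measurable (X @^-1` A i) by apply: measurable_preimageU => //; case: pA.
have [m [B [c [pB c0 le1]]]] := quantize_posterior P mY N mE; apply: (le_trans le1).
have mB j : measurable (Y @^-1` B j) by apply: measurable_preimageU => //; case: pB.
have mEB i j : measurable (X @^-1` A i `&` Y @^-1` B j) by exact: measurableI.
rewrite -lerBlDl -lee_fin; apply: le_trans Irho.
apply: (@le_trans _ _ (discrete_info
    (fun i j => fine (P (X @^-1` A i `&` Y @^-1` B j)))
    (fun i => fine (P (X @^-1` A i))) (fun j => fine (P (Y @^-1` B j))))%:E).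
  rewrite lee_fin; apply: discrete_info_lower => //.
  - by move=> i j; rewrite fine_ge0.
  - move=> i; rewrite -/(pr P _) -Rintegral_indic//.
    under eq_bigr do rewrite -/(pr P _) -Rintegral_indic//.
    rewrite -Rintegral_sum => [|j _]; last exact: intg_indic1.
    apply: eq_Rintegral => t _; under eq_bigr do rewrite indicI.
    by rewrite -big_distrr/= (sum_indic_partition (Y t) pB) mulr1.
  - move=> j; rewrite -/(pr P _) -Rintegral_indic//.
    under eq_bigr do rewrite -/(pr P _) -Rintegral_indic//.
    rewrite -Rintegral_sum => [|i _]; last exact: intg_indic1.
    apply: eq_Rintegral => t _; under eq_bigr do rewrite indicI.
    by rewrite -big_distrl/= (sum_indic_partition (X t) pA) mul1r.
by apply: ereal_sup_ubound; exists n, m, A, B.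
Qed.

End chain_rule.

(** * The information needed to reach an error covariance *)

Section variational.
Context {R : realType} {d} {T : measurableType d} (P : probability T R).

Lemma Rintegral_indic_null (E : set T) h : measurable E -> intg P h -> pr P E = 0 ->
  \int[P]_t (\1_E t * h t) = 0.
Proof.
move=> mE hi PE0; have mh := intg_measurable hi.
have PE : P E = 0%E by rewrite -[LHS]fineK ?fin_num_measure// -/(pr P E) PE0.
have aeE : {ae P, forall t, \1_E t * h t = 0}.
  exists E; split=> // t /= h0; apply: contrapT => nE; apply: h0.
  by rewrite indicE memNset// mul0r.
rewrite (Rintegral_ae _ _ aeE) ?Rintegral_cst1//.
by apply: measurable_funM => //; exact: measurable_indic.
Qed.

(** Jensen's inequality on each cell, from the tangent of the exponential at the cell average [a]; a
    null cell has weight 0 on the left. *)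
Lemma jensen_cells n (E : 'I_n -> set T) h : (forall i, measurable (E i)) ->
  (forall t, \sum_i \1_(E i) t = 1 :> R) ->
  intg P h -> intg P (fun t => expR (h t)) ->
  \sum_i pr P (E i) * expR (\int[P]_t (\1_(E i) t * h t) / pr P (E i)) <=
  \int[P]_t expR (h t).
Proof.
move=> mE sE hi ehi.
have -> : \int[P]_t expR (h t) = \sum_i \int[P]_t (\1_(E i) t * expR (h t)).
  rewrite -Rintegral_sum => [|i _]; last exact: intg_indic.
  by apply: eq_Rintegral => t _; rewrite -big_distrl/= sE mul1r.
apply: ler_sum => i _; have [P0|Pn0] := eqVneq (pr P (E i)) 0.
  rewrite P0 mul0r; apply: Rintegral_ge0 => t _.
  by rewrite mulr_ge0// expR_ge0.
set a := _ / _; have Ei := intg_indic1 P (mE i); have Ehi := intg_indic (mE i) hi.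
have aP : a * pr P (E i) = \int[P]_t (\1_(E i) t * h t) by rewrite /a divfK.
have lin : intg P (fun t => expR a * ((1 - a) * \1_(E i) t + \1_(E i) t * h t)).
  by apply: intgZ; apply: intgD => //; exact: intgZ.
apply: (@le_trans _ _ (\int[P]_t (expR a * ((1 - a) * \1_(E i) t + \1_(E i) t * h t)))).
  rewrite RintegralZl//; last by apply: intgD => //; exact: intgZ.
  rewrite RintegralD//; last exact: intgZ.
  rewrite RintegralZl// Rintegral_indic// -aP.
  by rewrite le_eqVlt; apply/orP; left; apply/eqP; ring.
apply: le_Rintegral => //; first exact: (intg_indic (mE i) ehi).
move=> t _; rewrite indicE; case: (t \in E i); rewrite ?mul0r ?mulr0 ?addr0 ?mulr0//.
rewrite !mul1r mulr1; have -> : expR (h t) = expR a * expR (h t - a).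
  by rewrite -expRD addrC subrK.
rewrite ler_pM2l ?expR_gt0//; apply: le_trans (expR_ge1Dx _).
by rewrite le_eqVlt; apply/orP; left; apply/eqP; ring.
Qed.

Lemma xlnx_tangent (y z : R) : 0 <= y -> 0 < z -> y * ln z + y - z <= xlnx y.
Proof.
move=> y0 z0; rewrite /xlnx; have [->|yn0] := eqVneq y 0.
  by rewrite !mul0r addr0 sub0r oppr_le0 ltW.
have {y0 yn0}y0 : 0 < y by rewrite lt_neqAle eq_sym yn0.
have := ler_wpM2l (ltW y0) (ln_le_subr1 (divr_gt0 z0 y0)).
rewrite ln_div ?posrE//.
have -> : y * (z / y - 1) = z - y by rewrite mulrBr mulr1 mulrC divfK ?gt_eqF.
by move: (ln z) (ln y) => *; lra.
Qed.

Context {d'} {TU : measurableType d'} (U : T -> TU).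
Hypothesis mU : measurable_fun setT U.

(** Gibbs' inequality: [pr P (E i) * expR (a i u)] is a family of sub-probabilities compared with
    the posterior. The tangent inequality of y ln y is summed over i, where the posteriors add up to
    1 and the references to at most 1. *)
Lemma cond_xlnx_ge n (E : 'I_n -> set T) (a : 'I_n -> TU -> R) :
  (forall i, measurable (E i)) -> (forall t, \sum_i \1_(E i) t = 1 :> R) ->
  (forall i, measurable_fun setT (a i)) -> (forall i, intg P (a i \o U)) ->
  (forall u, \sum_i pr P (E i) * expR (a i u) <= 1) ->
  \sum_i xlnx (pr P (E i)) + \sum_i \int[P]_t (\1_(E i) t * a i (U t))
    <= cond_xlnx P U E.
Proof.
move=> mE sE ma ai alt.
pose p i t := cond_prob P U (E i) t.
have mp i : measurable_fun setT (p i) by exact: measurable_cond_prob.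
have pi i : intg P (p i) by exact: intg_cond_prob.
have ae0 : {ae P, forall t, forall i, 0 <= p i t}.
  by apply: filter_forall => i; exact: cond_prob_ge0.
have ae1 : {ae P, forall t, forall i, p i t <= 1}.
  by apply: filter_forall => i; exact: cond_prob_le1.
have aeS : {ae P, forall t, \sum_i p i t = 1}.
  have h := cond_prob_sum P mU mE measurableT.
  have : {ae P, forall t, \sum_i p i t = cond_prob P U setT t}.
    by apply: h => t; rewrite sE indicT.
  have : {ae P, forall t, cond_prob P U setT t = 1}.
    apply: (cond_exp_ae mU (g := fun=> 1)); first exact: intg_indic1.
    by have := is_regression_cst P mU (1 : R); rewrite indicT.
  by apply: filterS2 => t <- ->.
(* On a null cell the reference is 0 and no tangent is available; the term is settled by the
   vanishing of the posterior. *)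
have ae_null : {ae P, forall t, forall i, pr P (E i) = 0 -> p i t = 0}.
  apply: filter_forall => i; have [P0|Pn0] := eqVneq (pr P (E i)) 0; last first.
    by apply: aeW => t /eqP; rewrite (negbTE Pn0).
  have pe : {ae P, forall t, cond_prob P U (E i) t = 0}.
    apply: (cond_exp_ae mU (g := fun=> 0)); first exact: intg_indic1.
    apply/(is_regressionP mU); first exact: intg_indic1.
    split=> //; first exact: intg_cst.
    move=> C mC; under eq_Rintegral do rewrite mulr0; rewrite Rintegral_cst1.
    apply/esym; under eq_Rintegral do rewrite mulrC.
    apply: (Rintegral_indic_null (mE i) _ P0).
    exact: (intg_indic1 P (measurable_preimageU mU mC)).
  by apply: filterS pe => t pt _.
have mai i : measurable_fun setT (fun t => a i (U t)) by exact: (measurableT_comp (ma i) mU).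
have pai i : intg P (fun t => p i t * a i (U t)).
  apply: (@intg_ae _ _ _ P (fun t => Num.max 0 (Num.min 1 (p i t)) * a i (U t))).
  - apply: (@intg_le _ _ _ _ _ (fun t => `|a i (U t)|)).
    + apply: measurable_funM => //; apply: measurable_maxr => //.
      exact: measurable_minr.
    + by have := integrable_norm (ai i).
    + move=> t; rewrite normrM ler_piMl// ger0_norm ?le_max ?lexx//.
      by rewrite ge_max ler01 ge_min lexx.
  - exact: measurable_funM.
  - by apply: filterS2 ae0 ae1 => t h0 h1; rewrite min_r// max_r.
have intE i : \int[P]_t (\1_(E i) t * a i (U t)) = \int[P]_t (p i t * a i (U t)).
  have [g rg pE] := cond_expP mU (intg_indic1 P (mE i)).
  have pE' t : p i t = g (U t) by rewrite /p /cond_prob pE.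
  have i1 : intg P (fun t => a i (U t) * \1_(E i) t).
    by under eq_fun do rewrite mulrC; exact: (intg_indic (mE i) (ai i)).
  have i2 : intg P (fun t => a i (U t) * g (U t)).
    by have := pai i; under eq_fun do rewrite pE' mulrC.
  have := is_regression_pullout mU (intg_indic1 P (mE i)) rg (ma i) i1 i2.
  under eq_Rintegral do rewrite mulrC; move=> ->.
  by apply: eq_Rintegral => t _; rewrite pE' mulrC.
pose H t := \sum_i (ln (pr P (E i)) * p i t + p i t * a i (U t)).
have Hi i : intg P (fun t => ln (pr P (E i)) * p i t + p i t * a i (U t)).
  by apply: intgD => //; exact: intgZ.
have -> : \sum_i xlnx (pr P (E i)) + \sum_i \int[P]_t (\1_(E i) t * a i (U t)) =
    \int[P]_t H t.
  rewrite Rintegral_sum => [|i _]; last exact: Hi.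
  rewrite -big_split/=; apply: eq_bigr => i _.
  have lpi : intg P (fun t => ln (pr P (E i)) * p i t) by exact: intgZ.
  rewrite (RintegralD measurableT lpi (pai i)) (RintegralZl _ measurableT (pi i)).
  by rewrite (Rintegral_cond_prob P mU (mE i)) -intE /xlnx mulrC.
apply: Rintegral_le_ae; [by apply: intg_sum|exact: intg_cond_xlnx|].
have ae01 : {ae P, forall t, (forall i, 0 <= p i t) /\ \sum_i p i t = 1}.
  exact: filterS2 ae0 aeS.
apply: filterS2 ae01 ae_null => t [p0 pS] pn.
have key i : ln (pr P (E i)) * p i t + p i t * a i (U t) + p i t -
    pr P (E i) * expR (a i (U t)) <= xlnx (p i t).
  have [P0|Pn0] := eqVneq (pr P (E i)) 0.
    by rewrite pn// P0 /xlnx !mul0r !mulr0 !addr0 subr0.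
  have Pgt0 : 0 < pr P (E i) by rewrite lt_neqAle eq_sym Pn0 fine_ge0.
  have z0 : 0 < pr P (E i) * expR (a i (U t)) by rewrite mulr_gt0 ?expR_gt0.
  have := xlnx_tangent (p0 i) z0; rewrite lnM ?posrE ?expR_gt0// expRK.
  by rewrite mulrDr [_ * ln _]mulrC.
have : \sum_i (ln (pr P (E i)) * p i t + p i t * a i (U t) + p i t -
    pr P (E i) * expR (a i (U t))) <= \sum_i xlnx (p i t) by exact: ler_sum.
rewrite sumrB big_split/= pS -/(H t); have := alt (U t).
by move: (H t) (\sum_i _) (\sum_i xlnx _) => x y z; lra.
Qed.

End variational.

Section second_moments.
Context {R : realType} {d} {T : measurableType d} (P : probability T R).
Context {d'} {TU : measurableType d'} (U : T -> TU).
Hypothesis mU : measurable_fun setT U.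

(** The truncation [phi n] of the regression is bounded, hence a legitimate test function, and its
    integral against [f] is that of its square. So its square integrates to at most that of [f], and
    monotone convergence removes the truncation. *)
Lemma L2_cond_exp f : L2fun P f -> L2fun P (cond_exp P U f).
Proof.
move=> fL; have fi := L2_intg fL; have [g rg ->] := cond_expP mU fi.
have [mg gi _] := (is_regressionP mU g fi).1 rg.
have mgU : measurable_fun setT (g \o U) by exact: measurableT_comp.
pose C (n : nat) := [set y | `|g y| <= n%:R].
have mC n : measurable (C n).
  have mn : measurable_fun setT (fun y => `|g y|) by exact: measurableT_comp.
  have := measurable_fun_ler mn (measurable_cst (n%:R : R)) measurableT.
  by move=> /(_ [set true]); rewrite setTI; apply.
pose phi n y := \1_(C n) y * g y.
have mphi n : measurable_fun setT (phi n).
  by apply: measurable_funM => //; exact: measurable_indic.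
have phib n y : `|phi n y| <= n%:R.
  rewrite /phi indicE; have [|_] := boolP (y \in C n); last by rewrite mul0r normr0.
  by rewrite inE mul1r.
have phiU n : L2fun P (fun t => phi n (U t)).
  by apply: (@L2_bounded _ _ _ _ _ n%:R) => //; exact: (measurableT_comp (mphi n) mU).
have phi2 n t : phi n (U t) * g (U t) = phi n (U t) ^+ 2.
  rewrite /phi indicE; have [_|_] := boolP (U t \in C n); last by rewrite !mul0r expr0n.
  by rewrite !mul1r expr2.
have phile n : \int[P]_t (phi n (U t) ^+ 2) <= \int[P]_t (f t ^+ 2).
  have pf := L2_mul (phiU n) fL; have [_ p2] := phiU n; have [_ f2] := fL.
  have E1 : \int[P]_t (phi n (U t) * f t) = \int[P]_t (phi n (U t) ^+ 2).
    rewrite (is_regression_pullout mU fi rg (mphi n) pf); last first.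
      by under eq_fun do rewrite phi2.
    by apply: eq_Rintegral => t _; exact: phi2.
  have : \int[P]_t (2 * (phi n (U t) * f t)) <= \int[P]_t (phi n (U t) ^+ 2 + f t ^+ 2).
    apply: le_Rintegral => //; [exact: intgZ|exact: intgD|].
    by move=> t _; have := sqr_ge0 (phi n (U t) - f t); move: (phi _ _) (f t) => x y; nra.
  by rewrite RintegralZl// RintegralD// E1; move: (\int[P]_t _) (\int[P]_t _) => x y; lra.
split=> //; rewrite /intg; apply/integrableP; split.
  by apply/measurable_EFinP; exact: measurable_funX.
have cv : (fun n => \int[P]_t (phi n (U t) ^+ 2)%:E)%E @ \oo -->
    (\int[P]_t `|(g (U t) ^+ 2)%:E|)%E.
  have -> : (\int[P]_t `|(g (U t) ^+ 2)%:E|)%E =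
    (\int[P]_t (limn (fun n => (phi n (U t) ^+ 2)%:E)))%E.
    apply: eq_integral => t _; apply/esym/cvg_lim => //=.
    rewrite ger0_norm ?sqr_ge0//; apply: cvg_EFin; first exact: nearW.
    apply: cvg_near_cst; near=> n.
    rewrite /= /phi indicE mem_set ?mul1r// /C/=.
    by near: n; exact: nbhs_infty_ger.
  apply: cvg_monotone_convergence => //.
  - move=> n; apply/measurable_EFinP; apply: measurable_funX.
    exact: (measurableT_comp (mphi n) mU).
  - by move=> n t _; rewrite lee_fin sqr_ge0.
  - move=> t _ a b ab; rewrite lee_fin /phi !indicE.
    have [|_] := boolP (U t \in C a); last by rewrite mul0r expr0n sqr_ge0.
    rewrite inE /C/= => ga; rewrite (mem_set (_ : C b (U t)))// /C/=.
    by rewrite (le_trans ga)// ler_nat.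
apply: (@le_lt_trans _ _ (\int[P]_t (f t ^+ 2))%:E); last exact: ltry.
move/cvg_lim : (cv) => <- //; apply: lime_le; first by apply/cvg_ex; eexists; exact: cv.
apply: nearW => n; rewrite EFin_Rintegral ?lee_fin//.
by case: (phiU n).
Unshelve. all: by end_near. Qed.

Lemma Rintegral_cond_exp_mul f h : L2fun P f -> L2fun P h ->
  \int[P]_t (cond_exp P U f t * h t) = \int[P]_t (cond_exp P U f t * cond_exp P U h t).
Proof.
move=> fL hL; have := L2_cond_exp fL; have := L2_cond_exp hL.
have [g rg ->] := cond_expP mU (L2_intg fL); have [l rl ->] := cond_expP mU (L2_intg hL).
move=> lL gL; have [mg _ _] := rg.
by apply: (is_regression_pullout mU (L2_intg hL) rl mg); exact: L2_mul.
Qed.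

End second_moments.

Section gram.
Context {R : realType} {d} {T : measurableType d} (P : probability T R) {k : nat}.
Variable y : 'I_k -> T -> R.
Hypothesis yL : forall i, L2fun P (y i).
Let yy i j := L2_mul (yL i) (yL j).

Lemma intg_qf (Q : 'M[R]_k) : intg P (fun t => qf Q (\col_i y i t)).
Proof.
under eq_fun do rewrite qfE.
apply: intg_sum => i _; apply: intg_sum => j _; under eq_fun do rewrite !mxE.
exact: intgZ.
Qed.

Lemma Rintegral_qf (Q : 'M[R]_k) :
  \int[P]_t qf Q (\col_i y i t) = \tr (Q *m \matrix_(i, j) \int[P]_t (y i t * y j t)).
Proof.
have Qyy i j : intg P (fun t => Q i j * (y i t * y j t)) by exact: intgZ.
transitivity (\int[P]_t \sum_i \sum_j Q i j * (y i t * y j t)).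
  apply: eq_Rintegral => t _; rewrite qfE; apply: eq_bigr => i _.
  by apply: eq_bigr => j _; rewrite !mxE.
rewrite Rintegral_sum => [|i _]; last exact: intg_sum.
apply: eq_bigr => i _; rewrite Rintegral_sum => [|j _]; last exact: Qyy.
rewrite mxE; apply: eq_bigr => j _; rewrite (RintegralZl _ measurableT (yy i j)) mxE.
by congr (_ * _); apply: eq_Rintegral => t _; rewrite mulrC.
Qed.

Lemma gram_psdmx : psdmx (\matrix_(i, j) \int[P]_t (y i t * y j t)).
Proof.
split=> [|v].
  by apply/matrixP => i j; rewrite !mxE; apply: eq_Rintegral => t _; rewrite mulrC.
set G := \matrix_(i, j) _; suff -> : (v^T *m G *m v) 0 0 = \int[P]_t (\sum_i v i 0 * y i t) ^+ 2.
  by apply: Rintegral_ge0 => t _; exact: sqr_ge0.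
transitivity (\tr ((v *m v^T) *m G)).
  rewrite -[LHS]/(qf G v) mxtrace_mulC mulmxA mxtrace_mulC mulmxA.
  by rewrite /qf /mxtrace big_ord1.
rewrite -Rintegral_qf; apply: eq_Rintegral => t _; rewrite qfE expr2 big_distrl/=.
apply: eq_bigr => i _; rewrite big_distrr/=; apply: eq_bigr => j _.
by rewrite !mxE big_ord1 !mxE; ring.
Qed.

End gram.

Section cell_means.
Context {R : realType} {d} {T : measurableType d} (P : probability T R).
Context {n : nat} (E : 'I_n -> set T).
Hypotheses (mE : forall i, measurable (E i)) (sE : forall t, \sum_i \1_(E i) t = 1 :> R).

Definition cell_mean (f : T -> R) t :=
  \sum_j \1_(E j) t * (\int[P]_s (\1_(E j) s * f s) / pr P (E j)).

Lemma cell_const_L2 (c : 'I_n -> R) : L2fun P (fun t => \sum_j \1_(E j) t * c j).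
Proof.
apply: L2_sum => j _; under eq_fun do rewrite mulrC; apply: L2Z.
apply: (@L2_bounded _ _ _ _ _ 1); first exact: measurable_indic.
by move=> t; rewrite indicE ger0_norm ?ler0n// lern1 leq_b1.
Qed.

Lemma indic_cell_const (c : 'I_n -> R) i t :
  \1_(E i) t * (\sum_j \1_(E j) t * c j) = \1_(E i) t * c i.
Proof.
have Ei j : (\1_(E j) t : R) = (t \in E j)%:R by rewrite indicE.
rewrite Ei; have [tEi|_] := boolP (t \in E i); last by rewrite !mul0r.
have E0 j : j != i -> \1_(E j) t = 0 :> R.
  move=> ji; have := sE t; rewrite (bigD1 i)//= Ei tEi.
  have s0 : 0 <= \sum_(l | l != i) \1_(E l) t :> R by rewrite sumr_ge0.
  move=> s1; have {}s1 : \sum_(l | l != i) \1_(E l) t = 0 :> R.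
    by apply: (@addrI _ 1); rewrite addr0.
  by apply: (psumr_eq0P _ s1 ji) => l _.
rewrite (bigD1 i)//= big1 => [|j ji]; first by rewrite Ei tEi addr0 !mul1r.
by rewrite E0// mul0r.
Qed.

(** [cell_mean] is the orthogonal projection onto the functions constant on cells. *)
Lemma cell_mean_le f (c : 'I_n -> R) : L2fun P f ->
  \int[P]_t ((f t - cell_mean f t) ^+ 2) <=
  \int[P]_t ((f t - \sum_j \1_(E j) t * c j) ^+ 2).
Proof.
move=> fL; set s := fun t => \sum_j \1_(E j) t * c j.
have mL : L2fun P (cell_mean f) by exact: cell_const_L2.
have sL : L2fun P s by exact: cell_const_L2.
have aL := L2B fL mL; have bL := L2B mL sL.
have ab := L2_mul aL bL; have [_ a2] := aL; have [_ b2] := bL.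
have orth : \int[P]_t ((f t - cell_mean f t) * (cell_mean f t - s t)) = 0.
  pose mu j := \int[P]_t (\1_(E j) t * f t) / pr P (E j).
  have fi := L2_intg fL; have Ef j : intg P (fun t => \1_(E j) t * f t) by exact: intg_indic.
  have E1 j := intg_indic1 P (mE j).
  have term j : intg P (fun t => (mu j - c j) * (\1_(E j) t * f t - mu j * \1_(E j) t)).
    by apply: intgZ; apply: intgB => //; exact: intgZ.
  transitivity (\int[P]_t \sum_j (mu j - c j) * (\1_(E j) t * f t - mu j * \1_(E j) t)).
    apply: eq_Rintegral => t _.
    have -> : cell_mean f t - s t = \sum_j \1_(E j) t * (mu j - c j).
      by rewrite /cell_mean /s -sumrB; apply: eq_bigr => j _; rewrite mulrBr.
    rewrite big_distrr/=; apply: eq_bigr => j _.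
    have <- : \1_(E j) t * (f t - cell_mean f t) = \1_(E j) t * f t - mu j * \1_(E j) t.
      by rewrite mulrBr /cell_mean indic_cell_const -/(mu j) [mu j * _]mulrC.
    by ring.
  rewrite Rintegral_sum => [|j _]; last exact: term.
  apply: big1 => j _; have mE1 : intg P (fun t => mu j * \1_(E j) t) by exact: intgZ.
  rewrite RintegralZl//; last exact: intgB.
  rewrite (RintegralB measurableT (Ef j) mE1) (RintegralZl _ measurableT (E1 j)).
  rewrite (Rintegral_indic P (mE j)).
  have [P0|Pn0] := eqVneq (pr P (E j)) 0.
    by rewrite P0 mulr0 subr0 (Rintegral_indic_null (mE j) fi P0) mulr0.
  by rewrite /mu divfK// subrr mulr0.
have -> : \int[P]_t ((f t - s t) ^+ 2) = \int[P]_t ((f t - cell_mean f t) ^+ 2) +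
    (2 * \int[P]_t ((f t - cell_mean f t) * (cell_mean f t - s t)) +
     \int[P]_t ((cell_mean f t - s t) ^+ 2)).
  have ab2 := intgZ 2 ab.
  rewrite -(RintegralZl _ measurableT ab) -(RintegralD measurableT ab2 b2).
  rewrite -(RintegralD measurableT a2 (intgD ab2 b2)).
  by apply: eq_Rintegral => t _; ring.
by rewrite orth mulr0 add0r lerDl; apply: Rintegral_ge0 => t _; exact: sqr_ge0.
Qed.

End cell_means.

Section gaussian_information_bound.
Context {R : realType} {k : nat} {d} {T : measurableType d}.
Variables (P : probability T R) (X : T -> k.-tuple R) (S : 'M[R]_k).
Hypotheses (mX : measurable_fun setT X) (gX : centered_gaussian P X S) (S_pd : pdmx S).
Context {d'} {TU : measurableType d'} (U : T -> TU).
Hypothesis mU : measurable_fun setT U.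

Local Notation K := (cond_cov P U X).
Let x i t := tnth (X t) i.
Let m i := cond_exp P U (x i).

Let xL i : L2fun P (x i). Proof. exact: (centered_gaussian_moments mX gX).1. Qed.
Let mL i : L2fun P (m i). Proof. exact: L2_cond_exp. Qed.
Let xx i j : \int[P]_t (x i t * x j t) = S i j.
Proof. exact: (centered_gaussian_moments mX gX).2. Qed.
Let mx i j : \int[P]_t (m i t * x j t) = \int[P]_t (m i t * m j t).
Proof. exact: Rintegral_cond_exp_mul. Qed.

Let KE : K = \matrix_(i, j) \int[P]_t ((x i t - m i t) * (x j t - m j t)).
Proof.
apply/matrixP => i j; rewrite !mxE unlock /Rintegral; congr fine.
by apply: eq_integral => t _; rewrite mxE big_ord1 !mxE.
Qed.

(** The law of total covariance for centered X; as a Gram matrix, the left side is positive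
    semidefinite, which gives the Loewner bound on [K]. *)
Let mm : \matrix_(i, j) \int[P]_t (m i t * m j t) = S - K.
Proof.
apply/matrixP => i j; rewrite KE !mxE -xx.
have xm a b := L2_mul (xL a) (mL b); have xxi a b := L2_mul (xL a) (xL b).
have mmi a b := L2_mul (mL a) (mL b); have mxi a b := L2_mul (mL a) (xL b).
have -> : \int[P]_t ((x i t - m i t) * (x j t - m j t)) =
    \int[P]_t (x i t * x j t) - \int[P]_t (x i t * m j t) - \int[P]_t (m i t * x j t)
    + \int[P]_t (m i t * m j t).
  rewrite -(RintegralB measurableT (xxi i j) (xm i j)).
  rewrite -(RintegralB measurableT (intgB (xxi i j) (xm i j)) (mxi i j)).
  rewrite -(RintegralD measurableT (intgB (intgB (xxi i j) (xm i j)) (mxi i j)) (mmi i j)).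
  by apply: eq_Rintegral => t _; ring.
have -> : \int[P]_t (x i t * m j t) = \int[P]_t (m j t * x i t).
  by apply: eq_Rintegral => t _; rewrite mulrC.
rewrite !mx (_ : \int[P]_t (m j t * m i t) = \int[P]_t (m i t * m j t)); first by ring.
by apply: eq_Rintegral => t _; rewrite mulrC.
Qed.

Lemma cond_cov_psdmx : psdmx K.
Proof. by rewrite KE; apply: gram_psdmx => i; exact: L2B. Qed.

Lemma cond_cov_le : loewner_le K S.
Proof. by rewrite /loewner_le -mm; apply: gram_psdmx. Qed.

Variable rho : R.
(** The only link with information in this section: it holds for the last representation of a
    mechanism and for the output of a test channel. *)
Hypothesis info_le : forall n (A : 'I_n -> set (k.-tuple R)), finite_partition A ->
  cond_xlnx P U (fun i => X @^-1` A i) <= \sum_i xlnx (pr P (X @^-1` A i)) + rho.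

Section test_function.
Variable Q : 'M[R]_k.
Hypotheses (Q_pd : pdmx Q) (trQK : \tr (Q *m K) <= k%:R).

(** [expR kappa] normalizes the density of N(u, Q^-1) relative to N(0, S). For Q = K^-1, [kappa] is
    the rate to be bounded. *)
Let kappa := 2^-1 * ln (\det Q * \det S).
Let Si := invmx S.
Let r b t := \sum_c Q b c * m c t.
Let rL b : L2fun P (r b).
Proof. by apply: L2_sum => c _; exact: L2Z. Qed.

Let qfx (M : 'M[R]_k) t := qf M (\col_i x i t).
Let qfxi M : intg P (qfx M). Proof. exact: intg_qf. Qed.
Let w t := qf Q (\col_i m i t).
Let wi : intg P w. Proof. exact: intg_qf. Qed.

Let int_w : \int[P]_t w t = \tr (Q *m (S - K)).
Proof. by rewrite Rintegral_qf ?mm. Qed.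

Let int_qfx M : \int[P]_t qfx M t = \tr (M *m S).
Proof.
rewrite Rintegral_qf//; congr (\tr (_ *m _)).
by apply/matrixP => i j; rewrite mxE xx.
Qed.

Let int_xr : \sum_b \int[P]_t (x b t * r b t) = \tr (Q *m (S - K)).
Proof.
rewrite -int_w; rewrite Rintegral_qf//; apply: eq_bigr => b _; rewrite mxE.
have Qxm c : intg P (fun t => Q b c * (m c t * x b t)) by apply: intgZ; exact: L2_mul.
transitivity (\int[P]_t \sum_c Q b c * (m c t * x b t)).
  apply: eq_Rintegral => t _; rewrite /r big_distrr/=; apply: eq_bigr => c _.
  by rewrite mulrCA [x b t * _]mulrC.
rewrite Rintegral_sum => [|c _]; last exact: Qxm.
apply: eq_bigr => c _; rewrite (RintegralZl _ measurableT (L2_mul (mL c) (xL b))) mx.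
by rewrite mxE.
Qed.

Section cells.
Context {n : nat} (A : 'I_n -> set (k.-tuple R)).
Hypothesis pA : finite_partition A.
Let E i := X @^-1` A i.
Let mE i : measurable (E i).
Proof. by apply: measurable_preimageU => //; case: pA. Qed.
Let sE t : \sum_i \1_(E i) t = 1 :> R.
Proof. exact: (sum_indic_partition (X t) pA). Qed.

Let xi j b := \int[P]_t (\1_(E j) t * x b t).
Let sigma j := \int[P]_t (\1_(E j) t * (qfx Si t - qfx Q t)).

(** Averaging the log-density over cells leaves the integrals of the terms in X alone and in U alone
    unchanged. Only the product of X with Q E[X|U] changes, X being replaced by its cell mean,
    whence the error term. *)
Lemma gaussian_cell_bound :
  kappa - \sum_b \int[P]_t ((x b t - cell_mean P E (x b) t) * r b t) <= rho.
Proof.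
have [g gP] : {g : 'I_k -> TU -> R & forall b, is_regression P U (x b) (g b) /\
    m b = g b \o U}.
  apply: (@choice _ _ (fun b g => is_regression P U (x b) g /\ m b = g \o U)) => b.
  by have [g ? ?] := cond_expP mU (L2_intg (xL b)); exists g.
pose M u : 'cV[R]_k := \col_b g b u.
have mM : measurable_vec M by move=> b; under eq_fun do rewrite mxE; case: (gP b) => -[].
have MU t : M (U t) = \col_b m b t by apply/colP => b; rewrite !mxE (gP b).2.
have QMU b t : (Q *m M (U t)) b 0 = r b t.
  by rewrite MU mxE; apply: eq_bigr => c _; rewrite mxE.
(* the logarithm of the density of N(M u, Q^-1) with respect to N(0, S) *)
pose h u t := kappa + 2^-1 * (qfx Si t - qf Q (\col_i x i t - M u)).
have hE u t : h u t = kappa + (2^-1 * (qfx Si t - qfx Q t) +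
    (\sum_b (Q *m M u) b 0 * x b t - 2^-1 * qf Q (M u))).
  rewrite /h qfB ?Q_pd.1// -/(qfx Q t).
  have -> : ((\col_i x i t)^T *m Q *m M u) 0 0 = \sum_b (Q *m M u) b 0 * x b t.
    by rewrite -mulmxA mxE; apply: eq_bigr => b _; rewrite !mxE mulrC.
  by move: (\sum_b _) => s; field.
have dQS : 0 < \det Q * \det S by rewrite mulr_gt0 ?pdmx_det_gt0.
have hx u : intg P (fun t => \sum_b (Q *m M u) b 0 * x b t).
  by apply: intg_sum => b _; apply: intgZ; exact: L2_intg.
have qfd : intg P (fun t => qfx Si t - qfx Q t) by exact: intgB.
have hi u : intg P (h u).
  rewrite (_ : h u = fun t => kappa + (2^-1 * (qfx Si t - qfx Q t) +
    (\sum_b (Q *m M u) b 0 * x b t - 2^-1 * qf Q (M u)))); last exact/funext/hE.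
  apply: intgD; first exact: intg_cst; apply: intgD; first exact: intgZ.
  by apply: intgB => //; exact: intg_cst.
have expkappa : expR kappa = Num.sqrt (\det Q * \det S).
  apply/eqP; rewrite -(@eqrXn2 _ 2) ?expR_ge0 ?sqrtr_ge0//.
  rewrite sqr_sqrtr ?ltW// -expRM_natl /kappa mulrA mulfV// mul1r lnK//.
have ehE u : (\int[P]_t (expR (h u t))%:E = 1)%E.
  have mw : measurable_fun setT (fun t => (wexp (qfx Si t)
      (qf Q (\col_i x i t - M u)))%:E).
    apply/measurable_EFinP; apply: measurable_wexp; first exact: intg_measurable.
    have -> : (fun t => qf Q (\col_i x i t - M u)) =
        fun t => qfx Si t - 2 * (h u t - kappa).
      by apply/funext => t; rewrite /h; move: (qfx Si t) (qf _ _) => p q; field.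
    apply: measurable_funB; first exact: intg_measurable.
    by apply: measurable_funM => //; apply: measurable_funB => //; exact: intg_measurable.
  transitivity ((expR kappa)%:E * \int[P]_t (wexp (qfx Si t)
      (qf Q (\col_i x i t - M u)))%:E)%E.
    rewrite -ge0_integralZl//.
    - by apply: eq_integral => t _; rewrite -EFinM /h expRD.
    - by move=> t _; rewrite lee_fin wexp_ge0.
  have -> := centered_gaussian_exp_quadratic mX gX (M u) S_pd Q_pd.
  by rewrite -EFinM expkappa mulfV// gt_eqF// sqrtr_gt0.
have ehi u : intg P (fun t => expR (h u t)).
  rewrite /intg; apply/integrableP; split.
    apply/measurable_EFinP; apply: measurableT_comp => //; exact: intg_measurable.
  rewrite (eq_integral (fun t => (expR (h u t))%:E)) => [|t _]; last first.
    by rewrite /= ger0_norm// expR_ge0.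
  by rewrite ehE ltry.
(* Averaging h over the cells keeps exp (a j u) a sub-probability density. *)
pose a j u := \int[P]_t (\1_(E j) t * h u t) / pr P (E j).
have E1 j := intg_indic1 P (mE j).
have intEh j u : \int[P]_t (\1_(E j) t * h u t) = kappa * pr P (E j) +
    (2^-1 * sigma j + (\sum_b (Q *m M u) b 0 * xi j b - 2^-1 * qf Q (M u) * pr P (E j))).
  have i1 : intg P (fun t => kappa * \1_(E j) t) by exact: intgZ.
  have i2 : intg P (fun t => \1_(E j) t * (qfx Si t - qfx Q t)) by exact: intg_indic.
  have i2' := intgZ (2^-1) i2.
  have i3 b : intg P (fun t => \1_(E j) t * x b t) by apply: intg_indic => //; exact: L2_intg.
  have i3' b := intgZ ((Q *m M u) b 0) (i3 b).
  have i3s : intg P (fun t => \sum_b (Q *m M u) b 0 * (\1_(E j) t * x b t)).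
    by apply: intg_sum.
  have i4 := intgZ (2^-1 * qf Q (M u)) (E1 j).
  transitivity (\int[P]_t (kappa * \1_(E j) t + (2^-1 * (\1_(E j) t * (qfx Si t - qfx Q t)) +
     (\sum_b (Q *m M u) b 0 * (\1_(E j) t * x b t) - 2^-1 * qf Q (M u) * \1_(E j) t)))).
    apply: eq_Rintegral => t _; rewrite hE.
    have -> : \sum_b (Q *m M u) b 0 * (\1_(E j) t * x b t) =
        \1_(E j) t * \sum_b (Q *m M u) b 0 * x b t.
      by rewrite big_distrr/=; apply: eq_bigr => b _; rewrite mulrCA.
    by move: (\sum_b _) => s; ring.
  rewrite (RintegralD measurableT i1 (intgD i2' (intgB i3s i4))).
  rewrite (RintegralD measurableT i2' (intgB i3s i4)) (RintegralB measurableT i3s i4).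
  rewrite (RintegralZl _ measurableT (E1 j)) (RintegralZl _ measurableT (E1 j)).
  rewrite (RintegralZl _ measurableT i2) (Rintegral_indic P (mE j)).
  rewrite Rintegral_sum => [|b _]; last exact: i3'.
  by under eq_bigr do rewrite (RintegralZl _ measurableT (i3 _)).

have aE j u : a j u = (pr P (E j))^-1 * (kappa * pr P (E j) + (2^-1 * sigma j +
    (\sum_b (Q *m M u) b 0 * xi j b - 2^-1 * qf Q (M u) * pr P (E j)))).
  by rewrite /a intEh mulrC.
have mqf : measurable_fun setT (fun u => qf Q (M u)).
  under eq_fun do rewrite qfE; apply: measurable_sum => b; apply: measurable_sum => c.
  by apply: measurable_funM => //; exact: measurable_funM.
have ma j : measurable_fun setT (a j).
  rewrite (funext (aE j)); apply: measurable_funM => //; apply: measurable_funD => //.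
  apply: measurable_funD => //; apply: measurable_funB.
    apply: measurable_sum => b; apply: measurable_funM => //.
    exact: (measurable_vec_mul Q mM b).
  by apply: measurable_funM => //; exact: measurable_funM.
have aUE j t : a j (U t) = (pr P (E j))^-1 * (kappa * pr P (E j) + (2^-1 * sigma j +
    (\sum_b xi j b * r b t - 2^-1 * pr P (E j) * w t))).
  rewrite aE MU -/(w t); congr (_ * (_ + (_ + (_ - _)))); last by rewrite mulrAC.
  by apply: eq_bigr => b _; rewrite -MU QMU mulrC.
have ai j : intg P (a j \o U).
  rewrite (_ : a j \o U = fun t => (pr P (E j))^-1 * (kappa * pr P (E j) + (2^-1 * sigma j +
    (\sum_b xi j b * r b t - 2^-1 * pr P (E j) * w t)))); last exact/funext/aUE.
  apply: intgZ; apply: intgD; first exact: intg_cst; apply: intgD; first exact: intg_cst.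
  by apply: intgB; [apply: intg_sum => b _; apply: intgZ; exact: L2_intg|exact: intgZ].
have asum u : \sum_j pr P (E j) * expR (a j u) <= 1.
  apply: (le_trans (jensen_cells mE sE (hi u) (ehi u))).
  by rewrite -lee_fin -EFin_Rintegral// ehE.
have main : \sum_j \int[P]_t (\1_(E j) t * a j (U t)) <= rho.
  rewrite -(lerD2l (\sum_i xlnx (pr P (E i)))); apply: le_trans (info_le pA).
  exact: (cond_xlnx_ge mU mE sE ma ai asum).
have cells f : intg P f -> \sum_j \int[P]_t (\1_(E j) t * f t) = \int[P]_t f t.
  move=> fi; rewrite -Rintegral_sum => [|j _]; last exact: intg_indic.
  by apply: eq_Rintegral => t _; rewrite -big_distrl/= sE mul1r.
have term j : \int[P]_t (\1_(E j) t * a j (U t)) = kappa * pr P (E j) + (2^-1 * sigma j +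
    (\sum_b xi j b / pr P (E j) * \int[P]_t (\1_(E j) t * r b t)
      - 2^-1 * \int[P]_t (\1_(E j) t * w t))).
  have [P0|Pn0] := eqVneq (pr P (E j)) 0.
    rewrite (Rintegral_indic_null (mE j) (ai j) P0) (Rintegral_indic_null (mE j) wi P0) P0.
    rewrite /sigma (Rintegral_indic_null (mE j) qfd P0) big1 ?mulr0 ?subrr ?addr0// => b _.
    by rewrite (Rintegral_indic_null (mE j) (L2_intg (rL b)) P0) mulr0.
  have i1 := intgZ kappa (E1 j); have i2 := intgZ (2^-1 * sigma j / pr P (E j)) (E1 j).
  have i3 b : intg P (fun t => \1_(E j) t * r b t).
    by apply: intg_indic => //; exact: L2_intg.
  have i3' b := intgZ (xi j b / pr P (E j)) (i3 b).
  have i4 : intg P (fun t => \1_(E j) t * w t) by exact: intg_indic.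
  have i4' := intgZ (2^-1) i4.
  have i3s : intg P (fun t => \sum_b xi j b / pr P (E j) * (\1_(E j) t * r b t)).
    by apply: intg_sum => b _.
  transitivity (\int[P]_t (kappa * \1_(E j) t + (2^-1 * sigma j / pr P (E j) * \1_(E j) t +
      (\sum_b xi j b / pr P (E j) * (\1_(E j) t * r b t) - 2^-1 * (\1_(E j) t * w t))))).
    apply: eq_Rintegral => t _; rewrite aUE.
    have -> : \sum_b xi j b / pr P (E j) * (\1_(E j) t * r b t) =
        \1_(E j) t * (pr P (E j))^-1 * \sum_b xi j b * r b t.
      by rewrite big_distrr/=; apply: eq_bigr => b _; ring.
    by move: (\sum_b _) Pn0 => s; move: (pr P (E j)) => p p0; field.
  rewrite (RintegralD measurableT i1 (intgD i2 (intgB i3s i4'))).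
  rewrite (RintegralD measurableT i2 (intgB i3s i4')) (RintegralB measurableT i3s i4').
  rewrite (RintegralZl _ measurableT (E1 j)) (RintegralZl _ measurableT (E1 j)).
  rewrite (RintegralZl _ measurableT i4) (Rintegral_indic P (mE j)) divfK//.
  rewrite Rintegral_sum => [|b _]; last exact: i3'.
  by under eq_bigr do rewrite (RintegralZl _ measurableT (i3 _)).
have cmL b : L2fun P (cell_mean P E (x b)) by exact: cell_const_L2.
have cm b : \sum_j xi j b / pr P (E j) * \int[P]_t (\1_(E j) t * r b t) =
    \int[P]_t (cell_mean P E (x b) t * r b t).
  have i3 j : intg P (fun t => \1_(E j) t * r b t).
    by apply: intg_indic => //; exact: L2_intg.
  transitivity (\sum_j \int[P]_t (xi j b / pr P (E j) * (\1_(E j) t * r b t))).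
    by apply: eq_bigr => j _; rewrite (RintegralZl _ measurableT (i3 j)).
  rewrite -Rintegral_sum => [|j _]; last exact: intgZ.
  apply: eq_Rintegral => t _; rewrite /cell_mean big_distrl/=; apply: eq_bigr => j _.
  by rewrite mulrA [_ * \1_ _ _]mulrC.
have err b : \int[P]_t ((x b t - cell_mean P E (x b) t) * r b t) =
    \int[P]_t (x b t * r b t) - \int[P]_t (cell_mean P E (x b) t * r b t).
  rewrite -(RintegralB measurableT (L2_mul (xL b) (rL b)) (L2_mul (cmL b) (rL b))).
  by apply: eq_Rintegral => t _; rewrite mulrBl.
have P1 : \sum_j pr P (E j) = 1.
  rewrite -[RHS](Rintegral_cst1 P) -cells; last exact: intg_cst.
  by apply: eq_bigr => j _; rewrite -Rintegral_indic//; apply: eq_Rintegral => t _; rewrite mulr1.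
have sig : \sum_j sigma j = k%:R - \tr (Q *m S).
  rewrite cells// (RintegralB measurableT (qfxi _) (qfxi _)) !int_qfx.
  by rewrite mulVmx ?pdmx_unit// mxtrace1.
(* The sum in [main] evaluates to [kappa] + (k - tr(Q K)) / 2 minus the error, and the middle term
   is nonnegative by [trQK]. *)
rewrite (eq_bigr _ (fun b _ => err b)) sumrB int_xr.
move: main; rewrite (eq_bigr _ (fun j _ => term j)) !big_split/= -!big_distrr/= P1 sig mulr1.
rewrite sumrN -big_distrr/= cells// int_w exchange_big/= (eq_bigr _ (fun b _ => cm b)).
move: trQK; rewrite mulmxBr raddfB/=.
move: (\tr (Q *m K)) (\tr (Q *m S)) (\sum_b _) kappa => a1 a2 a3 a4.
by move: (k%:R : R) => a5 *; lra.
Qed.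

End cells.

(** On the cells of a fine grid the error of [gaussian_cell_bound] disappears in two limits: first
    the mesh tends to 0 for fixed [eta], then [eta] tends to 0. *)
Lemma gaussian_test_bound : kappa <= rho.
Proof.
pose y N b t : R := quant_val (quant N (x b t)).
pose e N b := \int[P]_t ((x b t - y N b t) ^+ 2).
have mx1 b : measurable_fun setT (x b) by case: (xL b).
have my N b : measurable_fun setT (y N b).
  rewrite (_ : y N b = fun t => \sum_i \1_(quant N @^-1` [set i]) (x b t) * quant_val i).
    apply: measurable_sum => i; apply: measurable_funM => //.
    by apply: (measurableT_comp _ (mx1 b)); apply: measurable_indic; exact: measurable_quant.
  apply/funext => t; rewrite (bigD1 (quant N (x b t)))//= big1 => [|i /eqP ni].
    by rewrite indicE mem_set// mul1r addr0.
  by rewrite indicE memNset ?mul0r// => /= qi; apply: ni.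
have e0 b : e^~ b @ \oo --> (0 : R).
  rewrite -(Rintegral_cst1 P 0).
  apply: (@Rintegral_cvg _ _ _ P _ _ (fun t => (1 + `|x b t|) ^+ 2)).
  - by move=> N; apply: measurable_funX; exact: measurable_funB.
  - exact: measurable_cst.
  - apply: (L2D (L2_cst P 1) _).2; apply: (L2_le _ (xL b)); first exact: measurableT_comp.
    by move=> t; rewrite normr_id.
  - move=> t; rewrite [X in _ --> X](_ : 0 = (x b t - x b t) * (x b t - x b t)); last first.
      by rewrite subrr mul0r.
    under eq_fun do rewrite expr2.
    by apply: cvgM; apply: cvgB; [exact: cvg_cst|exact: quant_cvg|exact: cvg_cst|exact: quant_cvg].
  - move=> N t; rewrite ger0_norm ?sqr_ge0// -[leLHS]real_normK ?num_real//.
    rewrite lerXn2r ?nnegrE ?addr_ge0//; apply: le_trans (quant_dist N (x b t)) _.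
    by rewrite lerD2r invf_le1 ?ltr0n// ler1n.
(* Young's inequality separates the cell error of X, small for large [N], from [r b], which is only
   square integrable. *)
have cellN N (eta : R) : 0 < eta ->
    kappa - \sum_b (eta^-1 * e N b + eta * \int[P]_t (r b t ^+ 2)) <= rho.
  move=> eta0; pose F : finType := {ffun 'I_k -> 'I_(quant_bound N)}.
  pose q (v : k.-tuple R) : F := [ffun b => quant N (tnth v b)].
  pose A (j : 'I_#|F|) := [set v | q v = enum_val j].
  have pA : finite_partition A.
    split.
    - move=> j; rewrite (_ : A j = \bigcap_b
        ((fun v => tnth v b) @^-1` (quant N @^-1` [set enum_val j b]))).
        apply: fin_bigcap_measurable => // b _.
        rewrite -[X in measurable X]setTI; apply: measurable_tnth => //.
        exact: measurable_quant.
      apply/seteqP; split=> v /=.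
        by move=> vj b _ /=; rewrite -vj ffunE.
      by move=> vb; apply/ffunP => b; rewrite ffunE vb.
    - apply/trivIsetP => i j _ _ ij; rewrite -subset0 => v [/= vi vj].
      by move/eqP: ij; apply; apply: enum_val_inj; rewrite -vi -vj.
    - apply/seteqP; split=> // v _; exists (enum_rank (q v)) => //=.
      by rewrite /A/= enum_rankK.
  apply: le_trans (gaussian_cell_bound pA); rewrite lerD2l lerN2; apply: ler_sum => b _.
  pose E i := X @^-1` A i.
  have mE i : measurable (E i) by apply: measurable_preimageU => //; case: pA.
  have sE t : \sum_i \1_(E i) t = 1 :> R by exact: (sum_indic_partition (X t) pA).
  have cL : L2fun P (cell_mean P E (x b)) by exact: cell_const_L2.
  have dL := L2B (xL b) cL; have [_ d2] := dL; have [_ r2] := rL b.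
  apply: (@le_trans _ _ (eta^-1 * \int[P]_t ((x b t - cell_mean P E (x b) t) ^+ 2) +
      eta * \int[P]_t (r b t ^+ 2))); last first.
    rewrite lerD2r ler_wpM2l ?invr_ge0 ?(ltW eta0)//.
    (* The grid values of X are constant on cells, so the cell mean approximates X at least as well
       as they do. *)
    apply: (le_trans (cell_mean_le mE sE (fun j => quant_val (enum_val j b)) (xL b))).
    rewrite le_eqVlt; apply/orP; left; apply/eqP; apply: eq_Rintegral => t _.
    congr ((_ - _) ^+ 2); transitivity (\sum_j \1_(E j) t * y N b t); last first.
      by rewrite -big_distrl/= sE mul1r.
    apply: eq_bigr => j _; rewrite indicE; have [/set_mem|_] := boolP (t \in E j).
      by rewrite /E /A/= => tj; rewrite -tj ffunE.
    by rewrite !mul0r.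
  rewrite -(RintegralZl _ measurableT d2) -(RintegralZl _ measurableT r2).
  rewrite -(RintegralD measurableT (intgZ _ d2) (intgZ _ r2)).
  apply: (Rintegral_le_ae (L2_mul dL (rL b)) (intgD (intgZ _ d2) (intgZ _ r2))).
  apply: aeW => t; move: (x b t - _) (r b t) => u v.
  have := sqr_ge0 (u - eta * v); rewrite -(pmulr_rge0 _ (_ : 0 < eta^-1)) ?invr_gt0//.
  have -> : eta^-1 * (u - eta * v) ^+ 2 = eta^-1 * u ^+ 2 + eta * v ^+ 2 - 2 * (u * v).
    by field; rewrite gt_eqF.
  have : 0 <= eta^-1 * u ^+ 2 + eta * v ^+ 2.
    by rewrite addr_ge0// mulr_ge0 ?sqr_ge0 ?invr_ge0 ?ltW.
  by move: (eta^-1 * _ + _) (u * v) => *; lra.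
have cell eta : 0 < eta -> kappa - \sum_b eta * \int[P]_t (r b t ^+ 2) <= rho.
  move=> eta0; have cv : (fun N => kappa -
      \sum_b (eta^-1 * e N b + eta * \int[P]_t (r b t ^+ 2))) @ \oo -->
      kappa - \sum_b (eta^-1 * 0 + eta * \int[P]_t (r b t ^+ 2)).
    apply: cvgB; first exact: cvg_cst.
    apply: cvg_big => [|b _]; first exact: add_continuous.
    by apply: cvgD; [apply: cvgM; [exact: cvg_cst|exact: e0]|exact: cvg_cst].
  rewrite (eq_bigr (fun b => eta^-1 * 0 + eta * \int[P]_t (r b t ^+ 2))); last first.
    by move=> b _; rewrite mulr0 add0r.
  by apply: (cvgr_to_le cv); apply: nearW => N; exact: cellN.
apply: (@le_of_le_div _ _ _ (\sum_b \int[P]_t (r b t ^+ 2))).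
  by apply: sumr_ge0 => b _; apply: Rintegral_ge0 => t _; exact: sqr_ge0.
by move=> N; rewrite mulrC big_distrr/=; apply: cell; rewrite invr_gt0 ltr0n.
Qed.

End test_function.

Lemma gaussian_information_bound : feasible S rho K.
Proof.
apply/(feasibleP _ S_pd); split; [exact: cond_cov_psdmx|exact: cond_cov_le|].
(* K is not yet known to be invertible: the bound is used with
   Q = (K + e I)^-1, and e tends to 0. *)
pose G (e : R) := K + e *: 1%:M.
have bound e : 0 < e -> \det S * expR (- (2 * rho)) <= \det (G e).
  move=> e0; have G_pd : pdmx (G e) by apply: pdmxD cond_cov_psdmx (pdmxZ e0 (pdmx1 k)).
  have dG := pdmx_det_gt0 G_pd; have dS := pdmx_det_gt0 S_pd.
  have uG := pdmx_unit G_pd; have Q_pd := pdmx_inv G_pd.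
  have trQ : \tr (invmx (G e) *m K) <= k%:R.
    (* The trace is k - e tr(Q) with Q the inverse of [G e], and tr(Q) is a sum of squares by
       Cholesky. *)
    have -> : K = G e - e *: 1%:M by rewrite addrK.
    rewrite mulmxBr mulVmx// -scalemxAr mulmx1 raddfB/= mxtrace1 linearZ/=.
    rewrite gerBl mulr_ge0 ?(ltW e0)//.
    have [L [_ _ ->]] := psdmx_cholesky (pdmx_psdmx Q_pd).
    by rewrite mxtrace_mulmxT; apply: sumr_ge0 => i _; apply: sumr_ge0 => j _; exact: sqr_ge0.
  have := gaussian_test_bound Q_pd trQ; rewrite det_inv => le1.
  rewrite expRN ler_pdivrMr ?expR_gt0// mulrC -ler_pdivrMr//.
  rewrite -ler_ln ?posrE ?expR_gt0 ?divr_gt0// expRK mulrC.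
  by move: le1; move: (ln _) => l; lra.
have cG : continuous (fun e => \det (G e)).
  apply: continuous_det => i j e; under eq_fun do rewrite addmxE scalemxE.
  by apply: cvgD; [exact: cvg_cst|apply: cvgM; [exact: cvg_id|exact: cvg_cst]].
have cv : (fun N => \det (G (N.+1%:R^-1 : R))) @ \oo --> \det (G 0).
  exact: (cvg_comp _ (fun e => \det (G e)) (@cvg_harmonic R) (cG 0)).
have -> : K = G 0 by rewrite /G scale0r addr0.
apply: (cvgr_to_ge cv); apply: nearW => N; apply: bound.
by rewrite invr_gt0 ltr0n.
Qed.

End gaussian_information_bound.

(** * Feasibility of the error covariance of a mechanism *)

Section converse.
Context {R : realType} {k : nat} {d} {T : measurableType d} (P : probability T R).
Variables (X : {RV P >-> k.-tuple R}) (S : 'M[R]_k) (L : nat) (r : nat -> R).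
Variables (dZ : measure_display) (TZ : measurableType dZ) (Z : {RV P >-> TZ}).
Variables (dH : nat -> measure_display) (TH : forall l, measurableType (dH l)).
Variable H : forall l, {RV P >-> TH l}.

Lemma mechanism_xlnx n (A : 'I_n -> set (k.-tuple R)) l :
  mechanism S L r X Z H -> finite_partition A -> (l <= L)%N ->
  cond_xlnx P (H l) (fun i => X @^-1` A i) <=
    \sum_i xlnx (pr P (X @^-1` A i)) + \sum_(0 <= j < l) r j.
Proof.
move=> [_ _ ind _ rate] pA; have mA i : measurable (A i) by case: pA.
have mX : measurable_fun setT X by [].
have mE i : measurable (X @^-1` A i) by exact: measurable_preimageU.
elim: l => [_|l IH lL].
  rewrite big_nil addr0; set s := \sum_i _; rewrite -[leRHS](Rintegral_cst1 P).
  rewrite le_eqVlt; apply/orP; left; apply/eqP.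
  apply: (@Rintegral_ae _ _ _ P) => //.
    by apply: measurable_sum => i; exact/measurable_xlnx/measurable_cond_prob.
  have aeE : {ae P, forall t, forall i, cond_prob P (H 0%N) (X @^-1` A i) t = pr P (X @^-1` A i)}.
    apply: filter_forall => i; apply: cond_prob_indep => // C mC; exact: ind.
  by apply: filterS aeE => t tE; apply: eq_bigr => i _; rewrite tE.
rewrite big_nat_recr//= addrA; apply: le_trans (lerD (IH (ltnW lL)) (lexx _)).
by apply: cond_mutual_info_chain => //; exact: rate.
Qed.

Lemma mechanism_feasible : pdmx S -> mechanism S L r X Z H ->
  feasible S (\sum_(0 <= l < L) r l) (cond_cov P (H L) X).
Proof.
move=> S_pd mH; have [gX _ _ _ _] := mH.
apply: (gaussian_information_bound _ gX S_pd) => // n A pA.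
exact: mechanism_xlnx.
Qed.

End converse.

(** * Gaussian test channels *)

Section gauss_blocks.
Context {R : realType} {m n : nat}.

Definition cat_tuplev (p : m.-tuple R * n.-tuple R) : (m + n).-tuple R :=
  tupv (col_mx (colv p.1) (colv p.2)).

Lemma measurable_cat_tuplev : measurable_fun setT cat_tuplev.
Proof.
apply: measurable_tupv => i; case: (split_ordP i) => j ->.
  under eq_fun do rewrite col_mxEu mxE.
  exact: (measurableT_comp (measurable_tnth j) measurable_fst).
under eq_fun do rewrite col_mxEd mxE.
exact: (measurableT_comp (measurable_tnth j) measurable_snd).
Qed.

HB.instance Definition _ := isMeasurableFun.Build _ _ _ _ cat_tuplev measurable_cat_tuplev.

Lemma gauss_cat A : measurable A ->
  gauss (m + n) A = (gauss m \x gauss n)%E (cat_tuplev @^-1` A).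
Proof.
move=> mA; rewrite -[RHS]/(distribution (gauss m \x gauss n)%E cat_tuplev A).
apply: measure_tuple_unique => // C mC; rewrite gauss_box// big_split_ord/=.
rewrite -!gauss_box//.
rewrite -(product_measure1E (gauss m) (gauss n)); [|exact: measurable_box|exact: measurable_box].
rewrite /distribution /pushforward; congr (_ _).
have E1 (p : m.-tuple R * n.-tuple R) (j : 'I_m) : tnth (cat_tuplev p) (lshift n j) = tnth p.1 j.
  by rewrite tnth_mktuple col_mxEu mxE.
have E2 (p : m.-tuple R * n.-tuple R) (j : 'I_n) : tnth (cat_tuplev p) (rshift m j) = tnth p.2 j.
  by rewrite tnth_mktuple col_mxEd mxE.
apply/seteqP; split=> [p [p1 p2] i _|p pC].
  rewrite /preimage/=; case: (split_ordP i) => j ->; first by rewrite E1; exact: (p1 j I).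
  by rewrite E2; exact: (p2 j I).
split=> j _; rewrite /preimage/=; first by rewrite -E1; exact: (pC _ I).
by rewrite -E2; exact: (pC _ I).
Qed.

Lemma ge0_integral_gauss_cat (F : (m + n).-tuple R -> \bar R) :
  measurable_fun setT F -> (forall t, (0 <= F t)%E) ->
  (\int[gauss (m + n)]_t F t =
     \int[gauss m]_u \int[gauss n]_v F (cat_tuplev (u, v)))%E.
Proof.
move=> mF F0; rewrite -(fubini_tonelli1 (F \o cat_tuplev)) => //; last first.
- by move=> p; exact: F0.
- by apply: measurableT_comp => //; exact: measurable_cat_tuplev.
apply/esym/(ge0_integral_law (P := (gauss m \x gauss n)%E) measurable_cat_tuplev) => // A mA.
by rewrite gauss_cat.
Qed.

End gauss_blocks.

Section orthogonal_blocks.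
Context {R : realType} {m n : nat}.

(** By rotation invariance, orthonormal rows act like coordinate projections, whose two blocks are
    independent standard Gaussians. *)
Lemma gauss_orthogonal_blocks (O1 : 'M[R]_(m, m + n)) (O2 : 'M[R]_(n, m + n)) A B :
  col_mx O1 O2 *m (col_mx O1 O2)^T = 1%:M -> measurable A -> measurable B ->
  gauss (m + n) [set t | A (tupv (O1 *m colv t)) /\ B (tupv (O2 *m colv t))] =
  (gauss m A * gauss n B)%E.
Proof.
move=> OO mA mB; pose F (s : (m + n).-tuple R) : Prop :=
  A (tupv (usubmx (colv s))) /\ B (tupv (dsubmx (colv s))).
have mF : measurable (F : set _).
  have mu : measurable_fun setT (fun s : (m + n).-tuple R => tupv (usubmx (colv s))).
    by apply: measurable_tupv => i; under eq_fun do rewrite !mxE; exact: measurable_tnth.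
  have md : measurable_fun setT (fun s : (m + n).-tuple R => tupv (dsubmx (colv s))).
    by apply: measurable_tupv => i; under eq_fun do rewrite !mxE; exact: measurable_tnth.
  by apply: measurableI; rewrite -[X in measurable X]setTI; [exact: mu|exact: md].
have E0 : @cat_tuplev R m n @^-1` F = A `*` B.
  by apply/seteqP; split=> -[u v]; rewrite /F/= /cat_tuplev/= tupvK col_mxKu col_mxKd !colvK.
have -> : [set t | A (tupv (O1 *m colv t)) /\ B (tupv (O2 *m colv t))] =
    (fun t => tupv (col_mx O1 O2 *m colv t)) @^-1` F.
  by apply/seteqP; split=> t; rewrite /F/= /preimage/= tupvK mul_col_mx col_mxKu col_mxKd.
rewrite -(product_measure1E (gauss m) (gauss n))// -E0 -gauss_cat//.
have mO : measurable_fun setT (fun t => tupv (col_mx O1 O2 *m colv t)).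
  apply: measurable_tupv; apply: measurable_vec_mul; exact: measurable_colv.
have mpre : measurable ((fun t => tupv (col_mx O1 O2 *m colv t)) @^-1` F).
  by rewrite -[X in measurable X]setTI; exact: mO.
have gE E : measurable E -> gauss (m + n) E = (\int[gauss (m + n)]_t (\1_E t)%:E)%E.
  by move=> mE; rewrite integral_indic// setIT.
rewrite gE// gE// -(gauss_rotation OO (F := fun t => (\1_F t)%:E)).
- by apply: eq_integral => t _; rewrite !indicE.
- by apply/measurable_EFinP; exact: measurable_indic.
- by move=> t; rewrite lee_fin.
Qed.

End orthogonal_blocks.

(** The rows of L^-1 (F1 F2) are orthonormal. Since [F2] is invertible, [Psi] explicitly spans the
    orthogonal complement, and its Cholesky factor normalizes it. *)
Lemma orthogonal_completion {R : realType} {k : nat} (F1 F2 L : 'M[R]_k) :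
  F2 \in unitmx -> L \in unitmx -> F1 *m F1^T + F2 *m F2^T = L *m L^T ->
  exists O2 : 'M[R]_(k, k + k), let O := col_mx (invmx L *m row_mx F1 F2) O2 in O *m O^T = 1%:M.
Proof.
move=> uF uL FL; pose Psi := row_mx 1%:M (- (invmx F2 *m F1)^T).
have PP : Psi *m Psi^T = 1%:M + (invmx F2 *m F1)^T *m (invmx F2 *m F1).
  by rewrite tr_row_mx mul_row_col trmx1 mulmx1 [(- _)^T]linearN/= trmxK mulmxN mulNmx opprK.
have PP_pd : pdmx (Psi *m Psi^T).
  rewrite PP addrC; apply: pdmxD (pdmx1 k).
  by have := psdmx_mulmxT (invmx F2 *m F1)^T; rewrite trmxK.
have [M [_ _ MM]] := pdmx_cholesky PP_pd.
have uM : M \in unitmx.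
  by move: (pdmx_unit PP_pd); rewrite MM unitmx_mul => /andP[].
exists (invmx M *m Psi) => /=; set Phi := row_mx F1 F2.
have PhiPhi : Phi *m Phi^T = L *m L^T by rewrite tr_row_mx mul_row_col.
have PhiPsi : Phi *m Psi^T = 0.
  rewrite tr_row_mx mul_row_col trmx1 mulmx1 [(- _)^T]linearN/= trmxK mulmxN mulmxA.
  by rewrite mulmxV// mul1mx subrr.
have PsiPhi : Psi *m Phi^T = 0 by rewrite -[LHS]trmxK trmx_mul trmxK PhiPsi trmx0.
have uLT : L^T \in unitmx by rewrite unitmx_tr.
have uMT : M^T \in unitmx by rewrite unitmx_tr.
rewrite tr_col_mx mul_col_row !trmx_mul !trmx_inv !mulmxA.
rewrite -[invmx L *m Phi *m Phi^T]mulmxA PhiPhi -[invmx L *m Phi *m Psi^T]mulmxA PhiPsi.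
rewrite -[invmx M *m Psi *m Phi^T]mulmxA PsiPhi -[invmx M *m Psi *m Psi^T]mulmxA MM.
rewrite !mulmx0 !mul0mx !mulmxA mulVmx// mulVmx// !mul1mx mulmxV// mulmxV//.
by rewrite -scalar_mx_block.
Qed.

Section mutual_info_upper_bound.
Context {R : realType} {d} {T : measurableType d} (P : probability T R).
Context {d1} {T1 : measurableType d1} {d2} {T2 : measurableType d2}.
Variables (X : T -> T1) (Y : T -> T2).
Hypotheses (mX : measurable_fun setT X) (mY : measurable_fun setT Y).

(* Tangent inequality ln z <= z - 1 at z = c * exp (- l), where c is the density
   ratio averaged over E. *)
Lemma info_term_le (E : set T) l (pq : R) : measurable E -> intg P l -> 0 <= pq ->
  (pq = 0 -> pr P E = 0) ->
  (\int[P]_t (\1_E t * expR (- l t))%:E = pq%:E)%E ->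
  pr P E * ln (pr P E / pq) <= \int[P]_t (\1_E t * l t).
Proof.
move=> mE li pq0 pqE El; have [P0|Pn0] := eqVneq (pr P E) 0.
  by rewrite P0 mul0r (Rintegral_indic_null mE li P0).
have E0 : 0 < pr P E by rewrite lt_neqAle eq_sym Pn0 fine_ge0.
have {}pq0 : 0 < pq.
  by rewrite lt_neqAle pq0 andbT eq_sym; apply: contra_neq Pn0.
set c := pr P E / pq; have c0 : 0 < c by rewrite divr_gt0.
have ml := intg_measurable li; have E1 := intg_indic1 P mE.
have ei : intg P (fun t => \1_E t * expR (- l t)).
  apply/integrableP; split.
    apply/measurable_EFinP; apply: measurable_funM; first exact: measurable_indic.
    by apply: measurableT_comp => //; exact: measurableT_comp.
  rewrite (eq_integral (fun t => (\1_E t * expR (- l t))%:E)) => [|t _].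
    by rewrite El ltry.
  by rewrite /= ger0_norm// mulr_ge0// expR_ge0.
have i2 := intgZ (ln c + 1) E1; have i3 := intgZ c ei.
have El' : \int[P]_t (\1_E t * expR (- l t)) = pq by rewrite /Rintegral El.
apply: (@le_trans _ _ (\int[P]_t ((ln c + 1) * \1_E t - c * (\1_E t * expR (- l t))))).
  rewrite (RintegralB measurableT i2 i3) (RintegralZl _ measurableT E1).
  rewrite (RintegralZl _ measurableT ei) El' (Rintegral_indic P mE).
  by rewrite /c divfK ?gt_eqF// mulrDl mul1r addrK mulrC.
apply: Rintegral_le_ae; [exact: intgB|exact: intg_indic|apply: aeW => t].
have e0 := expR_gt0 (- l t); have := ln_le_subr1 (mulr_gt0 c0 e0).
rewrite lnM ?posrE// expRK indicE; move: (expR _) (ln c) => y z.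
by case: (t \in E) => /= h; rewrite ?mulr1n ?mulr0n; lra.
Qed.

(** [l] stands for the logarithm of the density of the joint law relative to the product of the
    marginals: on rectangles, [expR (- l)] turns the joint law into that product. The bound is the
    log-sum inequality, cell by cell. *)
Lemma mutual_info_le l : intg P l ->
  (forall A B, measurable A -> measurable B ->
    \int[P]_t (\1_(X @^-1` A `&` Y @^-1` B) t * expR (- l t))%:E =
    P (X @^-1` A) * P (Y @^-1` B))%E ->
  (mutual_info P X Y <= (\int[P]_t l t)%:E)%E.
Proof.
move=> li El; apply: ge_ereal_sup => _ [n [m [A [B [pA pB ->]]]]]; rewrite lee_fin.
have mA i : measurable (A i) by case: pA.
have mB j : measurable (B j) by case: pB.
have mXA i : measurable (X @^-1` A i) by exact: measurable_preimageU.
have mYB j : measurable (Y @^-1` B j) by exact: measurable_preimageU.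
have mE i j : measurable (X @^-1` A i `&` Y @^-1` B j) by exact: measurableI.
have fP E : measurable E -> P E = (pr P E)%:E.
  by move=> mE'; rewrite /pr fineK// fin_num_measure.
have -> : \int[P]_t l t = \sum_i \sum_j \int[P]_t (\1_(X @^-1` A i `&` Y @^-1` B j) t * l t).
  have lij i j : intg P (fun t => \1_(X @^-1` A i `&` Y @^-1` B j) t * l t) by exact: intg_indic.
  under eq_bigr do (rewrite -Rintegral_sum => [|j _]; last exact: lij).
  rewrite -Rintegral_sum => [|i _]; last by apply: intg_sum.
  apply: eq_Rintegral => t _.
  have E1 i j : \1_(X @^-1` A i `&` Y @^-1` B j) t = \1_(A i) (X t) * \1_(B j) (Y t) :> R.
    by rewrite indicI.
  under eq_bigr do under eq_bigr do rewrite E1.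
  under eq_bigr do rewrite -big_distrl/= -big_distrr/= sum_indic_partition// mulr1.
  by rewrite -big_distrl/= sum_indic_partition// mul1r.
apply: ler_sum => i _; apply: ler_sum => j _.
apply: info_term_le => //; first by rewrite mulr_ge0// fine_ge0.
  have le (D : set T) : measurable D -> X @^-1` A i `&` Y @^-1` B j `<=` D ->
      pr P D = 0 -> pr P (X @^-1` A i `&` Y @^-1` B j) = 0.
    move=> mD ED D0; apply/eqP; rewrite eq_le fine_ge0// andbT -D0.
    by apply: fine_le; rewrite ?fin_num_measure//; apply: le_measure; rewrite ?inE.
  move=> /eqP; rewrite mulf_eq0 => /orP[]/eqP; apply: le => //; exact: subIsetl || exact: subIsetr.
by rewrite El// EFinM -!fP.
Qed.

End mutual_info_upper_bound.

Section linear_vectors.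
Context {R : realType}.

Definition lin_tuple k n (M : 'M[R]_(k, n)) (t : n.-tuple R) : k.-tuple R :=
  tupv (M *m colv t).

Lemma measurable_lin_tuple k n (M : 'M[R]_(k, n)) : measurable_fun setT (lin_tuple M).
Proof. by apply: measurable_tupv; apply: measurable_vec_mul; exact: measurable_colv. Qed.

HB.instance Definition _ k n (M : 'M[R]_(k, n)) :=
  isMeasurableFun.Build _ _ _ _ (lin_tuple M) (measurable_lin_tuple M).

Lemma lin_tuple_gaussian k n (M : 'M[R]_(k, n)) :
  centered_gaussian (gauss n) (lin_tuple M) (M *m M^T).
Proof.
pose G (i : 'I_n) : {RV (gauss n) >-> R} := HB.pack (fun t : n.-tuple R => tnth t i)
  (isMeasurableFun.Build _ _ _ _ _ (measurable_tnth i)).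
exists n, M, G; split=> //.
  by move=> C mC; have := gauss_box mC.
apply: aeW => t; rewrite tupvK; congr (_ *m _).
Qed.

Lemma lin_tuple_L2 k n (M : 'M[R]_(k, n)) i : L2fun (gauss n) (fun t => (M *m colv t) i 0).
Proof.
have := (centered_gaussian_moments (measurable_lin_tuple M) (lin_tuple_gaussian M)).1 i.
by under eq_fun do rewrite tnth_mktuple.
Qed.

Lemma lin_tuple_second_moment k n (M : 'M[R]_(k, n)) i j :
  \int[gauss n]_t ((M *m colv t) i 0 * (M *m colv t) j 0) = (M *m M^T) i j.
Proof.
have := (centered_gaussian_moments (measurable_lin_tuple M) (lin_tuple_gaussian M)).2 i j.
by under eq_Rintegral do rewrite !tnth_mktuple.
Qed.

Lemma lin_tuple_sqn k n (M : 'M[R]_(k, n)) :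
  intg (gauss n) (fun t => sqn (M *m colv t)) /\
  \int[gauss n]_t sqn (M *m colv t) = \tr (M *m M^T).
Proof.
have L2 i := (lin_tuple_L2 M i).2; split.
  rewrite (_ : (fun _ => _) = fun t => \sum_i (M *m colv t) i 0 ^+ 2).
    by apply: intg_sum.
  by apply/funext => t; rewrite sqnE.
transitivity (\int[gauss n]_t \sum_i (M *m colv t) i 0 ^+ 2).
  by apply: eq_Rintegral => t _; rewrite sqnE.
rewrite Rintegral_sum//; apply: eq_bigr => i _; rewrite -lin_tuple_second_moment.
by apply: eq_Rintegral => t _; rewrite expr2.
Qed.

End linear_vectors.

(** * The channel U = C F1 g1 for X = F1 g1 + F2 g2 *)

Section channel.
Context {R : realType} {k : nat}.
Variables F1 F2 C L : 'M[R]_k.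
Hypotheses (uF2 : F2 \in unitmx) (uC : C \in unitmx) (uL : L \in unitmx).
Hypothesis FL : F1 *m F1^T + F2 *m F2^T = L *m L^T.

Let P := @gauss R (k + k).
Let S := L *m L^T.
Let K := F2 *m F2^T.
Let Phi : 'M[R]_(k, k + k) := row_mx F1 F2.
Let X : {RV P >-> k.-tuple R} := lin_tuple Phi.
Let G : 'M[R]_(k, k + k) := row_mx (C *m F1) 0.
Let U : {RV P >-> k.-tuple R} := lin_tuple G.
(** The linear regression coefficient of [U] on [X], which makes the noise U - A X uncorrelated with
    [X]. *)
Let A := C *m (F1 *m F1^T *m invmx S).
Let N : {RV P >-> k.-tuple R} := lin_tuple (G - A *m Phi).

Let PhiPhi : Phi *m Phi^T = S. Proof. by rewrite tr_row_mx mul_row_col. Qed.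

Let uS : S \in unitmx. Proof. by rewrite unitmx_mul uL unitmx_tr. Qed.

Let orth_noise : (G - A *m Phi) *m Phi^T = 0.
Proof.
rewrite mulmxBl -[A *m Phi *m _]mulmxA PhiPhi /A -!mulmxA mulVmx// mulmx1.
by rewrite tr_row_mx mul_row_col mul0mx addr0 mulmxA subrr.
Qed.

(** [X] is a function of the block [O1]. The matrix of the noise is orthogonal to the rows of [O1],
    so it factors through the complementary block [O2], and the blocks are independent. *)
Let joint_law B D : measurable B -> measurable D ->
  P (X @^-1` B `&` N @^-1` D) = (P (X @^-1` B) * P (N @^-1` D))%E /\
  P (X @^-1` B) = gauss k (lin_tuple L @^-1` B).
Proof.
move=> mB mD; have [ O2 /= orthO] := orthogonal_completion uF2 uL FL.
set O1 := invmx L *m _ in orthO.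
have LO : L *m O1 = Phi by rewrite mulmxA mulmxV// mul1mx.
have O1E : O1 = invmx L *m Phi by [].
have OTO := mulmx1C orthO; rewrite tr_col_mx mul_row_col in OTO.
pose M := G - A *m Phi.
have MPhi : M *m Phi^T = 0 by exact: orth_noise.
have MO1 : M *m O1^T = 0 by rewrite O1E trmx_mul mulmxA MPhi mul0mx.
have ME : M = M *m O2^T *m O2.
  by rewrite -[LHS]mulmx1 -OTO mulmxDr !mulmxA MO1 !mul0mx add0r.
pose B' := lin_tuple L @^-1` B; pose D' := lin_tuple (M *m O2^T) @^-1` D.
have mB' : measurable B' by rewrite -[X in measurable X]setTI; exact: measurable_lin_tuple.
have mD' : measurable D' by rewrite -[X in measurable X]setTI; exact: measurable_lin_tuple.
have XB : X @^-1` B = [set t | B' (tupv (O1 *m colv t))].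
  by apply/seteqP; split=> t; rewrite /B' /X /preimage/= /lin_tuple tupvK mulmxA LO.
have ND : N @^-1` D = [set t | D' (tupv (O2 *m colv t))].
  by apply/seteqP; split=> t; rewrite /D' /N /preimage/= /lin_tuple tupvK mulmxA -ME.
have PX : P (X @^-1` B) = gauss k B'.
  have := gauss_orthogonal_blocks orthO mB' measurableT.
  rewrite probability_setT mule1 => <-; congr (P _); rewrite XB.
  by apply/seteqP; split=> t //= -[].
have PN : P (N @^-1` D) = gauss k D'.
  have := gauss_orthogonal_blocks orthO measurableT mD'.
  rewrite probability_setT mul1e => <-; congr (P _); rewrite ND.
  by apply/seteqP; split=> t //= -[].
split=> //; rewrite PX PN -(gauss_orthogonal_blocks orthO mB' mD'); congr (P _).
by rewrite XB ND.
Qed.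

Lemma channel_indep : indep_rv P X N.
Proof. by move=> B D mB mD; have [] := joint_law mB mD. Qed.

Let Mu : 'M[R]_(k, k + k) := row_mx F1 0.
Let Mv : 'M[R]_(k, k + k) := row_mx 0 F2.

Let PhiE : Phi = Mu + Mv. Proof. by rewrite /Mu /Mv add_row_mx addr0 add0r. Qed.

Let MvE (t : (k + k).-tuple R) i :
  (Mv *m colv t) i 0 = \sum_j F2 i j * tnth t (rshift k j).
Proof.
rewrite -[colv t]vsubmxK mul_row_col mul0mx add0r mxE; apply: eq_bigr => j _.
by rewrite !mxE.
Qed.

Let U_dep (t t' : (k + k).-tuple R) :
  (forall j, tnth t (lshift k j) = tnth t' (lshift k j)) -> U t = U t'.
Proof.
move=> tt'; rewrite /U /= /lin_tuple -[colv t]vsubmxK -[colv t']vsubmxK.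
rewrite !mul_row_col !mul0mx; congr (tupv (_ *m _ + _)).
by apply/colP => j; rewrite !mxE tt'.
Qed.

(** [U] depends on the first block g1 only, and each coordinate of g2 has mean zero against any
    square integrable function of the other coordinates. *)
Let noise_orth B i : measurable B ->
  \int[P]_t (\1_B (U t) * (Mv *m colv t) i 0) = 0.
Proof.
move=> mB; have mU : measurable_fun setT U by [].
have mUB := measurable_preimageU mU mB.
have L2B : L2fun P (fun t => \1_B (U t)).
  apply: (@L2_bounded _ _ _ _ _ 1).
    by apply: measurableT_comp => //; exact: measurable_indic.
  by move=> t; rewrite indicE ger0_norm ?ler0n// lern1 leq_b1.
have tB j : intg P (fun t => tnth t (rshift k j) * \1_B (U t)).
  by apply: L2_mul => //; exact: gauss_coord_L2.
transitivity (\int[P]_t \sum_j F2 i j * (tnth t (rshift k j) * \1_B (U t))).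
  apply: eq_Rintegral => t _; rewrite MvE big_distrr/=; apply: eq_bigr => j _.
  by rewrite mulrCA [\1_B _ * _]mulrC.
rewrite Rintegral_sum => [|j _]; last exact: intgZ.
apply: big1 => j _; rewrite (RintegralZl _ measurableT (tB j)) gauss_mean_mul ?mulr0//.
move=> t t' tt'; congr (\1_B _); apply: U_dep => l; apply: tt'.
by rewrite eq_lrshift.
Qed.

(** F1 g1 = C^-1 U is a function of [U] even for singular [F1], and the remainder F2 g2 is
    orthogonal to all events of [U]. So the regression is C^-1 U and the residual has covariance F2
    F2^T. *)
Lemma channel_cond_cov : cond_cov P U X = K.
Proof.
have mU : measurable_fun setT U by [].
have xL i : L2fun P (fun t => tnth (X t) i).
  by under eq_fun do rewrite tnth_mktuple; exact: lin_tuple_L2.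
pose g i (u : k.-tuple R) := (invmx C *m colv u) i 0.
have gU i t : g i (U t) = (Mu *m colv t) i 0.
  by rewrite /g tupvK mulmxA /G mul_mx_row mulmx0 mulmxA mulVmx// mul1mx.
have xE i t : tnth (X t) i = g i (U t) + (Mv *m colv t) i 0.
  by rewrite tnth_mktuple gU PhiE mulmxDl addmxE.
have reg i : is_regression P U (fun t => tnth (X t) i) (g i).
  have gi : intg P (g i \o U).
    rewrite (_ : g i \o U = fun t => (Mu *m colv t) i 0); last exact/funext/gU.
    by apply: L2_intg; exact: lin_tuple_L2.
  have vi : intg P (fun t => (Mv *m colv t) i 0) by apply: L2_intg; exact: lin_tuple_L2.
  apply/(is_regressionP mU); first exact: L2_intg; split=> //.
    by apply: (measurable_vec_mul (invmx C) _ i); exact: measurable_colv.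
  move=> B mB; have mUB := measurable_preimageU mU mB.
  transitivity (\int[P]_t (\1_B (U t) * g i (U t) + \1_B (U t) * (Mv *m colv t) i 0)).
    rewrite (RintegralD measurableT (intg_indic mUB gi) (intg_indic mUB vi)).
    by rewrite noise_orth// addr0.
  by apply: eq_Rintegral => t _; rewrite xE mulrDr.
have res : {ae P, forall t i, cond_residual P U X t i 0 = (Mv *m colv t) i 0}.
  apply: filter_forall => i; apply: filterS (cond_exp_ae mU (L2_intg (xL i)) (reg i)) => t.
  by rewrite mxE => ->; rewrite xE addrC addKr.
have mres i : measurable_fun setT (fun t => cond_residual P U X t i 0).
  under eq_fun do rewrite mxE; apply: measurable_funB; first by case: (xL i).
  by case: (L2_cond_exp mU (xL i)).
have mv i : measurable_fun setT (fun t : (k + k).-tuple R => (Mv *m colv t) i 0).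
  by case: (lin_tuple_L2 Mv i).
apply/matrixP => i j; rewrite mxE unlock.
transitivity (\int[P]_t (cond_residual P U X t i 0 * cond_residual P U X t j 0)).
  by rewrite /Rintegral; congr fine; apply: eq_integral => t _; rewrite mxE big_ord1 [_^T _ _]mxE.
transitivity (\int[P]_t ((Mv *m colv t) i 0 * (Mv *m colv t) j 0)).
  apply: Rintegral_ae; [exact: measurable_funM|exact: measurable_funM|].
  by apply: filterS res => t rt; rewrite !rt.
rewrite lin_tuple_second_moment; congr (fun_of_matrix _ i j).
by rewrite tr_row_mx mul_row_col trmx0 mulmx0 add0r.
Qed.

Let D2 := `|\det (invmx L *m F2)|.
Let E2 : 'M[R]_(k, k + k) := row_mx 0 1%:M.
(* the log-density of the law of (X, U) with respect to the product of its
   marginals *)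
Let l (t : (k + k).-tuple R) :=
  2^-1 * (sqn (invmx L *m Phi *m colv t) - sqn (E2 *m colv t)) - ln D2.

Let uLF : invmx L *m F2 \in unitmx. Proof. by rewrite unitmx_mul unitmx_inv uL. Qed.

Let D2_gt0 : 0 < D2. Proof. by rewrite normr_gt0 -unitfE -unitmxE. Qed.

Let expl t : expR (- l t) =
  wexp (sqn (E2 *m colv t)) (sqn (invmx L *m Phi *m colv t)) * D2.
Proof.
rewrite /l opprB addrC expRD lnK ?posrE// /wexp; congr (expR _ * _).
by rewrite -mulrN opprB.
Qed.

Let l_intg : intg P l.
Proof.
apply: intgB; last exact: intg_cst.
by apply/intgZ/intgB; [exact: (lin_tuple_sqn _).1|exact: (lin_tuple_sqn _).1].
Qed.

(** Both squared norms have mean k and cancel; what remains is - ln [D2], and the square of [D2] is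
    [\det K / \det S]. *)
Let l_mean : \int[P]_t l t = 2^-1 * ln (\det S / \det K).
Proof.
have [i1 m1] := lin_tuple_sqn (invmx L *m Phi); have [i2 m2] := lin_tuple_sqn E2.
rewrite (RintegralB measurableT (intgZ _ (intgB i1 i2)) (intg_cst P _)) Rintegral_cst1.
rewrite (RintegralZl _ measurableT (intgB i1 i2)) (RintegralB measurableT i1 i2) m1 m2.
have -> : invmx L *m Phi *m (invmx L *m Phi)^T = 1%:M.
  rewrite trmx_mul mulmxA -[invmx L *m Phi *m _]mulmxA PhiPhi /S mulmxA mulVmx// mul1mx.
  by rewrite -trmx_mul mulVmx// trmx1.
have -> : E2 *m E2^T = 1%:M by rewrite tr_row_mx mul_row_col mul0mx add0r trmx1 mulmx1.
rewrite subrr mulr0 sub0r.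
have dL : \det L != 0 by rewrite -unitfE -unitmxE.
have dF : \det F2 != 0 by rewrite -unitfE -unitmxE.
have -> : \det S / \det K = D2^-1 ^+ 2.
  rewrite exprVn real_normK ?num_real// !det_mulmx !det_tr det_inv.
  by move: (\det L) (\det F2) dL dF => a b a0 b0; field; rewrite a0 b0.
by rewrite lnXn ?invr_gt0// lnV ?posrE//; move: (ln D2) => z; field.
Qed.

(** For g1 = u fixed, L^-1 X is an affine image of g2 with matrix L^-1 F2. The weight and Jacobian
    that make it standard Gaussian are exactly [expR (- l)], so the inner integral is the marginal
    probability of [X], independent of u. *)
Let density A' B : measurable A' -> measurable B ->
  (\int[P]_t (\1_(X @^-1` A' `&` U @^-1` B) t * expR (- l t))%:E =
   P (X @^-1` A') * P (U @^-1` B))%E.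
Proof.
move=> mA mB; have [_ ->] := joint_law mA measurableT.
have mX : measurable_fun setT X by []; have mU : measurable_fun setT U by [].
have mXA := measurable_preimageU mX mA; have mUB := measurable_preimageU mU mB.
have mE : measurable (X @^-1` A' `&` U @^-1` B) by exact: measurableI.
pose u0 (u : k.-tuple R) := tupv (C *m F1 *m colv u).
have UE u v : U (cat_tuplev (u, v)) = u0 u.
  by rewrite /U /= /lin_tuple /cat_tuplev tupvK mul_row_col mul0mx addr0.
pose AL : set (k.-tuple R) := lin_tuple L @^-1` A'.
have mAL : measurable AL by rewrite -[X in measurable X]setTI; exact: measurable_lin_tuple.
have ml := intg_measurable l_intg.
rewrite ge0_integral_gauss_cat; first last.
- by move=> t; rewrite lee_fin mulr_ge0// expR_ge0.
- apply/measurable_EFinP; apply: measurable_funM; first exact: measurable_indic.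
  by apply: measurableT_comp => //; exact: measurableT_comp.
have mu0 : measurable_fun setT u0.
  by apply: measurable_tupv; apply: measurable_vec_mul; exact: measurable_colv.
have mu0B : measurable (u0 @^-1` B) by exact: measurable_preimageU.
have inner u : (\int[gauss k]_v (\1_(X @^-1` A' `&` U @^-1` B) (cat_tuplev (u, v)) *
    expR (- l (cat_tuplev (u, v))))%:E = (\1_(u0 @^-1` B) u)%:E * gauss k AL)%E.
  have mF : measurable_fun setT (fun w : k.-tuple R => (\1_AL w : R)%:E).
    by apply/measurable_EFinP; exact: measurable_indic.
  pose s := invmx L *m F1 *m colv u.
  have F0 w : (0 <= (\1_AL w : R)%:E)%E by rewrite lee_fin.
  have := gauss_affine_unit s uLF mF F0; rewrite integral_indic// setIT => <-.
  have XE v : invmx L *m Phi *m colv (cat_tuplev (u, v)) = invmx L *m F2 *m colv v + s.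
    by rewrite tupvK -mulmxA mul_row_col mulmxDr addrC /s !mulmxA.
  have EE v : E2 *m colv (cat_tuplev (u, v)) = colv v.
    by rewrite tupvK mul_row_col mul0mx add0r mul1mx.
  rewrite -ge0_integralZl//; first last.
  - by move=> v _; rewrite mule_ge0// lee_fin// mulr_ge0// wexp_ge0.
  - exact: (measurable_gauss_affine (invmx L *m F2) s mF).
  apply: eq_integral => v _; rewrite expl XE EE -!EFinM mulrA; congr ((_ * _)%:E).
  have XA : X (cat_tuplev (u, v)) = lin_tuple L (tupv (invmx L *m F2 *m colv v + s)).
    by rewrite /lin_tuple tupvK -XE !mulmxA mulmxV// mul1mx.
  rewrite indicI /= mulrC /AL !indicE; congr (_%:R * _%:R).
    congr nat_of_bool; apply/idP/idP => /set_mem h; apply/mem_set; move: h; rewrite /preimage/= UE //.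
  by congr nat_of_bool; apply/idP/idP => /set_mem h; apply/mem_set; move: h; rewrite /preimage/= -/(X _) XA.
rewrite (eq_integral (fun u => ((\1_(u0 @^-1` B) u)%:E * gauss k AL)%E)) => [|u _]; last exact: inner.
rewrite ge0_integralZr//; last by apply/measurable_EFinP; exact: measurable_indic.
rewrite integral_indic// setIT muleC; congr (_ * _)%E.
rewrite gauss_cat// -[LHS]mule1 -(probability_setT (gauss k)).
rewrite -(product_measure1E (gauss k) (gauss k))//; congr (_ _).
by apply/seteqP; split=> -[u v]; rewrite /preimage/= UE => // -[].
Qed.

Lemma channel_mutual_info :
  mutual_info P X U = (2^-1 * ln (\det S / \det K))%:E.
Proof.
have mX : measurable_fun setT X by []; have mU : measurable_fun setT U by [].
have S_pd : pdmx S.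
  have := pdmx_congr (pdmx1 k) (_ : L^T \in unitmx); rewrite unitmx_tr trmxK mulmx1.
  exact.
have gX : centered_gaussian P X S by rewrite -PhiPhi; exact: lin_tuple_gaussian.
have ub := mutual_info_le mX mU l_intg density; rewrite l_mean in ub.
have lb rho : (mutual_info P X U <= rho%:E)%E -> 2^-1 * ln (\det S / \det K) <= rho.
  move=> Irho; have [] : feasible S rho (cond_cov P U X); last by rewrite channel_cond_cov.
  apply: (gaussian_information_bound mX gX S_pd mU) => n B pB.
  exact: mutual_info_chain.
move: ub lb; case: (mutual_info P X U) => [rho ub lb|//|_ lb].
  by congr (_%:E); apply/le_anti/andP; split; [rewrite -lee_fin|exact: lb].
(* The value -oo would make every real number an upper bound, including one below the rate. *)
have := lb (2^-1 * ln (\det S / \det K) - 1) (leNye _).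
by move: (ln _) => z h; exfalso; lra.
Qed.

End channel.

Lemma feasible_gaussian_test_channel {R : realType} {k : nat} (S : 'M[R]_k) r K :
  pdmx S -> feasible S r K -> gaussian_test_channel S r K.
Proof.
move=> S_pd [K_pd SK rate].
have [F1 [_ _ F1E]] := psdmx_cholesky SK; have [F2 [_ _ F2E]] := pdmx_cholesky K_pd.
have [L [_ _ LE]] := pdmx_cholesky S_pd.
have uF2 : F2 \in unitmx by move: (pdmx_unit K_pd); rewrite F2E unitmx_mul => /andP[].
have uL : L \in unitmx by move: (pdmx_unit S_pd); rewrite LE unitmx_mul => /andP[].
have FL : F1 *m F1^T + F2 *m F2^T = L *m L^T by rewrite -F1E -F2E -LE subrK.
(* F1 g1 = A0 X + noise; rescaling by C = A0^-1 gives the form X + N, which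
   requires S - K to be invertible. *)
pose A0 := F1 *m F1^T *m invmx (L *m L^T).
have [C [uC CA]] : exists C : 'M[R]_k, C \in unitmx /\ (loewner_lt K S -> C *m A0 = 1%:M).
  have [KS|nKS] := pselect (loewner_lt K S); last by exists 1%:M; rewrite unitmx1.
  exists (invmx A0); have uA0 : A0 \in unitmx.
    by rewrite unitmx_mul -F1E pdmx_unit//= unitmx_inv -LE pdmx_unit.
  by split=> [|_]; rewrite ?unitmx_inv// mulVmx.
pose G : 'M[R]_(k, k + k) := row_mx (C *m F1) 0.
pose A := C *m A0; pose M := G - A *m row_mx F1 F2.
exists _, _, (gauss (k + k)), (lin_tuple (row_mx F1 F2)), (lin_tuple M), (lin_tuple G).
exists A, (M *m M^T); split; split.
- by rewrite LE -FL -mul_row_col -tr_row_mx; exact: lin_tuple_gaussian.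
- exact: lin_tuple_gaussian.
- exact: (channel_indep C uF2 uL FL).
- by move=> t; rewrite !tupvK mulmxBl mulmxA addrC subrK.
- exact: CA.
- by rewrite (channel_cond_cov F1 F2 uC).
- by rewrite (channel_mutual_info uF2 uC uL FL) -LE -F2E.
- by rewrite (channel_mutual_info uF2 uC uL FL) -LE -F2E lee_fin.
Qed.

Theorem theorem7 (R : realType) (k : nat) (k_gt0 : (0 < k)%N)
    (SX B We : 'M[R]_k) (SX_pd : pdmx SX) (We_pd : pdmx We)
    (L : nat) (r : nat -> R) (Rtot_ge0 : 0 <= \sum_(0 <= l < L) r l) :
  let Wt := Wtilde We B in
  let Rtot := \sum_(0 <= l < L) r l in
  [/\ (* the minimum defining D_opt is attained *)
      (exists K, is_optimal SX Wt Rtot K) /\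
      (forall K, is_optimal SX Wt Rtot K -> \tr (Wt *m K) = Dopt SX Wt Rtot),
      (* converse *)
      (forall (d : measure_display) (T : measurableType d) (P : probability T R)
          (X : {RV P >-> k.-tuple R})
          (dZ : measure_display) (TZ : measurableType dZ) (Z : {RV P >-> TZ})
          (dH : nat -> measure_display) (TH : forall l, measurableType (dH l))
          (H : forall l, {RV P >-> TH l}),
        mechanism SX L r X Z H ->
        Dopt SX Wt Rtot <= \tr (Wt *m cond_cov P (H L) X)),
      (* achievability *)
      (forall K, is_optimal SX Wt Rtot K -> gaussian_test_channel SX Rtot K) &
      (* interior optimum *)
      (forall Kstar, pdmx Wt -> is_optimal SX Wt Rtot Kstar ->
        loewner_lt Kstar SX ->
        let nustar := expR (k%:R^-1 *
          (ln (\det SX) + ln (\det Wt) - 2 * Rtot)) in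
        [/\ Kstar = nustar *: invmx Wt,
            (forall K, is_optimal SX Wt Rtot K -> K = Kstar) &
            Dopt SX Wt Rtot =
              k%:R * (\det SX * \det Wt) `^ (k%:R^-1)
                * expR (- 2 * (Rtot / k%:R))])].
Proof.
move=> Wt Rtot; split.
- split; first exact: is_optimal_exists.
  exact: is_optimal_Dopt.
- move=> d T P X dZ TZ Z dH TH H mH; apply: Dopt_le => //.
  exact: mechanism_feasible mH.
- by move=> K [fK _]; exact: feasible_gaussian_test_channel.
- by move=> K W_pd oK KS; exact: interior_optimum.
Qed.
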